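(* Let each of $Y$ and $Z$ be either one of the two solutions $Y_+$, $Y_-$ of the boundary value problem $2y''=y^2-s$ $(s>0)$, $y(0)=0$, $y(s)-s^{1/2}\to 0$ as $s\to\infty$ (the choices of $Y$ and $Z$ being independent of each other). Then there exist constants $0<\delta\ll D$, $C>0$ and $A_0>0$, all independent of $A$, such that for every $A\ge A_0$ there is a solution $u=u_{YZ}$ (depending on $A$) of $$2u''=u^2-A(1-x^2),\quad x\in(-1,1),\qquad u(-1)=u(1)=0,$$ satisfying: (1) near $x=-1$: $$\left|u(x)-(2A)^{2/5}Y\big((2A)^{1/5}(x+1)\big)\right|\le C A^{2/5}(x+1)\quad\text{for } 0\le x+1\le (2A)^{-1/5}D,$$ $$\left|u(x)-(2A)^{2/5}Y\big((2A)^{1/5}(x+1)\big)\right|\le C A^{1/2}(x+1)^{3/2}\quad\text{for } (2A)^{-1/5}D\le x+1\le \delta;$$ (2) near $x=1$: $$\left|u(x)-(2A)^{2/5}Z\big((2A)^{1/5}(1-x)\big)\right|\le C A^{2/5}(1-x)\quad\text{for } 0\le 1-x\le (2A)^{-1/5}D,$$ $$\left|u(x)-(2A)^{2/5}Z\big((2A)^{1/5}(1-x)\big)\right|\le C A^{1/2}(1-x)^{3/2}\quad\text{for } (2A)^{-1/5}D\le 1-x\le \delta;$$ (3) in the interior: $$\left|u(x)-\sqrt{A(1-x^2)}\right|\le C(1-x^2)^{-2}\quad\text{for } x\in\left[-1+(2A)^{-1/5}D,\;1-(2A)^{-1/5}D\right].$$ Moreover, the following a priori estimate holds for the associated linearized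 operator: there exist constants $A_1,C>0$ such that if $A\in(A_1,\infty)$ and $\varphi\in C^2[-1,1]$, $f\in C[-1,1]$ satisfy $$-\varphi''+u_{YZ}\,\varphi=f,\quad x\in(-1,1),\qquad \varphi(-1)=0=\varphi(1),$$ then $$\|\varphi\|_{L^\infty(-1,1)}\le C A^{-2/5}\|f\|_{L^\infty(-1,1)}.$$
   Context: The boundary value problem $2y''=y^2-s$ for $s>0$, $y(0)=0$, $y(s)-s^{1/2}\to0$ as $s\to\infty$, has exactly two (classical) solutions: $Y_+$, which is strictly increasing on $[0,\infty)$, and $Y_-$, which satisfies $Y_-'(0)<0$ and has exactly one local minimum, located in $(0,\infty)$. The notation $0<\delta\ll D$ means that $\delta$ is a small constant and $D$ a large constant, with $\delta<D$. *)

(* Defs.v *)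
From Stdlib Require Import Reals.
From Coquelicot Require Import Coquelicot.
Open Scope R_scope.

(* [ex_derive_n f 2 x] alone does not force [f] to be differentiable, because
   [Derive] is total; hence the first conjunct. *)
Definition twice_derivable (f : R -> R) (x : R) : Prop :=
  ex_derive f x /\ ex_derive_n f 2 x.

Definition half_line (s : R) : Prop := 0 <= s.

Definition segment (a b x : R) : Prop := a <= x <= b.

(* Classical solutions of 2y'' = y^2 - s (s > 0), y(0) = 0, y(s) - sqrt s -> 0.
   Values at s < 0 are irrelevant: continuity at 0 is relative to [0, oo). *)
Definition layer_solution (y : R -> R) : Prop :=
  continuous_on half_line y /\
  (forall s, 0 < s ->
     twice_derivable y s /\ 2 * Derive_n y 2 s = (y s) ^ 2 - s) /\
  y 0 = 0 /\
  is_lim (fun s => y s - sqrt s) p_infty 0.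

Definition right_derivative (f : R -> R) (a l : R) : Prop :=
  filterlim (fun x => (f x - f a) / (x - a)) (at_right a) (locally l).

Definition local_min_on (E : R -> Prop) (f : R -> R) (m : R) : Prop :=
  E m /\ within E (locally m) (fun x => f m <= f x).

Definition is_Yplus (y : R -> R) : Prop :=
  layer_solution y /\ (forall s t, 0 <= s -> s < t -> y s < y t).

Definition is_Yminus (y : R -> R) : Prop :=
  layer_solution y /\
  (exists l, right_derivative y 0 l /\ l < 0) /\
  (exists m, 0 < m /\ unique (local_min_on half_line y) m).

Definition bvp_solution (A : R) (u : R -> R) : Prop :=
  continuous_on (segment (-1) 1) u /\
  (forall x, -1 < x < 1 ->
     twice_derivable u x /\ 2 * Derive_n u 2 x = (u x) ^ 2 - A * (1 - x ^ 2)) /\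
  u (-1) = 0 /\ u 1 = 0.

(* C^2[a,b]: C^2 on (a,b), with the derivatives of order <= 2 extending
   continuously to [a,b]. *)
Definition C2_segment (a b : R) (f : R -> R) : Prop :=
  continuous_on (segment a b) f /\
  (forall x, a < x < b -> twice_derivable f x) /\
  exists f1 f2 : R -> R,
    continuous_on (segment a b) f1 /\ continuous_on (segment a b) f2 /\
    (forall x, a < x < b -> f1 x = Derive f x /\ f2 x = Derive_n f 2 x).

(* Lebesgue-null sets of reals. *)
Definition null_set (N : R -> Prop) : Prop :=
  forall eps : R, 0 < eps ->
  exists (a b : nat -> R) (l : R),
    (forall n, a n <= b n) /\
    (forall x, N x -> exists n, a n < x < b n) /\
    is_series (fun n => b n - a n) l /\ l <= eps.

(* L^oo(a,b) norm: the essential supremum of |f| on (a,b). *)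
Definition Linf_norm (a b : R) (f : R -> R) : Rbar :=
  Glb_Rbar (fun M => null_set (fun x => a < x < b /\ M < Rabs (f x))).

(* Main.v *)
Require Import Defs.
From Stdlib Require Import Reals Lra Psatz Classical ClassicalEpsilon.
From Coquelicot Require Import Coquelicot.
Open Scope R_scope.

(** Put [K = (2A)^(1/5)], [L = 2K] and [u x = K^2 U (K (x + 1))]: the problem becomes
    [2 U'' = U^2 - s (L - s) / L] on [0, L], and because
    [sqrt (s (L - s) / L) = sqrt s * sqrt (L - s) / sqrt L], the product
    [w s = Y s * Z (L - s) / sqrt L] of the two layers solves it up to [O(1/L)].
    The operator [- phi'' + P phi], with [P] close to [w], is inverted uniformly in [L]:
    nondegeneracy of a layer says that the solution [v] of [v'' = Y v], [v 0 = 0], satisfies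
    [v v' > 0] at some [s0] beyond which [Y > 0]; this turns the Dirichlet condition at [0] into a
    Robin condition of good sign at [s0], and between the two layers the maximum principle applies.
    A contraction then gives [U = w + O(1/L)]; all the stated estimates follow from this,
    except the interior one, which uses the barrier [(s (L - s) / L)^(-2)].

    Nondegeneracy is clear for [Y_+]. For [Y = Y_-], the Wronskian of [v] with [Y'] (which satisfies
    [(Y')'' = Y Y' - 1/2]) and an energy argument show that the first zero of [v] lies beyond the
    minimum of [Y]; after it, [v] cannot return to [0], by the same Wronskian. If [v] has no zero,
    the Wronskian with the scaling direction [2 Y + s Y'] prevents it from decaying. *)

(** * Calculus on the line *)

(** The choice [K ^ 5 = 2 * A] gives the rescaled forcing [s (L - s) / L] slope one at each end,
    which is the forcing of the layer equation. A uniform error [O(1/L)] for [U] is an error of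
    order [A^(1/5)] for [u]. This is too weak at the ends, where the bound must vanish linearly, and
    in the middle, where it must stay bounded. At the ends the equation for [U - Y] turns it into a
    bound on slopes; in the middle a barrier is needed. The obstacle to inverting the linearization
    is the interval where [Y_-] is negative: the maximum principle fails there, and only the initial
    value solution [v] carries information across it. Both Wronskians use a symmetry of
    [2 y'' = y^2] that the term [s] breaks. Translation gives [Y'], with source [- 1/2]. The family
    [lam^2 Y (lam s)] solves the equation with [s] replaced by [lam^5 s]; its derivative at
    [lam = 1] is [2 Y + s Y'], with source [- (5/2) s]. Since the sources have a fixed sign, each
    Wronskian is monotone as long as [v] keeps its sign. *)

Lemma is_derive_eq (f : R -> R) (x l l' : R) : is_derive f x l -> l = l' -> is_derive f x l'.
Proof. intros H E; rewrite <- E; exact H. Qed.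

Lemma is_derive_Rplus (f g : R -> R) (x a b : R) :
  is_derive f x a -> is_derive g x b -> is_derive (fun t => f t + g t) x (a + b).
Proof. intros Hf Hg. exact (is_derive_plus f g x a b Hf Hg). Qed.

Lemma is_derive_Rminus (f g : R -> R) (x a b : R) :
  is_derive f x a -> is_derive g x b -> is_derive (fun t => f t - g t) x (a - b).
Proof. intros Hf Hg. exact (is_derive_minus f g x a b Hf Hg). Qed.

Lemma is_derive_Rmult (f g : R -> R) (x a b : R) :
  is_derive f x a -> is_derive g x b ->
  is_derive (fun t => f t * g t) x (a * g x + f x * b).
Proof. intros Hf Hg. exact (is_derive_mult f g x a b Hf Hg Rmult_comm). Qed.

Lemma is_derive_Ropp (f : R -> R) (x a : R) :
  is_derive f x a -> is_derive (fun t => - f t) x (- a).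
Proof. intros Hf. exact (is_derive_opp f x a Hf). Qed.

Lemma is_derive_Rsqr (f : R -> R) (x a : R) :
  is_derive f x a -> is_derive (fun t => f t ^ 2) x (2 * f x * a).
Proof.
  intros Hf. apply (is_derive_eq _ _ (INR 2 * a * f x ^ 1)); [apply (is_derive_pow f 2 x a Hf) | simpl; ring].
Qed.

Lemma is_derive_Rcube (f : R -> R) (x a : R) :
  is_derive f x a -> is_derive (fun t => f t ^ 3) x (3 * f x ^ 2 * a).
Proof.
  intros Hf. apply (is_derive_eq _ _ (INR 3 * a * f x ^ 2)); [apply (is_derive_pow f 3 x a Hf) | simpl; ring].
Qed.

Lemma is_derive_Rdiv_const (f : R -> R) (x a c : R) :
  is_derive f x a -> is_derive (fun t => f t / c) x (a / c).
Proof.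
  intros Hf. apply (is_derive_ext (fun t => / c * f t)).
  - intros t; apply Rmult_comm.
  - apply (is_derive_eq _ _ (/ c * a)); [apply is_derive_scal, Hf | unfold Rdiv; ring].
Qed.

Lemma is_derive_Rconst (c x : R) : is_derive (fun _ => c) x 0.
Proof. exact (is_derive_const c x). Qed.

Lemma is_derive_Rid (x : R) : is_derive (fun t => t) x 1.
Proof. exact (is_derive_id x). Qed.

Lemma is_derive_reflect (f : R -> R) (L x a : R) :
  is_derive f (L - x) a -> is_derive (fun t => f (L - t)) x (- a).
Proof.
  intros Hf. apply (is_derive_eq _ _ ((0 - 1) * a)); [|ring].
  apply (is_derive_comp f (fun t => L - t)); [exact Hf|].
  apply is_derive_Rminus; [apply is_derive_Rconst | apply is_derive_Rid].
Qed.

(** The derivative is left as an existential variable and assembled from the hypotheses; [derive_by]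
    then compares it with the announced value. *)
Ltac der :=
  lazymatch goal with
  | |- is_derive (fun _ => ?c) _ _ => apply is_derive_Rconst
  | |- is_derive (fun t => t) _ _ => apply is_derive_Rid
  | |- is_derive (fun t => @?f t + @?g t) _ _ => eapply (is_derive_Rplus f g); der
  | |- is_derive (fun t => @?f t - @?g t) _ _ => eapply (is_derive_Rminus f g); der
  | |- is_derive (fun t => @?f t * @?g t) _ _ => eapply (is_derive_Rmult f g); der
  | |- is_derive (fun t => @?f t / ?c) _ _ => eapply (is_derive_Rdiv_const f); der
  | |- is_derive (fun t => - @?f t) _ _ => eapply (is_derive_Ropp f); der
  | |- is_derive (fun t => @?f t ^ 2) _ _ => eapply (is_derive_Rsqr f); der
  | |- is_derive (fun t => @?f t ^ 3) _ _ => eapply (is_derive_Rcube f); der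
  | |- is_derive (fun t => ?f (?L - t)) _ _ => eapply is_derive_reflect; der
  | |- is_derive (fun t => ?f t) ?x ?l => change (is_derive f x l); der
  | |- is_derive ?f _ _ =>
      match goal with H : context [is_derive f] |- _ => eapply H; solve [auto | lra] end
  end.
Tactic Notation "derive_by" tactic(tac) := eapply is_derive_eq; [ der | tac ].

Lemma is_derive_continuous (f : R -> R) (x l : R) : is_derive f x l -> continuous f x.
Proof. intros H. apply (ex_derive_continuous f x). exists l; exact H. Qed.

Lemma is_derive_continuity_pt (f : R -> R) (x l : R) : is_derive f x l -> continuity_pt f x.
Proof.
  intros H. apply continuity_pt_filterlim. exact (is_derive_continuous f x l H).
Qed.

(** * Mean value inequalities and local monotonicity *)

Lemma mean_value (f f1 : R -> R) (a b : R) :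
  a < b -> (forall x, a <= x <= b -> is_derive f x (f1 x)) ->
  exists c, a < c < b /\ f b - f a = f1 c * (b - a).
Proof.
  intros Hab H.
  destruct (MVT_cor2 f f1 a b Hab) as [c [H1 H2]].
  { intros c Hc. apply is_derive_Reals, H; exact Hc. }
  exists c; split; [exact H2 | exact H1].
Qed.

Lemma derive_ge0_le (f f1 : R -> R) (a b : R) :
  a <= b -> (forall x, a <= x <= b -> is_derive f x (f1 x)) ->
  (forall x, a < x < b -> 0 <= f1 x) -> f a <= f b.
Proof.
  intros Hab H Hp. destruct (Req_dec a b) as [->|Hne]; [lra|].
  destruct (mean_value f f1 a b) as [c [Hc E]]; [lra|exact H|].
  specialize (Hp c Hc). nra.
Qed.

Lemma derive_le0_le (f f1 : R -> R) (a b : R) :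
  a <= b -> (forall x, a <= x <= b -> is_derive f x (f1 x)) ->
  (forall x, a < x < b -> f1 x <= 0) -> f b <= f a.
Proof.
  intros Hab H Hp. destruct (Req_dec a b) as [->|Hne]; [lra|].
  destruct (mean_value f f1 a b) as [c [Hc E]]; [lra|exact H|].
  specialize (Hp c Hc). nra.
Qed.

Lemma derive_abs_le (f f1 g g1 : R -> R) (a b : R) :
  a <= b -> (forall x, a <= x <= b -> is_derive f x (f1 x)) ->
  (forall x, a <= x <= b -> is_derive g x (g1 x)) ->
  (forall x, a < x < b -> Rabs (f1 x) <= g1 x) -> Rabs (f b - f a) <= g b - g a.
Proof.
  intros Hab Hf Hg Hp.
  assert (H1 : g a - f a <= g b - f b).
  { apply (derive_ge0_le (fun t => g t - f t) (fun t => g1 t - f1 t)); [exact Hab| |].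
    - intros x Hx. derive_by reflexivity.
    - intros x Hx. specialize (Hp x Hx). pose proof (Rle_abs (f1 x)). lra. }
  assert (H2 : g a + f a <= g b + f b).
  { apply (derive_ge0_le (fun t => g t + f t) (fun t => g1 t + f1 t)); [exact Hab| |].
    - intros x Hx. derive_by reflexivity.
    - intros x Hx. specialize (Hp x Hx). pose proof (Rle_abs (- f1 x)).
      rewrite Rabs_Ropp in H. lra. }
  apply Rabs_le. lra.
Qed.

Lemma derive_zero_const (f : R -> R) (a b : R) :
  (forall x, Rmin a b <= x <= Rmax a b -> is_derive f x 0) -> f a = f b.
Proof.
  intros H. destruct (Rle_lt_dec a b) as [Hab|Hab].
  - rewrite Rmin_left, Rmax_right in H by lra.
    pose proof (derive_ge0_le f (fun _ => 0) a b Hab H (fun _ _ => Rle_refl 0)).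
    pose proof (derive_le0_le f (fun _ => 0) a b Hab H (fun _ _ => Rle_refl 0)). lra.
  - rewrite Rmin_right, Rmax_left in H by lra.
    pose proof (derive_ge0_le f (fun _ => 0) b a ltac:(lra) H (fun _ _ => Rle_refl 0)).
    pose proof (derive_le0_le f (fun _ => 0) b a ltac:(lra) H (fun _ _ => Rle_refl 0)). lra.
Qed.

Lemma is_derive_pos_local (f : R -> R) (x l : R) :
  is_derive f x l -> 0 < l ->
  exists d, 0 < d /\ (forall t, x < t < x + d -> f x < f t) /\
            (forall t, x - d < t < x -> f t < f x).
Proof.
  intros H Hl. apply is_derive_Reals in H.
  destruct (H (l / 2)) as [d Hd]; [lra|].
  exists d. split; [apply cond_pos|].
  split; intros t Ht.
  - specialize (Hd (t - x) ltac:(lra)). rewrite Rabs_right in Hd by lra.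
    specialize (Hd ltac:(lra)). replace (x + (t - x)) with t in Hd by ring.
    apply Rabs_def2 in Hd. destruct Hd as [_ Hd].
    assert (l / 2 < (f t - f x) / (t - x)) by lra.
    apply (Rmult_lt_compat_r (t - x)) in H0; [|lra].
    unfold Rdiv in H0 at 2. rewrite Rmult_assoc, Rinv_l in H0 by lra. nra.
  - specialize (Hd (t - x) ltac:(lra)). rewrite Rabs_left in Hd by lra.
    specialize (Hd ltac:(lra)). replace (x + (t - x)) with t in Hd by ring.
    apply Rabs_def2 in Hd. destruct Hd as [_ Hd].
    assert (l / 2 < (f t - f x) / (t - x)) by lra.
    apply (Rmult_lt_compat_r (x - t)) in H0; [|lra].
    replace ((f t - f x) / (t - x) * (x - t)) with (f x - f t) in H0 by (field; lra). nra.
Qed.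

Lemma is_derive_neg_local (f : R -> R) (x l : R) :
  is_derive f x l -> l < 0 ->
  exists d, 0 < d /\ (forall t, x < t < x + d -> f t < f x) /\
            (forall t, x - d < t < x -> f x < f t).
Proof.
  intros H Hl.
  destruct (is_derive_pos_local (fun t => - f t) x (- l)) as [d [Hd [H1 H2]]].
  - derive_by reflexivity.
  - lra.
  - exists d. split; [exact Hd|]. split; intros t Ht; [specialize (H1 t Ht)|specialize (H2 t Ht)]; lra.
Qed.

(** * Maxima, the maximum principle and first zeros *)

Lemma max_conditions (f f1 f2 : R -> R) (a b : R) :
  a < b -> (forall x, a <= x <= b -> is_derive f x (f1 x)) ->
  (forall x, a <= x <= b -> is_derive f1 x (f2 x)) ->
  exists e, a <= e <= b /\ (forall x, a <= x <= b -> f x <= f e) /\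
    (e < b -> f1 e <= 0) /\ (a < e -> 0 <= f1 e) /\ (a < e < b -> f2 e <= 0).
Proof.
  intros Hab H1 H2.
  destruct (continuity_ab_maj f a b) as [e [He Hab']]; [lra| |].
  { intros c Hc. exact (is_derive_continuity_pt f c _ (H1 c Hc)). }
  exists e. split; [exact Hab'|]. split; [exact He|].
  assert (A : e < b -> f1 e <= 0).
  { intros Hlt. destruct (Rle_lt_dec (f1 e) 0) as [|Hpos]; [assumption|exfalso].
    destruct (is_derive_pos_local f e (f1 e) (H1 e Hab') Hpos) as [d [Hd [Hr _]]].
    set (t := Rmin (e + d / 2) b).
    assert (e < t <= b /\ t < e + d).
    { unfold t, Rmin. destruct Rle_dec; lra. }
    specialize (Hr t ltac:(lra)). specialize (He t ltac:(lra)). lra. }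
  assert (B : a < e -> 0 <= f1 e).
  { intros Hlt. destruct (Rle_lt_dec 0 (f1 e)) as [|Hneg]; [assumption|exfalso].
    destruct (is_derive_neg_local f e (f1 e) (H1 e Hab') Hneg) as [d [Hd [_ Hl]]].
    set (t := Rmax (e - d / 2) a).
    assert (a <= t < e /\ e - d < t).
    { unfold t, Rmax. destruct Rle_dec; lra. }
    specialize (Hl t ltac:(lra)). specialize (He t ltac:(lra)). lra. }
  split; [exact A|]. split; [exact B|].
  intros [Ha Hb]. specialize (A Hb). specialize (B Ha).
  destruct (Rle_lt_dec (f2 e) 0) as [|Hpos]; [assumption|exfalso].
  destruct (is_derive_pos_local f1 e (f2 e) (H2 e Hab') Hpos) as [d [Hd [Hr _]]].
  set (t := Rmin (e + d / 2) b).
  assert (Ht : e < t <= b /\ t < e + d).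
  { unfold t, Rmin. destruct Rle_dec; lra. }
  destruct (mean_value f f1 e t) as [c [Hc E]]; [lra| |].
  { intros x Hx. apply H1; lra. }
  specialize (Hr c ltac:(lra)). specialize (He t ltac:(lra)). nra.
Qed.

Lemma max_principle (f f1 f2 : R -> R) (a b : R) :
  a < b -> (forall x, a <= x <= b -> is_derive f x (f1 x)) ->
  (forall x, a <= x <= b -> is_derive f1 x (f2 x)) ->
  f a <= 0 -> f b <= 0 -> (forall x, a < x < b -> 0 < f x -> 0 < f2 x) ->
  forall x, a <= x <= b -> f x <= 0.
Proof.
  intros Hab H1 H2 Ha Hb Hp x Hx.
  destruct (max_conditions f f1 f2 a b Hab H1 H2) as [e [He [Hm [_ [_ Hi]]]]].
  specialize (Hm x Hx).
  destruct (Req_dec e a) as [->|Hea]; [lra|].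
  destruct (Req_dec e b) as [->|Heb]; [lra|].
  destruct (Rle_lt_dec (f e) 0); [lra|].
  specialize (Hi ltac:(lra)). specialize (Hp e ltac:(lra) r). lra.
Qed.

(** Positivity on [(0, d)] is assumed because the functions of interest vanish at [0]. The zero is
    the supremum of the [t] such that [f > 0] on [(0, t)]. *)
Lemma first_zero (f : R -> R) (x0 d : R) :
  (forall x, continuity_pt f x) -> 0 < d -> (forall t, 0 < t < d -> 0 < f t) ->
  0 < x0 -> f x0 <= 0 ->
  exists b, 0 < b <= x0 /\ f b = 0 /\ (forall t, 0 < t < b -> 0 < f t).
Proof.
  intros Hc Hd Hp Hx0 Hf.
  set (E := fun t => 0 < t /\ forall u, 0 < u < t -> 0 < f u).
  assert (Hbd : forall t, E t -> t <= x0).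
  { intros t [Ht HE]. destruct (Rle_lt_dec t x0); [assumption|].
    specialize (HE x0 ltac:(lra)). lra. }
  destruct (completeness E) as [b [Hub Hlub]].
  - exists x0. intros t Ht. apply Hbd, Ht.
  - exists d. split; assumption.
  - assert (Hdb : d <= b) by (apply Hub; split; assumption).
    assert (Hpos : forall t, 0 < t < b -> 0 < f t).
    { intros t Ht. destruct (classic (exists u, E u /\ t < u)) as [[u [[_ HE] Hu]]|Hn].
      - apply HE; lra.
      - exfalso. assert (b <= t); [|lra]. apply Hlub. intros u Hu.
        destruct (Rle_lt_dec u t); [assumption|]. exfalso. apply Hn. exists u; split; assumption. }
    exists b. split; [split; [lra|apply Hlub; exact Hbd]|]. split; [|exact Hpos].
    destruct (Rtotal_order (f b) 0) as [Hlt|[Heq|Hgt]]; [exfalso|exact Heq|exfalso].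
    + pose proof (Hc b) as Hcb. destruct (Hcb (- f b) ltac:(lra)) as [al [Hal H]].
      set (t := Rmax (b - al / 2) (b / 2)).
      assert (Ht : 0 < t < b /\ b - al < t).
      { unfold t, Rmax. destruct Rle_dec; lra. }
      specialize (Hpos t ltac:(lra)).
      specialize (H t). unfold D_x, no_cond, dist in H; simpl in H; unfold Rdist in H.
      assert (Rabs (f t - f b) < - f b).
      { apply H. split; [split; [trivial|lra]|]. rewrite Rabs_left; lra. }
      apply Rabs_def2 in H0. lra.
    + pose proof (Hc b) as Hcb. destruct (Hcb (f b) ltac:(lra)) as [al [Hal H]].
      assert (b + al / 2 <= b); [|lra]. apply Hub. split; [lra|]. intros u Hu.
      destruct (Rlt_le_dec u b); [apply Hpos; lra|].
      destruct (Req_dec u b) as [->|Hne]; [lra|].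
      specialize (H u). unfold D_x, no_cond, dist in H; simpl in H; unfold Rdist in H.
      assert (Rabs (f u - f b) < f b).
      { apply H. split; [split; [trivial|lra]|]. rewrite Rabs_right; lra. }
      apply Rabs_def2 in H0. lra.
Qed.

(** * Primitives, clamping and continuity *)

Lemma RInt_is_derive (G : R -> R) (a x : R) :
  (forall t, continuous G t) -> is_derive (fun s => RInt G a s) x (G x).
Proof.
  intros HG. apply (is_derive_RInt G (fun s => RInt G a s) a x).
  - apply filter_forall. intros s. apply (RInt_correct G a s).
    apply (ex_RInt_continuous G). intros z _. apply HG.
  - apply HG.
Qed.

Definition clamp (a b x : R) : R := Rmax a (Rmin b x).

Lemma clamp_in (a b x : R) : a <= b -> a <= clamp a b x <= b.
Proof. intros H. unfold clamp, Rmax, Rmin. repeat destruct Rle_dec; lra. Qed.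

Lemma clamp_id (a b x : R) : a <= x <= b -> clamp a b x = x.
Proof. intros H. unfold clamp, Rmax, Rmin. repeat destruct Rle_dec; lra. Qed.

Lemma clamp_contract (a b x y : R) : Rabs (clamp a b x - clamp a b y) <= Rabs (x - y).
Proof.
  unfold clamp, Rmax, Rmin. repeat destruct Rle_dec; unfold Rabs; repeat destruct Rcase_abs; lra.
Qed.

(** Clamping the argument turns continuity relative to a segment into continuity on the line, so
    that integrals and primitives are available without side conditions. *)
Lemma continuous_clamp_comp (f : R -> R) (a b : R) :
  a <= b -> continuous_on (segment a b) f -> forall x, continuous (fun t => f (clamp a b t)) x.
Proof.
  intros Hab Hf x. specialize (Hf (clamp a b x) (clamp_in a b x Hab)).
  intros P HP. specialize (Hf P HP). destruct Hf as [d Hd].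
  exists d. intros t Ht. apply Hd.
  - eapply Rle_lt_trans; [apply (clamp_contract a b t x)|exact Ht].
  - apply clamp_in, Hab.
Qed.

Lemma continuous_on_of_continuous (D : R -> Prop) (f : R -> R) :
  (forall x, D x -> continuous f x) -> continuous_on D f.
Proof.
  intros H x Hx P HP. destruct (H x Hx P HP) as [d Hd]. exists d. intros t Ht _. apply Hd, Ht.
Qed.

Lemma continuous_continuity_pt (f : R -> R) (x : R) : continuous f x <-> continuity_pt f x.
Proof. symmetry. apply continuity_pt_filterlim. Qed.

Lemma continuous_eps (f : R -> R) (x : R) :
  continuous f x <->
  forall e, 0 < e -> exists d, 0 < d /\ forall t, Rabs (t - x) < d -> Rabs (f t - f x) < e.
Proof.
  split.
  - intros H e He. destruct (H (fun z => Rabs (z - f x) < e)) as [d Hd].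
    + exists (mkposreal e He). intros z Hz. exact Hz.
    + exists d. split; [apply cond_pos|]. intros t Ht. apply Hd. exact Ht.
  - intros H P [e HP]. destruct (H e (cond_pos e)) as [d [Hd Hd']].
    exists (mkposreal d Hd). intros t Ht. apply HP. apply Hd'. exact Ht.
Qed.

Ltac conjs := repeat match goal with |- _ /\ _ => split end.

(** * Linear initial value problems *)

Lemma bounded_on_segment (f : R -> R) (a b : R) :
  a <= b -> (forall x, a <= x <= b -> continuous f x) ->
  exists M, 0 < M /\ forall x, a <= x <= b -> Rabs (f x) <= M.
Proof.
  intros Hab Hf.
  destruct (continuity_ab_maj f a b Hab) as [p [Hp _]].
  { intros c Hc. apply continuous_continuity_pt, Hf, Hc. }
  destruct (continuity_ab_min f a b Hab) as [q [Hq _]].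
  { intros c Hc. apply continuous_continuity_pt, Hf, Hc. }
  exists (1 + Rabs (f p) + Rabs (f q)). split.
  - pose proof (Rabs_pos (f p)). pose proof (Rabs_pos (f q)). lra.
  - intros x Hx. specialize (Hp x Hx). specialize (Hq x Hx).
    pose proof (Rle_abs (f p)). pose proof (Rle_abs (- f q)). rewrite Rabs_Ropp in H0.
    pose proof (Rabs_pos (f p)). pose proof (Rabs_pos (f q)).
    apply Rabs_le. lra.
Qed.

(** Integrating [G] twice from [m], with the value and slope of [f] at [m], continues [f] beyond
    [I]. The end points of [I] thereby acquire two-sided derivatives. *)
Lemma C2_extension (I : R -> Prop) (f G : R -> R) (m : R) :
  (forall x y t, I x -> I y -> x <= t <= y -> I t) -> I m ->
  (forall x, continuous G x) ->
  (forall x, I x -> twice_derivable f x /\ Derive_n f 2 x = G x) ->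
  exists g g1 : R -> R, (forall x, is_derive g x (g1 x)) /\ (forall x, is_derive g1 x (G x)) /\
    forall x, I x -> g x = f x.
Proof.
  intros HI Hm HG Hf.
  set (g1 := fun x => Derive f m + RInt G m x).
  assert (Hg1 : forall x, is_derive g1 x (G x)).
  { intros x. unfold g1. apply (is_derive_eq _ _ (0 + G x)); [|ring].
    apply is_derive_Rplus; [apply is_derive_Rconst|apply RInt_is_derive, HG]. }
  set (g := fun x => f m + RInt g1 m x).
  assert (Hg : forall x, is_derive g x (g1 x)).
  { intros x. unfold g. apply (is_derive_eq _ _ (0 + g1 x)); [|ring].
    apply is_derive_Rplus; [apply is_derive_Rconst|apply RInt_is_derive].
    intros t. exact (is_derive_continuous g1 t _ (Hg1 t)). }
  assert (Hin : forall x t, I x -> Rmin m x <= t <= Rmax m x -> I t).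
  { intros x t Hx Ht. destruct (Rle_lt_dec m x).
    - rewrite Rmin_left, Rmax_right in Ht by lra. apply (HI m x); assumption.
    - rewrite Rmin_right, Rmax_left in Ht by lra. apply (HI x m); assumption. }
  assert (D1 : forall t, I t -> is_derive f t (Derive f t)).
  { intros t Ht. apply Derive_correct. apply (Hf t Ht). }
  assert (D2 : forall t, I t -> is_derive (Derive f) t (G t)).
  { intros t Ht. destruct (Hf t Ht) as [[_ H2] E]. rewrite <- E. apply (Derive_correct (Derive f)). exact H2. }
  assert (E1 : forall x, I x -> Derive f x = g1 x).
  { intros x Hx.
    assert (E : Derive f m - g1 m = Derive f x - g1 x).
    { apply (derive_zero_const (fun t => Derive f t - g1 t)). intros t Ht.
      specialize (D2 t (Hin x t Hx Ht)). specialize (Hg1 t). derive_by ring. }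
    unfold g1 in E at 1. rewrite RInt_point in E. unfold zero in E; simpl in E. lra. }
  exists g, g1. split; [exact Hg|]. split; [exact Hg1|].
  intros x Hx.
  assert (E : f m - g m = f x - g x).
  { apply (derive_zero_const (fun t => f t - g t)). intros t Ht.
    specialize (D1 t (Hin x t Hx Ht)). rewrite (E1 t (Hin x t Hx Ht)) in D1.
    specialize (Hg t). derive_by ring. }
  unfold g in E at 1. rewrite RInt_point in E. unfold zero in E; simpl in E. lra.
Qed.

(** Used to carry the equality of a function and its [C2_extension] from an open interval to its end
    points. *)
Lemma eq_at_limit_point (E : R -> Prop) (f g : R -> R) (a : R) :
  filterlim f (within E (locally a)) (locally (f a)) -> continuous g a ->
  (forall d, 0 < d -> exists t, Rabs (t - a) < d /\ E t /\ g t = f t) -> g a = f a.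
Proof.
  intros Hf Hg H. apply NNPP; intros Hne.
  set (e := Rabs (g a - f a) / 2).
  assert (He : 0 < e).
  { unfold e. assert (0 < Rabs (g a - f a)); [apply Rabs_pos_lt; lra|lra]. }
  destruct (Hf (fun z => Rabs (z - f a) < e)) as [d1 H1].
  { exists (mkposreal e He). intros z Hz. exact Hz. }
  destruct (proj1 (continuous_eps g a) Hg e He) as [d2 [Hd2 H2]].
  destruct (H (Rmin d1 d2)) as [t [Ht [HE Et]]].
  { apply Rmin_glb_lt; [apply cond_pos|exact Hd2]. }
  assert (A : Rabs (f t - f a) < e).
  { apply H1; [|exact HE]. eapply Rlt_le_trans; [exact Ht|apply Rmin_l]. }
  assert (B : Rabs (g t - g a) < e).
  { apply H2. eapply Rlt_le_trans; [exact Ht|apply Rmin_r]. }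
  rewrite Et in B.
  assert (Rabs (g a - f a) <= Rabs (f t - f a) + Rabs (f t - g a)).
  { unfold Rabs; repeat destruct Rcase_abs; lra. }
  unfold e in *. lra.
Qed.

Lemma half_pow_pos (n : nat) : 0 < (1 / 2) ^ n.
Proof. apply pow_lt; lra. Qed.

Lemma half_pow_small (K e : R) : 0 < e -> exists n, K * (1 / 2) ^ n < e.
Proof.
  intros He. destruct (pow_lt_1_zero (1 / 2)) with (y := e / (1 + Rabs K)) as [n Hn].
  - rewrite Rabs_right; lra.
  - apply Rdiv_lt_0_compat; [exact He|pose proof (Rabs_pos K); lra].
  - exists n. specialize (Hn n (le_n n)). pose proof (half_pow_pos n).
    rewrite Rabs_right in Hn by lra. pose proof (Rabs_pos K). pose proof (Rle_abs K).
    apply (Rmult_lt_compat_r (1 + Rabs K)) in Hn; [|lra].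
    unfold Rdiv in Hn at 2. rewrite Rmult_assoc, Rinv_l in Hn by lra. nra.
Qed.

Lemma le_of_half_pow (x K : R) : (forall n, x <= K * (1 / 2) ^ n) -> x <= 0.
Proof.
  intros H. destruct (Rle_lt_dec x 0) as [|Hx]; [assumption|].
  destruct (half_pow_small K x Hx) as [n Hn]. specialize (H n). lra.
Qed.

(** Serves both fixed-point constructions: Picard iteration for the linear problem and the
    contraction for the nonlinear one. The rate is kept because it identifies the limit as a fixed
    point. *)
Lemma geometric_limit (u : nat -> R -> R) :
  (forall n x, continuous (u n) x) ->
  (forall B, 0 < B -> exists K, forall n x, Rabs x <= B ->
     Rabs (u (S n) x - u n x) <= K * (1 / 2) ^ n) ->
  exists f : R -> R, (forall x, continuous f x) /\
    forall B, 0 < B -> exists K, forall n x, Rabs x <= B -> Rabs (u n x - f x) <= K * (1 / 2) ^ n.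
Proof.
  intros Hc Hu.
  assert (Htail : forall B, 0 < B -> exists K, forall n k x, Rabs x <= B ->
     Rabs (u (n + k)%nat x - u n x) <= K * (1 / 2) ^ n).
  { intros B HB. destruct (Hu B HB) as [K HK]. exists (2 * K).
    intros n k x Hx.
    assert (Rabs (u (n + k)%nat x - u n x) <= 2 * K * ((1 / 2) ^ n - (1 / 2) ^ (n + k))).
    { induction k as [|k IH].
      - rewrite Nat.add_0_r, Rminus_diag, Rabs_R0. lra.
      - rewrite Nat.add_succ_r. specialize (HK (n + k)%nat x Hx).
        replace (u (S (n + k)) x - u n x)
          with ((u (S (n + k)) x - u (n + k)%nat x) + (u (n + k)%nat x - u n x)) by ring.
        eapply Rle_trans; [apply Rabs_triang|]. simpl. lra. }
    specialize (HK 0%nat x Hx). pose proof (Rabs_pos (u 1%nat x - u 0%nat x)). simpl in HK.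
    pose proof (half_pow_pos (n + k)). nra. }
  assert (Hlim : forall x, exists l, Un_cv (fun n => u n x) l).
  { intros x. destruct (Htail (1 + Rabs x)) as [K HK]; [pose proof (Rabs_pos x); lra|].
    destruct (Rcomplete.R_complete (fun n => u n x)) as [l Hl]; [|exists l; exact Hl].
    intros e He. destruct (half_pow_small K (e / 2)) as [N HN]; [lra|].
    exists N. intros n m Hn Hm. unfold Rdist.
    replace n with (N + (n - N))%nat by lia. replace m with (N + (m - N))%nat by lia.
    pose proof (HK N (n - N)%nat x ltac:(lra)). pose proof (HK N (m - N)%nat x ltac:(lra)).
    replace (u (N + (n - N))%nat x - u (N + (m - N))%nat x) with
      ((u (N + (n - N))%nat x - u N x) - (u (N + (m - N))%nat x - u N x)) by ring.
    eapply Rle_lt_trans; [apply Rabs_triang|]. rewrite Rabs_Ropp. lra. }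
  destruct (choice _ Hlim) as [f Hf]. exists f.
  assert (Herr : forall B, 0 < B ->
    exists K, forall n x, Rabs x <= B -> Rabs (u n x - f x) <= K * (1 / 2) ^ n).
  { intros B HB. destruct (Htail B HB) as [K HK]. exists K. intros n x Hx.
    apply le_epsilon. intros e He. destruct (Hf x e He) as [N HN].
    specialize (HN (n + N)%nat ltac:(lia)). unfold Rdist in HN. specialize (HK n N x Hx).
    replace (u n x - f x) with ((u (n + N)%nat x - f x) - (u (n + N)%nat x - u n x)) by ring.
    eapply Rle_trans; [apply Rabs_triang|]. rewrite Rabs_Ropp. lra. }
  split; [|exact Herr].
  intros x. apply continuous_eps. intros e He.
  destruct (Herr (1 + Rabs x)) as [K HK]; [pose proof (Rabs_pos x); lra|].
  destruct (half_pow_small K (e / 3)) as [N HN]; [lra|].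
  destruct (proj1 (continuous_eps (u N) x) (Hc N x) (e / 3)) as [d [Hd Hd']]; [lra|].
  exists (Rmin d 1). split; [apply Rmin_glb_lt; lra|]. intros t Ht.
  assert (Ht1 : Rabs (t - x) < d) by (eapply Rlt_le_trans; [exact Ht|apply Rmin_l]).
  assert (Ht2 : Rabs (t - x) < 1) by (eapply Rlt_le_trans; [exact Ht|apply Rmin_r]).
  specialize (Hd' t Ht1). pose proof (HK N x ltac:(lra)).
  assert (Rabs t <= 1 + Rabs x).
  { pose proof (Rabs_triang (t - x) x). replace (t - x + x) with t in H0 by ring. lra. }
  pose proof (HK N t H0).
  replace (f t - f x) with (- (u N t - f t) + (u N t - u N x) + (u N x - f x)) by ring.
  eapply Rle_lt_trans; [apply Rabs_triang|].
  pose proof (Rabs_triang (- (u N t - f t)) (u N t - u N x)). rewrite Rabs_Ropp in H2. lra.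
Qed.

Lemma continuous_Rmax0 (f : R -> R) :
  (forall x, continuous f x) -> forall x, continuous (fun t => f (Rmax 0 t)) x.
Proof.
  intros Hf x. apply continuous_eps. intros e He.
  destruct (proj1 (continuous_eps f (Rmax 0 x)) (Hf _) e He) as [d [Hd H]].
  exists d. split; [exact Hd|]. intros t Ht. apply H.
  eapply Rle_lt_trans; [|exact Ht].
  unfold Rmax; repeat destruct Rle_dec; unfold Rabs; repeat destruct Rcase_abs; lra.
Qed.

Lemma continuous_Rplus (f g : R -> R) (x : R) :
  continuous f x -> continuous g x -> continuous (fun t => f t + g t) x.
Proof. intros Hf Hg. exact (continuous_plus f g x Hf Hg). Qed.

Lemma continuous_Rmult (f g : R -> R) (x : R) :
  continuous f x -> continuous g x -> continuous (fun t => f t * g t) x.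
Proof. intros Hf Hg. exact (continuous_mult f g x Hf Hg). Qed.

Lemma continuous_Rconst (c x : R) : continuous (fun _ : R => c) x.
Proof. exact (continuous_const c x). Qed.

Definition primitive2 (c : R) (g : R -> R) (s : R) : R :=
  RInt (fun t => c + RInt g 0 t) 0 s.

Lemma primitive2_derive (c : R) (g : R -> R) :
  (forall x, continuous g x) ->
  (forall s, is_derive (primitive2 c g) s (c + RInt g 0 s)) /\
  (forall s, is_derive (fun t => c + RInt g 0 t) s (g s)).
Proof.
  intros Hg.
  assert (H : forall s, is_derive (fun t => c + RInt g 0 t) s (g s)).
  { intros s. apply (is_derive_eq _ _ (0 + g s)); [|ring].
    apply is_derive_Rplus; [apply is_derive_Rconst|apply RInt_is_derive, Hg]. }
  split; [|exact H]. intros s. unfold primitive2.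
  apply (RInt_is_derive (fun t => c + RInt g 0 t)). intros t.
  exact (is_derive_continuous _ t _ (H t)).
Qed.

Lemma primitive2_0 (c : R) (g : R -> R) : primitive2 c g 0 = 0.
Proof. unfold primitive2. rewrite RInt_point. reflexivity. Qed.

Lemma primitive2_compare (c : R) (g h k k1 k2 : R -> R) (B : R) :
  (forall x, continuous g x) -> (forall x, continuous h x) ->
  (forall s, 0 <= s <= B -> is_derive k s (k1 s)) ->
  (forall s, 0 <= s <= B -> is_derive k1 s (k2 s)) ->
  0 <= k 0 -> 0 <= k1 0 ->
  (forall s, 0 <= s <= B -> Rabs (g s - h s) <= k2 s) ->
  forall s, 0 <= s <= B -> Rabs (primitive2 c g s - primitive2 c h s) <= k s.
Proof.
  intros Hg Hh Hk Hk1 Hk0 Hk10 Hb s Hs.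
  destruct (primitive2_derive c g Hg) as [G1 G2].
  destruct (primitive2_derive c h Hh) as [H1 H2].
  assert (First : forall r, 0 <= r <= B ->
    Rabs ((c + RInt g 0 r) - (c + RInt h 0 r)) <= k1 r).
  { intros r Hr.
    pose proof (derive_abs_le (fun t => (c + RInt g 0 t) - (c + RInt h 0 t))
                  (fun t => g t - h t) k1 k2 0 r ltac:(lra)) as A.
    cbv beta in A. rewrite !RInt_point in A. unfold zero in A; simpl in A.
    rewrite Rminus_diag, Rminus_0_r in A.
    eapply Rle_trans; [apply A|lra].
    - intros x Hx. apply is_derive_Rminus; [apply G2|apply H2].
    - intros x Hx. apply Hk1; lra.
    - intros x Hx. apply Hb; lra. }
  pose proof (derive_abs_le (fun t => primitive2 c g t - primitive2 c h t)
                (fun t => (c + RInt g 0 t) - (c + RInt h 0 t)) k k1 0 s ltac:(lra)) as A.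
  cbv beta in A. rewrite !primitive2_0, Rminus_diag, Rminus_0_r in A.
  eapply Rle_trans; [apply A|lra].
  - intros x Hx. apply is_derive_Rminus; [apply G1|apply H1].
  - intros x Hx. apply Hk; lra.
  - intros x Hx. apply First; lra.
Qed.

Lemma is_derive_exp_scal (m c x : R) :
  is_derive (fun t => c * exp (m * t)) x (c * m * exp (m * x)).
Proof. auto_derive; [trivial|ring]. Qed.

(** Picard iteration on the doubly integrated equation. The right-hand side is frozen at its value
    at [0] for negative arguments, so the derivatives at [0] are two-sided. *)
Lemma linear_ivp (P F : R -> R) (c : R) :
  (forall x, continuous P x) -> (forall x, continuous F x) ->
  exists x x1 : R -> R, x 0 = 0 /\ x1 0 = c /\
    (forall s, is_derive x s (x1 s)) /\
    (forall s, 0 <= s -> is_derive x1 s (P s * x s + F s)).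
Proof.
  intros HP HF.
  set (rhs := fun (w : R -> R) t => P (Rmax 0 t) * w (Rmax 0 t) + F (Rmax 0 t)).
  assert (Crhs : forall w, (forall x, continuous w x) -> forall x, continuous (rhs w) x).
  { intros w Hw x. apply (continuous_Rmax0 (fun t => P t * w t + F t)). intros t.
    apply continuous_Rplus; [apply continuous_Rmult|]; auto. }
  set (u := fix u (n : nat) : R -> R := match n with
     | O => fun _ => 0 | S n => fun s => primitive2 c (rhs (u n)) (Rmax 0 s) end).
  assert (Cu : forall n x, continuous (u n) x).
  { induction n as [|n IH]; intros x; simpl; [apply continuous_Rconst|].
    apply (continuous_Rmax0 (primitive2 c (rhs (u n)))). intros t.
    exact (is_derive_continuous _ t _ (proj1 (primitive2_derive c _ (Crhs _ IH)) t)). }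
  destruct (geometric_limit u Cu) as [w [Cw Hw]].
  { intros B HB.
    destruct (bounded_on_segment P 0 B) as [Q [HQ0 HQ]]; [lra|intros; apply HP|].
    destruct (bounded_on_segment (u 1%nat) 0 B) as [K [HK0 HK]]; [lra|intros; apply Cu|].
    (* In the norm weighted by [exp (m * s)], two integrations gain [1 / m ^ 2]; the inequality
       [2 * Q <= m * m] then halves the error at each iteration. *)
    set (m := 1 + 2 * Q).
    assert (Hm : 2 * Q <= m * m) by (unfold m; nra).
    assert (Step : forall n s, 0 <= s <= B ->
      Rabs (u (S n) s - u n s) <= K * (1 / 2) ^ n * exp (m * s)).
    { induction n as [|n IH]; intros s Hs.
      - change (u 0%nat s) with 0. rewrite Rminus_0_r. eapply Rle_trans; [apply HK, Hs|].
        assert (1 <= exp (m * s)); [|simpl; nra].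
        rewrite <- exp_0. destruct (Req_dec (m * s) 0) as [->|]; [lra|].
        left. apply exp_increasing. unfold m in *. nra.
      - change (u (S (S n)) s) with (primitive2 c (rhs (u (S n))) (Rmax 0 s)).
        change (u (S n) s) with (primitive2 c (rhs (u n)) (Rmax 0 s)).
        rewrite Rmax_right by lra.
        assert (Hmp : 0 < m) by (unfold m; lra).
        set (cn := K * (1 / 2) ^ n).
        assert (Hcn : 0 <= cn) by (unfold cn; pose proof (half_pow_pos n); nra).
        replace (K * (1 / 2) ^ S n) with (cn / 2) by (unfold cn; simpl; field).
        apply (primitive2_compare c (rhs (u (S n))) (rhs (u n))
           (fun s => cn / 2 * exp (m * s)) (fun s => cn / 2 * m * exp (m * s))
           (fun s => cn / 2 * m * m * exp (m * s)) B); try exact Hs; auto.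
        + intros r _. apply is_derive_exp_scal.
        + intros r _. apply is_derive_exp_scal.
        + pose proof (exp_pos (m * 0)). nra.
        + pose proof (exp_pos (m * 0)). apply Rmult_le_pos; [nra|lra].
        + intros r Hr. unfold rhs. rewrite Rmax_right by lra.
          replace (P r * u (S n) r + F r - (P r * u n r + F r))
            with (P r * (u (S n) r - u n r)) by ring.
          rewrite Rabs_mult. specialize (IH r Hr). specialize (HQ r Hr).
          fold cn in IH. pose proof (Rabs_pos (P r)). pose proof (Rabs_pos (u (S n) r - u n r)).
          pose proof (exp_pos (m * r)).
          apply Rle_trans with (Q * (cn * exp (m * r))); [apply Rmult_le_compat; lra|].
          replace (cn / 2 * m * m * exp (m * r)) with ((m * m / 2) * (cn * exp (m * r))) by field.
          apply Rmult_le_compat_r; [|lra]. apply Rmult_le_pos; lra. }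
    exists (K * exp (m * B)). intros n x Hx.
    assert (Hr : 0 <= Rmax 0 x <= B).
    { unfold Rmax, Rabs in *. destruct Rle_dec, Rcase_abs; lra. }
    assert (E : forall k, u k x = u k (Rmax 0 x)).
    { intros [|k]; [reflexivity|]. simpl. f_equal. symmetry. apply Rmax_right. apply Hr. }
    rewrite !E. eapply Rle_trans; [apply Step, Hr|].
    assert (exp (m * Rmax 0 x) <= exp (m * B)).
    { destruct (Req_dec (Rmax 0 x) B) as [->|]; [lra|]. left. apply exp_increasing.
      unfold m. nra. }
    pose proof (half_pow_pos n).
    replace (K * exp (m * B) * (1 / 2) ^ n) with (K * (1 / 2) ^ n * exp (m * B)) by ring.
    apply Rmult_le_compat_l; [nra|assumption]. }
  set (x := primitive2 c (rhs w)).
  destruct (primitive2_derive c (rhs w) (Crhs w Cw)) as [X1 X2].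
  assert (Fix : forall s, 0 <= s -> x s = w s).
  { intros s Hs.
    destruct (bounded_on_segment P 0 (1 + s)) as [Q [HQ0 HQ]]; [lra|intros; apply HP|].
    destruct (Hw (1 + s)) as [K HK]; [lra|].
    assert (Rabs (x s - w s) <= 0); [|pose proof (Rabs_pos (x s - w s));
      destruct (Req_dec (x s - w s) 0); [lra|pose proof (Rabs_pos_lt _ H1); lra]].
    apply (le_of_half_pow _ (Q * K * ((1 + s) * (1 + s)) + K)). intros n.
    assert (HK0 : forall n, 0 <= K * (1 / 2) ^ n).
    { intros k. eapply Rle_trans; [apply Rabs_pos|apply (HK k 0)]. rewrite Rabs_R0; lra. }
    assert (A : Rabs (x s - u (S n) s) <= Q * K * (1 / 2) ^ n * s * s).
    { simpl u. rewrite Rmax_right by lra.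
      apply (primitive2_compare c (rhs w) (rhs (u n))
        (fun r => Q * K * (1 / 2) ^ n * r * r) (fun r => 2 * Q * K * (1 / 2) ^ n * r)
        (fun r => 2 * Q * K * (1 / 2) ^ n) s); auto; try lra.
      - intros r Hr. derive_by ring.
      - intros r Hr. derive_by ring.
      - intros r Hr. unfold rhs. rewrite Rmax_right by lra.
        replace (P r * w r + F r - (P r * u n r + F r)) with (P r * - (u n r - w r)) by ring.
        rewrite Rabs_mult, Rabs_Ropp.
        specialize (HK n r ltac:(rewrite Rabs_right; lra)). specialize (HQ r ltac:(lra)).
        pose proof (Rabs_pos (P r)). pose proof (Rabs_pos (u n r - w r)). specialize (HK0 n).
        apply Rle_trans with (Q * (K * (1 / 2) ^ n)); [apply Rmult_le_compat; lra|nra]. }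
    pose proof (HK (S n) s ltac:(rewrite Rabs_right; lra)) as HB.
    replace (x s - w s) with ((x s - u (S n) s) + (u (S n) s - w s)) by ring.
    eapply Rle_trans; [apply Rabs_triang|].
    specialize (HK0 n). change ((1 / 2) ^ S n) with (1 / 2 * (1 / 2) ^ n) in HB.
    assert (Q * K * (1 / 2) ^ n * s * s <= Q * K * (1 / 2) ^ n * ((1 + s) * (1 + s))).
    { rewrite Rmult_assoc. apply Rmult_le_compat_l; nra. }
    lra. }
  exists x, (fun t => c + RInt (rhs w) 0 t).
  split; [apply primitive2_0|]. split.
  { rewrite RInt_point. unfold zero; simpl. ring. }
  split; [exact X1|]. intros s Hs. eapply is_derive_eq; [apply X2|].
  unfold rhs. rewrite Rmax_right by lra. rewrite (Fix s Hs). reflexivity.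
Qed.

(** * Asymptotics of layer solutions *)

(** A layer continued smoothly to the whole line, with decay rates valid down to [s = 0]. They are
    weaker than the rate [s^(-2)] of [layer_decay], but enough for a residual of order [1/L]. *)
Definition layer_profile (y y1 : R -> R) (C : R) : Prop :=
  0 < C /\ y 0 = 0 /\
  (forall s, is_derive y s (y1 s)) /\
  (forall s, 0 <= s -> is_derive y1 s ((y s ^ 2 - s) / 2)) /\
  (forall s, 0 <= s -> Rabs (y s - sqrt s) * (1 + s) <= C /\
     Rabs (y s ^ 2 - s) * (1 + s) <= C /\ Rabs (y1 s) * sqrt (1 + s) <= C).

Lemma continuous_on_half_line_Rmax (f : R -> R) :
  continuous_on half_line f -> forall x, continuous (fun t => f (Rmax 0 t)) x.
Proof.
  intros Hf x.
  specialize (Hf (Rmax 0 x) (Rmax_l 0 x)).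
  intros P HP. destruct (Hf P HP) as [d Hd].
  exists d. intros t Ht. apply Hd; [|apply Rmax_l].
  eapply Rle_lt_trans; [|exact Ht].
  unfold Rmax, abs, minus, plus, opp; simpl; repeat destruct Rle_dec; unfold Rabs;
    repeat destruct Rcase_abs; lra.
Qed.

Lemma layer_solution_smooth (Y : R -> R) :
  layer_solution Y -> exists y y1 : R -> R, y 0 = 0 /\
    (forall s, is_derive y s (y1 s)) /\
    (forall s, 0 <= s -> is_derive y1 s ((y s ^ 2 - s) / 2)) /\
    (forall s, 0 <= s -> y s = Y s).
Proof.
  intros [Hc [Hode [H0 _]]].
  pose proof (continuous_on_half_line_Rmax Y Hc) as Hc'.
  set (G := fun s => (Y (Rmax 0 s) ^ 2 - s) / 2).
  assert (CG : forall s, continuous G s).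
  { intros s. unfold G. apply (continuous_ext (fun t => Y (Rmax 0 t) * Y (Rmax 0 t) * / 2 + - / 2 * t)).
    - intros t. simpl. field.
    - apply continuous_Rplus; [apply continuous_Rmult; [apply continuous_Rmult|]|apply continuous_Rmult];
        auto using continuous_Rconst. apply continuous_id. }
  destruct (C2_extension (fun s => 0 < s) Y G 1) as [y [y1 [Hy [Hy1 E]]]]; try lra; auto.
  { intros x y t Hx _ Ht. lra. }
  { intros x Hx. destruct (Hode x Hx) as [T E]. split; [exact T|].
    unfold G. rewrite Rmax_right by lra. lra. }
  assert (E0 : y 0 = Y 0).
  { apply (eq_at_limit_point half_line); [apply Hc; unfold half_line; lra
      |exact (is_derive_continuous y 0 _ (Hy 0))|].
    intros d Hd. exists (d / 2). split; [rewrite Rminus_0_r, Rabs_right; lra|].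
    split; [unfold half_line; lra|apply E; lra]. }
  assert (E' : forall s, 0 <= s -> y s = Y s).
  { intros s [Hs|<-]; [apply E, Hs|exact E0]. }
  exists y, y1. split; [lra|]. split; [exact Hy|]. split; [|exact E'].
  intros s Hs. eapply is_derive_eq; [apply Hy1|]. unfold G. rewrite Rmax_right, E'; lra.
Qed.

Lemma is_derive_sqrt_pos (s : R) : 0 < s -> is_derive sqrt s (/ (2 * sqrt s)).
Proof.
  intros Hs. apply is_derive_Reals. apply derivable_pt_lim_sqrt, Hs.
Qed.

Lemma is_derive_inv_sqrt (s : R) :
  0 < s -> is_derive (fun t => / (2 * sqrt t)) s (- / (4 * sqrt s ^ 3)).
Proof.
  intros Hs. pose proof (sqrt_lt_R0 s Hs).
  eapply is_derive_eq.
  - apply (is_derive_inv (fun t => 2 * sqrt t)); [|nra].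
    apply is_derive_scal, is_derive_sqrt_pos, Hs.
  - field. lra.
Qed.

Lemma is_derive_inv_sqr (K s : R) : 0 < s -> is_derive (fun t => K / t ^ 2) s (- 2 * K / s ^ 3).
Proof. intros Hs. auto_derive; [simpl; nra|field; lra]. Qed.

Lemma is_derive_inv_cube (K s : R) :
  0 < s -> is_derive (fun t => - 2 * K / t ^ 3) s (6 * K / s ^ 4).
Proof. intros Hs. auto_derive; [simpl; apply Rgt_not_eq; repeat apply Rmult_lt_0_compat; lra|field; lra]. Qed.

Lemma Rdiv_le_intro (a b c : R) : 0 < b -> a <= c * b -> a / b <= c.
Proof. intros Hb H. apply Rle_div_l; lra. Qed.

Lemma Rle_div_intro (a b c : R) : 0 < b -> c * b <= a -> c <= a / b.
Proof. intros Hb H. apply Rle_div_r; lra. Qed.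

(** The difference [d = y - sqrt s] satisfies [d'' = (y^2 - s) / 2 + 1 / (4 s^(3/2))], where the
    first term is about [sqrt s * d]; balancing the two gives the size [s^(-2)]. The function
    [K / s^2] bounds [d] and [- d] by the maximum principle; the constant [e] takes care of the
    right end [T]. *)
Lemma layer_barrier (y y1 : R -> R) (S K e : R) :
  4 <= S -> 1 <= K -> 0 <= e ->
  (forall s, is_derive y s (y1 s)) ->
  (forall s, 0 <= s -> is_derive y1 s ((y s ^ 2 - s) / 2)) ->
  (forall s, S <= s -> Rabs (y s - sqrt s) <= 1 / 4) -> S ^ 2 <= K ->
  forall T, S < T -> Rabs (y T - sqrt T) <= e ->
  forall s, S <= s <= T -> Rabs (y s - sqrt s) <= K / s ^ 2 + e.
Proof.
  intros HS HK He H1 H2 Hd HSK T HT HeT s Hs.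
  assert (Hroot : forall s, S <= s -> 2 <= sqrt s /\ sqrt s ^ 2 = s).
  { intros r Hr. split; [|rewrite pow2_sqrt; lra].
    rewrite <- (sqrt_pow2 2) by lra. apply sqrt_le_1_alt. lra. }
  assert (HKS : 1 <= K / S ^ 2).
  { apply Rle_div_r; nra. }
  assert (KT : 0 < K / T ^ 2) by (apply Rdiv_lt_0_compat; nra).
  pose proof (Hd S (Rle_refl S)) as HdS.
  apply Rabs_le. apply Rabs_le_between in HeT, HdS. split.
  - assert (A : - (y s - sqrt s) - K / s ^ 2 - e <= 0); [|lra].
    apply (max_principle (fun t => - (y t - sqrt t) - K / t ^ 2 - e)
      (fun t => - (y1 t - / (2 * sqrt t)) - (- 2 * K / t ^ 3) - 0)
      (fun t => - ((y t ^ 2 - t) / 2 - (- / (4 * sqrt t ^ 3))) - 6 * K / t ^ 4 - 0) S T); auto.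
    + intros t Ht. apply is_derive_Rminus; [|apply is_derive_Rconst].
      apply is_derive_Rminus; [|apply is_derive_inv_sqr; lra].
      apply is_derive_Ropp, is_derive_Rminus; [apply H1|apply is_derive_sqrt_pos; lra].
    + intros t Ht. apply is_derive_Rminus; [|apply is_derive_Rconst].
      apply is_derive_Rminus; [|apply is_derive_inv_cube; lra].
      apply is_derive_Ropp, is_derive_Rminus; [apply H2; lra|apply is_derive_inv_sqrt; lra].
    + lra.
    + lra.
    + intros t Ht Hf. destruct (Hroot t ltac:(lra)) as [Hr Hr2].
      pose proof (Hd t ltac:(lra)) as Hdt. apply Rabs_le_between in Hdt.
      set (r := sqrt t) in *. clearbody r; subst t. set (d := r - y (r ^ 2)) in *.
      assert (Hy : y (r ^ 2) = r - d) by (unfold d; ring). rewrite Hy in *.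
      assert (Hd1 : K / (r ^ 2) ^ 2 < d) by lra.
      assert (X : K / r ^ 4 < d) by (replace (r ^ 4) with ((r ^ 2) ^ 2) by ring; exact Hd1).
      apply Rlt_div_l in X; [|apply pow_lt; lra].
      assert (Hd0 : 0 < d) by (pose proof (pow_lt r 4 ltac:(lra)); nra).
      assert (Y1 : d * r / 2 <= - (((r - d) ^ 2 - r ^ 2) / 2)) by nra.
      assert (Z : / (4 * r ^ 3) + 6 * K / (r ^ 2) ^ 4 < d * r / 2); [|lra].
      apply Rlt_le_trans with (K / (2 * r ^ 3)).
      * apply Rminus_lt_0.
        replace (K / (2 * r ^ 3) - (/ (4 * r ^ 3) + 6 * K / (r ^ 2) ^ 4))
          with (((2 * K - 1) * r ^ 5 - 24 * K) / (4 * r ^ 8)) by (field; lra).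
        apply Rdiv_lt_0_compat; [|apply Rmult_lt_0_compat; [lra|apply pow_lt; lra]].
        assert (32 <= r ^ 5).
        { replace 32 with (2 ^ 5) by ring. apply pow_incr; lra. }
        nra.
      * apply Rdiv_le_intro; [apply Rmult_lt_0_compat; [lra|apply pow_lt; lra]|].
        simpl in *; nra.
  - assert (A : (y s - sqrt s) - K / s ^ 2 - e <= 0); [|lra].
    apply (max_principle (fun t => (y t - sqrt t) - K / t ^ 2 - e)
      (fun t => (y1 t - / (2 * sqrt t)) - (- 2 * K / t ^ 3) - 0)
      (fun t => ((y t ^ 2 - t) / 2 - (- / (4 * sqrt t ^ 3))) - 6 * K / t ^ 4 - 0) S T); auto.
    + intros t Ht. apply is_derive_Rminus; [|apply is_derive_Rconst].
      apply is_derive_Rminus; [|apply is_derive_inv_sqr; lra].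
      apply is_derive_Rminus; [apply H1|apply is_derive_sqrt_pos; lra].
    + intros t Ht. apply is_derive_Rminus; [|apply is_derive_Rconst].
      apply is_derive_Rminus; [|apply is_derive_inv_cube; lra].
      apply is_derive_Rminus; [apply H2; lra|apply is_derive_inv_sqrt; lra].
    + lra.
    + lra.
    + intros t Ht Hf. destruct (Hroot t ltac:(lra)) as [Hr Hr2].
      set (r := sqrt t) in *. clearbody r; subst t. set (d := y (r ^ 2) - r) in *.
      assert (Hy : y (r ^ 2) = r + d) by (unfold d; ring). rewrite Hy in *.
      assert (Hd1 : K / (r ^ 2) ^ 2 < d) by lra.
      assert (X : K / r ^ 4 < d) by (replace (r ^ 4) with ((r ^ 2) ^ 2) by ring; exact Hd1).
      apply Rlt_div_l in X; [|apply pow_lt; lra].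
      assert (Hd0 : 0 < d) by (pose proof (pow_lt r 4 ltac:(lra)); nra).
      assert (Y1 : d * r <= (((r + d) ^ 2 - r ^ 2) / 2)) by nra.
      assert (P : 0 < / (4 * r ^ 3)).
      { apply Rinv_0_lt_compat, Rmult_lt_0_compat; [lra|apply pow_lt; lra]. }
      assert (Z : 6 * K / (r ^ 2) ^ 4 < d * r); [|lra].
      apply Rlt_le_trans with (K / r ^ 3).
      * apply Rminus_lt_0.
        replace (K / r ^ 3 - 6 * K / (r ^ 2) ^ 4)
          with ((K * r ^ 5 - 6 * K) / r ^ 8) by (field; lra).
        apply Rdiv_lt_0_compat; [|apply pow_lt; lra].
        assert (32 <= r ^ 5).
        { replace 32 with (2 ^ 5) by ring. apply pow_incr; lra. }
        nra.
      * apply Rdiv_le_intro; [apply pow_lt; lra|]. simpl in *; nra.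
Qed.

Lemma layer_decay (y y1 : R -> R) :
  (forall s, is_derive y s (y1 s)) ->
  (forall s, 0 <= s -> is_derive y1 s ((y s ^ 2 - s) / 2)) ->
  (forall e, 0 < e -> exists S, forall s, S < s -> Rabs (y s - sqrt s) < e) ->
  exists S K, 4 <= S /\ 1 <= K /\ forall s, S <= s ->
    Rabs (y s - sqrt s) <= 1 / 4 /\ Rabs (y s - sqrt s) <= K / s ^ 2.
Proof.
  intros H1 H2 H. destruct (H (1 / 4)) as [S0 HS0]; [lra|].
  set (S := Rmax 4 (S0 + 1)).
  assert (HS : 4 <= S) by apply Rmax_l.
  assert (HS' : S0 + 1 <= S) by apply Rmax_r.
  (* With [K = S ^ 2] the barrier equals one at [S], above the bound [1 / 4] known there. The right
     end [T] goes far out as [e] goes to zero. *)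
  exists S, (S ^ 2). split; [exact HS|]. split; [nra|].
  intros s Hs. split; [left; apply HS0; lra|]. apply le_epsilon. intros e He.
  destruct (H e He) as [T0 HT0].
  set (T := Rmax (s + 1) (T0 + 1)).
  assert (HT : s + 1 <= T) by apply Rmax_l.
  assert (HT' : T0 + 1 <= T) by apply Rmax_r.
  apply (layer_barrier y y1 S (S ^ 2) e HS) with (T := T); auto; try nra; try lra.
  - intros t Ht. left. apply HS0. lra.
  - left. apply HT0. lra.
Qed.

Lemma layer_profile_exists (Y : R -> R) :
  layer_solution Y -> exists y y1 C, layer_profile y y1 C /\ forall s, 0 <= s -> y s = Y s.
Proof.
  intros HY. destruct (layer_solution_smooth Y HY) as [y [y1 [H0 [H1 [H2 E]]]]].
  assert (Hlim : forall e, 0 < e -> exists S, forall s, S < s -> Rabs (y s - sqrt s) < e).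
  { intros e He. destruct HY as [_ [_ [_ HL]]].
    apply is_lim_spec in HL. destruct (HL (mkposreal e He)) as [S HS]. simpl in HS.
    exists (Rmax 0 S). intros s Hs.
    assert (0 < s) by (eapply Rle_lt_trans; [apply Rmax_l|exact Hs]).
    assert (S < s) by (eapply Rle_lt_trans; [apply Rmax_r|exact Hs]).
    specialize (HS s H3). rewrite Rminus_0_r in HS. rewrite E by lra. exact HS. }
  destruct (layer_decay y y1 H1 H2 Hlim) as [S [K [HS [HK Hd]]]].
  destruct (bounded_on_segment y 0 S) as [M [HM0 HM]]; [lra| |].
  { intros x _. exact (is_derive_continuous y x _ (H1 x)). }
  destruct (bounded_on_segment y1 0 S) as [M1 [HM10 HM1]]; [lra| |].
  { intros x Hx. exact (is_derive_continuous y1 x _ (H2 x ltac:(lra))). }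
  assert (Hroot : forall s, S <= s -> 2 <= sqrt s /\ sqrt s ^ 2 = s).
  { intros r Hr. split; [|rewrite pow2_sqrt; lra].
    rewrite <- (sqrt_pow2 2) by lra. apply sqrt_le_1_alt. lra. }
  assert (Hd' : forall s, S <= s -> s ^ 2 * Rabs (y s - sqrt s) <= K).
  { intros s Hs. destruct (Hd s Hs) as [_ Hds]. apply Rle_div_r in Hds; [lra|nra]. }
  assert (Hfar : forall s, S <= s -> Rabs (y s ^ 2 - s) * (1 + s) <= 2 * K).
  { intros s Hs. destruct (Hd s Hs) as [Hd4 _]. specialize (Hd' s Hs).
    destruct (Hroot s Hs) as [Hr Hr2].
    set (r := sqrt s) in *. set (d := y s - r) in *.
    replace (y s ^ 2 - s) with (d * (2 * r + d)) by (unfold d; nra).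
    rewrite Rabs_mult.
    assert (Rabs (2 * r + d) <= s + 1 / 4).
    { apply Rabs_le_between in Hd4. apply Rabs_le. nra. }
    assert (Rabs (2 * r + d) * (1 + s) <= 2 * s ^ 2).
    { apply Rle_trans with ((s + 1 / 4) * (1 + s)); [apply Rmult_le_compat_r; lra|nra]. }
    pose proof (Rabs_pos d). rewrite Rmult_assoc. nra. }
  (* Interpolation: some slope on [[s, s + 1]] equals the increment of [y], which is small because
     [y] is close to [sqrt], and the second derivative controls the change of slope from there to
     [s]. *)
  assert (Hslope : forall s, S <= s -> Rabs (y1 s) * sqrt (1 + s) <= 4 * K + 1).
  { intros s Hs.
    destruct (mean_value y y1 s (s + 1)) as [c [Hc Ec]]; [lra|intros; apply H1|].
    destruct (Hroot s Hs) as [Hr Hr2]. destruct (Hroot (s + 1) ltac:(lra)) as [Hq Hq2].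
    pose proof (Hd' s Hs) as A. pose proof (Hd' (s + 1) ltac:(lra)) as B.
    replace (1 + s) with (s + 1) by ring.
    set (r := sqrt s) in *. set (q := sqrt (s + 1)) in *.
    assert (Hrq : r <= q) by (apply sqrt_le_1_alt; lra).
    assert (Hqs : q <= s / 2 + 1) by nra.
    assert (D : Rabs (y1 s - y1 c) <= 2 * K / (1 + s)).
    { rewrite Rabs_minus_sym.
      pose proof (derive_abs_le y1 (fun t => (y t ^ 2 - t) / 2) (fun t => t * (2 * K / (1 + s)))
        (fun _ => 2 * K / (1 + s)) s c ltac:(lra)) as X. cbv beta in X.
      eapply Rle_trans; [apply X|].
      - intros t Ht. apply H2; lra.
      - intros t Ht. derive_by ring.
      - intros t Ht. apply Rle_div_r; [lra|]. specialize (Hfar t ltac:(lra)).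
        unfold Rdiv. rewrite Rabs_mult, (Rabs_right (/ 2)) by lra.
        pose proof (Rabs_pos (y t ^ 2 - t)). nra.
      - assert (0 <= 2 * K / (1 + s)) by (apply Rlt_le, Rdiv_lt_0_compat; lra).
        replace (c * (2 * K / (1 + s)) - s * (2 * K / (1 + s)))
          with ((c - s) * (2 * K / (1 + s))) by ring. nra. }
    assert (D' : (1 + s) * Rabs (y1 s - y1 c) <= 2 * K) by (apply Rle_div_r in D; lra).
    replace (s + 1 - s) with 1 in Ec by ring. rewrite Rmult_1_r in Ec.
    assert (F : Rabs (y1 c) <= Rabs (y s - r) + Rabs (y (s + 1) - q) + (q - r)).
    { rewrite <- Ec. replace (y (s + 1) - y s) with (- (y s - r) + (y (s + 1) - q) + (q - r)) by ring.
      eapply Rle_trans; [apply Rabs_triang|]. rewrite (Rabs_right (q - r)) by lra.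
      pose proof (Rabs_triang (- (y s - r)) (y (s + 1) - q)). rewrite Rabs_Ropp in H. lra. }
    assert (G0 : (q - r) * (q + r) = 1) by (simpl in *; lra).
    assert (G : (q - r) * q <= 1) by nra.
    assert (F' : Rabs (y1 s) <= Rabs (y1 s - y1 c) + Rabs (y1 c)).
    { replace (y1 s) with ((y1 s - y1 c) + y1 c) at 1 by ring. apply Rabs_triang. }
    pose proof (Rabs_pos (y s - r)). pose proof (Rabs_pos (y (s + 1) - q)).
    pose proof (Rabs_pos (y1 s - y1 c)).
    assert (q * Rabs (y1 s - y1 c) <= 2 * K) by nra.
    assert (Hq1 : q <= s ^ 2) by nra. assert (Hq3 : q <= (s + 1) ^ 2) by nra.
    assert (q * Rabs (y s - r) <= K).
    { eapply Rle_trans; [apply Rmult_le_compat_r; [lra|exact Hq1]|exact A]. }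
    assert (q * Rabs (y (s + 1) - q) <= K).
    { eapply Rle_trans; [apply Rmult_le_compat_r; [lra|exact Hq3]|exact B]. }
    nra. }
  exists y, y1, (4 * K + 1 + (M + S + S) * (1 + S) + (M * M + S) * (1 + S) + M1 * (1 + S)).
  split; [|exact E].
  assert (P1 : 0 < (M + S + S) * (1 + S)) by nra.
  assert (P2 : 0 < (M * M + S) * (1 + S)) by nra.
  assert (P3 : 0 < M1 * (1 + S)) by nra.
  split; [lra|]. split; [exact H0|]. split; [exact H1|]. split; [exact H2|].
  intros s Hs. destruct (Rle_lt_dec S s) as [HsS|HsS].
  - specialize (Hfar s HsS). specialize (Hslope s HsS). specialize (Hd' s HsS).
    pose proof (Rabs_pos (y s - sqrt s)). split; [nra|]. lra.
  - specialize (HM s ltac:(lra)). specialize (HM1 s ltac:(lra)).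
    assert (0 <= sqrt s) by apply sqrt_pos.
    assert (sqrt s <= S + S).
    { apply Rle_trans with (sqrt (S * S)); [apply sqrt_le_1_alt; nra|]. rewrite sqrt_square; lra. }
    assert (Q : 1 <= sqrt (1 + s) <= 1 + S).
    { split; [rewrite <- sqrt_1 at 1; apply sqrt_le_1_alt; lra|].
      apply Rle_trans with (sqrt ((1 + S) * (1 + S))); [apply sqrt_le_1_alt; nra|].
      rewrite sqrt_square; lra. }
    split; [|split].
    + apply Rle_trans with ((M + S + S) * (1 + S)); [|lra].
      apply Rmult_le_compat; [apply Rabs_pos|lra| |lra].
      eapply Rle_trans; [apply Rabs_triang|]. rewrite Rabs_Ropp, (Rabs_right (sqrt s)); lra.
    + apply Rle_trans with ((M * M + S) * (1 + S)); [|lra].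
      apply Rmult_le_compat; [apply Rabs_pos|lra| |lra].
      eapply Rle_trans; [apply Rabs_triang|]. rewrite Rabs_Ropp, (Rabs_right s) by lra.
      simpl. rewrite Rmult_1_r, Rabs_mult. pose proof (Rabs_pos (y s)). nra.
    + apply Rle_trans with (M1 * (1 + S)); [|lra].
      apply Rmult_le_compat; [apply Rabs_pos|lra|exact HM1|lra].
Qed.

(** * Nondegeneracy of the layers *)

(** The product [v * v1] is used because the sign of [v s0] is not prescribed: for a dipping layer
    [v] may have crossed zero. The lower bound [c] is what the maximum principle needs beyond
    [s0]. *)
Definition layer_nondegenerate (y : R -> R) : Prop :=
  exists (s0 c : R) (v v1 : R -> R), 1 <= s0 /\ 0 < c /\ (forall s, s0 <= s -> c <= y s) /\
    v 0 = 0 /\ (forall s, 0 <= s -> is_derive v s (v1 s)) /\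
    (forall s, 0 <= s -> is_derive v1 s (y s * v s)) /\ 0 < v s0 * v1 s0.

Lemma linearized_ivp (y y1 : R -> R) :
  (forall s, is_derive y s (y1 s)) ->
  exists v v1 : R -> R, v 0 = 0 /\ v1 0 = 1 /\ (forall s, is_derive v s (v1 s)) /\
    (forall s, 0 <= s -> is_derive v1 s (y s * v s)).
Proof.
  intros H. destruct (linear_ivp y (fun _ => 0) 1) as [v [v1 [V0 [V10 [V1 V2]]]]].
  - intros x. exact (is_derive_continuous y x _ (H x)).
  - intros x. apply continuous_Rconst.
  - exists v, v1. conjs; auto. intros s Hs. eapply is_derive_eq; [apply V2, Hs|ring].
Qed.

(** Since [y > 0], the function [v] is convex as long as it is nonnegative, so its slope never falls
    below the initial value [1]; any [s0] would do. *)
Lemma increasing_layer_nondegenerate (y y1 : R -> R) :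
  y 0 = 0 -> (forall s, is_derive y s (y1 s)) ->
  (forall s t, 0 <= s -> s < t -> y s < y t) -> layer_nondegenerate y.
Proof.
  intros H0 H1 Hinc.
  assert (Hpos : forall s, 0 < s -> 0 < y s).
  { intros s Hs. rewrite <- H0. apply Hinc; lra. }
  destruct (linearized_ivp y y1 H1) as [v [v1 [V0 [V10 [V1 V2]]]]].
  assert (Hgrow : forall s, 0 <= s -> (forall t, 0 < t < s -> 0 <= v t) -> 1 <= v1 s /\ s <= v s).
  { intros s Hs Hv.
    assert (A : forall t, 0 <= t <= s -> 1 <= v1 t).
    { intros t Ht. rewrite <- V10.
      apply (derive_ge0_le v1 (fun r => y r * v r)); [lra| |].
      - intros x Hx. apply V2; lra.
      - intros x Hx. specialize (Hpos x ltac:(lra)). specialize (Hv x ltac:(lra)). nra. }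
    split; [apply A; lra|].
    assert (v 0 - 0 <= v s - s); [|lra].
    apply (derive_ge0_le (fun t => v t - t) (fun t => v1 t - 1)); [lra| |].
    - intros x Hx. derive_by ring.
    - intros x Hx. specialize (A x ltac:(lra)). lra. }
  assert (Hv : forall s, 0 < s -> 0 < v s).
  { intros s Hs. apply Rnot_le_lt. intros Hn.
    destruct (is_derive_pos_local v 0 (v1 0) (V1 0)) as [d [Hd [Hr _]]]; [lra|].
    destruct (first_zero v s d) as [b [Hb [Eb Hpb]]]; auto.
    - intros x. exact (is_derive_continuity_pt v x _ (V1 x)).
    - intros t Ht. specialize (Hr t ltac:(lra)). lra.
    - destruct (Hgrow b) as [_ A]; [lra| |lra]. intros t Ht. left. apply Hpb, Ht. }
  destruct (Hgrow 1) as [A B]; [lra| |].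
  { intros t Ht. left. apply Hv; lra. }
  exists 1, (y 1), v, v1. conjs; auto; try lra.
  - apply Hpos; lra.
  - intros s Hs. destruct (Req_dec s 1) as [->|]; [lra|]. left. apply Hinc; lra.
  - nra.
Qed.

(* The energy [E] with [E' = y]; comparing it at [0], [2k], [a] and [p] bounds [k] from below,
   and [- y >= min (al * s) be] then contradicts either the energy inequality (small [k])
   or [y' (2 k) <= 0] (large [k]). *)
Lemma slow_descent_impossible (y y1 : R -> R) (k a p : R) :
  0 < k -> y 0 = 0 -> (forall s, is_derive y s (y1 s)) ->
  (forall s, 0 <= s -> is_derive y1 s ((y s ^ 2 - s) / 2)) ->
  y1 0 = - k ^ 2 -> (forall s, 0 <= s <= 2 * k -> y1 s <= 0) ->
  2 * k <= a -> y a = 0 -> (forall s, 0 <= s <= a -> y s <= 0) ->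
  a <= p -> y p = sqrt a -> (forall s, a <= s <= p -> y s <= sqrt a) -> False.
Proof.
  intros Hk H0 H1 H2 Hq Hdec Hka Ha Hneg Hap Hp Hup.
  set (E := fun s => y1 s ^ 2 - y s ^ 3 / 3 + s * y s).
  assert (HE : forall s, 0 <= s -> is_derive E s (y s)).
  { intros s Hs. unfold E. derive_by (simpl; field). }
  assert (E0 : E 0 = k ^ 4) by (unfold E; rewrite H0, Hq; field).
  set (h := sqrt (2 * k)).
  assert (Hh0 : 0 < h) by (apply sqrt_lt_R0; lra).
  assert (Hh : h ^ 2 = 2 * k) by (unfold h; rewrite pow2_sqrt; lra).
  (* On [[a, p]] the energy grows at rate at most [sqrt a], and
     [E p >= p * sqrt a - a * sqrt a / 3]; hence [E a >= (2/3) a sqrt a]. The energy decreases on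
     [[0, a]] and [a >= 2 k]. *)
  assert (Hlow : 4 / 3 * k * h <= E (2 * k)).
  { set (w := sqrt a) in *.
    assert (Hw0 : h <= w) by (apply sqrt_le_1_alt; exact Hka).
    assert (Hw : w ^ 2 = a) by (unfold w; rewrite pow2_sqrt; lra).
    assert (A : E p - p * w <= E a - a * w).
    { apply (derive_le0_le (fun s => E s - s * w) (fun s => y s - w)); [exact Hap| |].
      - intros x Hx. pose proof (HE x ltac:(lra)). derive_by ring.
      - intros x Hx. specialize (Hup x ltac:(lra)). lra. }
    assert (B : E a <= E (2 * k)).
    { apply (derive_le0_le E y); [lra| |].
      - intros x Hx. apply HE; lra.
      - intros x Hx. apply Hneg; lra. }
    assert (C : - w ^ 3 / 3 + p * w <= E p).
    { unfold E. rewrite Hp. pose proof (pow2_ge_0 (y1 p)). lra. }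
    assert (D : w ^ 3 = a * w) by (replace (w ^ 3) with (w ^ 2 * w) by ring; rewrite Hw; reflexivity).
    assert (2 * k * h <= a * w) by (apply Rmult_le_compat; lra).
    lra. }
  assert (Hup' : E (2 * k) <= k ^ 4).
  { rewrite <- E0. apply (derive_le0_le E y); [lra| |].
    - intros x Hx. apply HE; lra.
    - intros x Hx. apply Hneg; lra. }
  (* From [4/3 * k * sqrt (2 k) <= k ^ 4] follows [k ^ 5 >= 32/9], whose fifth root slightly exceeds
     1.28. *)
  assert (Hk1 : (128 / 100) <= k).
  { apply Rnot_lt_le. intros Hlt.
    assert (A : 4 / 3 * h <= k ^ 3) by nra.
    assert (B : k ^ 3 * k ^ 3 < 32 / 9 * k).
    { assert (k ^ 2 <= (16384 / 10000)) by nra. assert (k ^ 4 <= (26844 / 10000)) by nra.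
      assert (k ^ 5 < (35 / 10)) by nra.
      replace (k ^ 3 * k ^ 3) with (k ^ 5 * k) by ring. nra. }
    nra. }
  assert (Hslope : forall s, 0 <= s <= 2 * k -> k ^ 4 + y s ^ 3 / 3 <= y1 s ^ 2).
  { intros s Hs.
    assert (A : y1 0 ^ 2 - y 0 ^ 3 / 3 <= y1 s ^ 2 - y s ^ 3 / 3).
    { apply (derive_ge0_le (fun t => y1 t ^ 2 - y t ^ 3 / 3) (fun t => - t * y1 t)); [lra| |].
      - intros x Hx. derive_by (simpl; field).
      - intros x Hx. specialize (Hdec x ltac:(lra)). nra. }
    rewrite H0, Hq in A. simpl in *. lra. }
  assert (Hmono : forall s t, 0 <= s -> s <= t -> t <= 2 * k -> y t <= y s).
  { intros s t Hs Hst Ht. apply (derive_le0_le y y1); [lra|intros; apply H1|].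
    intros x Hx. apply Hdec; lra. }
  (* As long as [(- y) ^ 3 / 3 <= 0.51 * k ^ 4], the inequality [Hslope] leaves
     [y1 ^ 2 >= 0.49 * k ^ 4], that is, a descent at speed at least [0.7 * k ^ 2]. *)
  set (al := (7 / 10) * k ^ 2).
  assert (Hal : 0 < al) by (unfold al; nra).
  assert (Hmin : forall be, 0 < be -> be ^ 3 / 3 <= (51 / 100) * k ^ 4 ->
     forall s, 0 <= s <= 2 * k -> al * s <= - y s \/ be <= - y s).
  { intros be Hbe Hbe3 s Hs. destruct (Rle_lt_dec be (- y s)) as [|Hlt]; [right; assumption|left].
    assert (y 0 + al * 0 >= y s + al * s); [|lra].
    apply Rle_ge, (derive_le0_le (fun t => y t + al * t) (fun t => y1 t + al)); [lra| |].
    - intros x Hx. derive_by ring.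
    - intros x Hx. pose proof (Hmono x s ltac:(lra) ltac:(lra) ltac:(lra)).
      specialize (Hslope x ltac:(lra)). specialize (Hneg x ltac:(lra)). specialize (Hdec x ltac:(lra)).
      assert ((- y x) ^ 3 <= be ^ 3) by (apply pow_incr; lra).
      assert (al ^ 2 <= y1 x ^ 2).
      { replace (al ^ 2) with ((49 / 100) * k ^ 4) by (unfold al; field).
        replace ((- y x) ^ 3) with (- y x ^ 3) in H3 by ring. lra. }
      nra. }
  (* The energy argument excludes [k] from 1.28 up to about 1.70, the slope argument excludes [k]
     above about 1.54; 1.65 lies in the overlap. In both, [sb = be / al] is the time at which the
     line [al * s] reaches the level [be]. *)
  destruct (Rle_lt_dec k (165 / 100)) as [Hk2|Hk2].
  - assert (Hk4 : (2684 / 1000) <= k ^ 4).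
    { assert ((16384 / 10000) <= k ^ 2) by nra. nra. }
    specialize (Hmin (158 / 100) ltac:(lra) ltac:(lra)).
    set (sb := (158 / 100) / al).
    assert (Hsb : al * sb = (158 / 100)) by (unfold sb; field; lra).
    assert (Hsb0 : 0 < sb) by (apply Rdiv_lt_0_compat; lra).
    assert (Hal1 : (114 / 100) <= al) by (unfold al; nra).
    assert (Hsb1 : sb <= 2 * k) by nra.
    assert (A : E sb + al * sb ^ 2 / 2 <= E 0 + al * 0 ^ 2 / 2).
    { apply (derive_le0_le (fun t => E t + al * t ^ 2 / 2) (fun t => y t + al * t)); [lra| |].
      - intros x Hx. pose proof (HE x ltac:(lra)). derive_by (simpl; field).
      - intros x Hx. destruct (Hmin x ltac:(lra)); nra. }
    assert (B : E (2 * k) + (158 / 100) * (2 * k) <= E sb + (158 / 100) * sb).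
    { apply (derive_le0_le (fun t => E t + (158 / 100) * t) (fun t => y t + (158 / 100))); [lra| |].
      - intros x Hx. pose proof (HE x ltac:(lra)). derive_by ring.
      - intros x Hx. destruct (Hmin x ltac:(lra)); nra. }
    assert (Hh1 : (16 / 10) <= h) by nra.
    assert (C : sb * k ^ 2 = (158 / 100) / (7 / 10)) by (unfold sb, al; field; nra).
    assert (D : 4 / 3 * k * (16 / 10) <= k ^ 4 - (316 / 100) * k + (79 / 100) * sb) by nra.
    (* Multiplication by [k ^ 2] eliminates [sb] and leaves a quadratic inequality in [k ^ 3], which
       fails on the whole range [[2.09, 4.5]]. *)
    assert (F : 4 / 3 * (16 / 10) * k ^ 3 <= k ^ 6 - (316 / 100) * k ^ 3 + (79 / 100) * ((158 / 100) / (7 / 10))).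
    { rewrite <- C. replace (k ^ 6) with (k ^ 4 * k ^ 2) by ring.
      assert (0 < k ^ 2) by nra. apply (Rmult_le_compat_r (k ^ 2)) in D; [|lra]. simpl in *. lra. }
    assert ((209 / 100) <= k ^ 3 <= (45 / 10)).
    { assert ((16384 / 10000) <= k ^ 2 <= (27225 / 10000)) by nra. split; nra. }
    replace (k ^ 6) with (k ^ 3 * k ^ 3) in F by ring. nra.
  - set (be := (133 / 100) * k).
    specialize (Hmin be ltac:(unfold be; lra)).
    assert (Hbe : be ^ 3 / 3 <= (51 / 100) * k ^ 4).
    { replace (be ^ 3 / 3) with ((2352637 / 1000000) / 3 * k ^ 3) by (unfold be; field).
      replace (k ^ 4) with (k * k ^ 3) by ring. assert (0 < k ^ 3) by (apply pow_lt; lra). nra. }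
    specialize (Hmin Hbe).
    set (sb := be / al).
    assert (Hsb : al * sb = be) by (unfold sb; field; lra).
    assert (Hsb0 : 0 < sb) by (apply Rdiv_lt_0_compat; unfold be; lra).
    assert (C : sb * k = (19 / 10)) by (unfold sb, al, be; field; lra).
    assert (Hsb1 : sb <= 2 * k) by nra.
    (* Integration of [y1' = (y ^ 2 - s) / 2], with [y ^ 2 >= (al * s) ^ 2] before [sb] and
       [y ^ 2 >= be ^ 2] after it; the resulting lower bound for [y1 (2 * k)] is positive. *)
    assert (A : y1 0 + 0 ^ 2 / 4 - al ^ 2 * 0 ^ 3 / 6 <= y1 sb + sb ^ 2 / 4 - al ^ 2 * sb ^ 3 / 6).
    { apply (derive_ge0_le (fun t => y1 t + t ^ 2 / 4 - al ^ 2 * t ^ 3 / 6)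
               (fun t => y t ^ 2 / 2 - (al * t) ^ 2 / 2)); [lra| |].
      - intros x Hx. derive_by (simpl; field).
      - intros x Hx. assert (0 <= al * x) by nra. assert (al * x <= be) by nra.
        assert (al * x <= - y x) by (destruct (Hmin x ltac:(lra)); lra).
        set (z := al * x) in *. nra. }
    assert (B : y1 sb + sb ^ 2 / 4 - be ^ 2 / 2 * sb <= y1 (2 * k) + (2 * k) ^ 2 / 4 - be ^ 2 / 2 * (2 * k)).
    { apply (derive_ge0_le (fun t => y1 t + t ^ 2 / 4 - be ^ 2 / 2 * t)
               (fun t => y t ^ 2 / 2 - be ^ 2 / 2)); [lra| |].
      - intros x Hx. derive_by (simpl; field).
      - intros x Hx. assert (0 < be) by (unfold be; lra). assert (be <= al * x) by nra.
        assert (be <= - y x) by (destruct (Hmin x ltac:(lra)); lra). nra. }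
    specialize (Hdec (2 * k) ltac:(lra)).
    assert (D : al ^ 2 * sb ^ 3 = be ^ 2 * sb) by (rewrite <- Hsb; ring).
    assert (F : be ^ 2 * k - be ^ 2 * sb / 3 <= 2 * k ^ 2) by (rewrite Hq in A; simpl in *; lra).
    assert (be ^ 2 * sb = (17689 / 10000) * (19 / 10) * k) by (unfold be; rewrite <- C; field).
    replace (be ^ 2 * k) with ((17689 / 10000) * k ^ 3) in F by (unfold be; field).
    assert ((17689 / 10000) * k ^ 2 - (17689 / 10000) * (19 / 10) / 3 <= 2 * k).
    { apply (Rmult_le_reg_r k); [lra|]. simpl in *; lra. }
    nra.
Qed.

(** If [v >= n] forever, then [v1' >= n], and [v1] becomes positive in finite time; [T] is chosen so
    that [v1 T] would be at least [1]. *)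
Lemma bounded_linearized_decays (y v v1 : R -> R) (S n : R) :
  (forall s, S <= s -> 1 <= y s) ->
  (forall s, S <= s -> is_derive v1 s (y s * v s)) ->
  (forall s, S <= s -> v1 s <= 0) -> 0 < n ->
  exists s, S <= s /\ v s < n.
Proof.
  intros Hy H2 H1 Hn. apply NNPP; intros Hno.
  assert (Hv : forall s, S <= s -> n <= v s).
  { intros s Hs. apply Rnot_lt_le. intros Hlt. apply Hno. exists s; split; assumption. }
  set (T := S + (1 - v1 S) / n).
  pose proof (H1 S (Rle_refl S)).
  assert (HT : S <= T).
  { unfold T. assert (0 < (1 - v1 S) / n) by (apply Rdiv_lt_0_compat; lra). lra. }
  assert (A : v1 S - n * S <= v1 T - n * T).
  { apply (derive_ge0_le (fun t => v1 t - n * t) (fun t => y t * v t - n)); [exact HT| |].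
    - intros x Hx. derive_by ring.
    - intros x Hx. specialize (Hv x ltac:(lra)). specialize (Hy x ltac:(lra)). nra. }
  assert (E : n * T = n * S + 1 - v1 S) by (unfold T; field; lra).
  specialize (H1 T HT). lra.
Qed.

Lemma layer_profile_large (y y1 : R -> R) (C M s : R) :
  layer_profile y y1 C -> 0 <= M -> (M + C) ^ 2 <= s -> M <= y s.
Proof.
  intros [HC [_ [_ [_ H]]]] HM Hs.
  assert (0 <= s) by nra. destruct (H s H0) as [A _].
  assert (M + C <= sqrt s).
  { rewrite <- (sqrt_pow2 (M + C)) by lra. apply sqrt_le_1_alt, Hs. }
  pose proof (Rabs_pos (y s - sqrt s)).
  assert (B : Rabs (y s - sqrt s) <= C) by nra.
  apply Rabs_le_between in B. lra.
Qed.

Lemma layer_profile_bounds (y y1 : R -> R) (C s : R) :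
  layer_profile y y1 C -> 0 <= s ->
  Rabs (y s - sqrt s) <= C /\ Rabs (y s ^ 2 - s) <= C /\ Rabs (y1 s) <= C.
Proof.
  intros [HC [_ [_ [_ H]]]] Hs. destruct (H s Hs) as [A [B D]].
  assert (1 <= sqrt (1 + s)) by (rewrite <- sqrt_1 at 1; apply sqrt_le_1_alt; lra).
  pose proof (Rabs_pos (y s - sqrt s)). pose proof (Rabs_pos (y s ^ 2 - s)). pose proof (Rabs_pos (y1 s)).
  split; [nra|]. split; nra.
Qed.

Lemma intermediate_value (f : R -> R) (a b c : R) :
  (forall x, continuity_pt f x) -> a <= b -> f a <= c <= f b ->
  exists x, a <= x <= b /\ f x = c.
Proof.
  intros Hf Hab Hc. destruct (IVT_gen f a b c) as [x [Hx E]].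
  - exact Hf.
  - rewrite Rmin_left, Rmax_right by lra. exact Hc.
  - rewrite Rmin_left, Rmax_right in Hx by lra. exists x; split; assumption.
Qed.

Lemma dipping_layer_nondegenerate (y y1 : R -> R) (C m : R) :
  layer_profile y y1 C -> y1 0 < 0 -> 0 < m ->
  (forall s, 0 <= s <= m -> y1 s <= 0) -> (forall s, m <= s -> 0 <= y1 s) ->
  layer_nondegenerate y.
Proof.
  intros HP Hq Hm Hdec Hinc.
  pose proof (fun M s => layer_profile_large y y1 C M s HP) as Hlarge.
  pose proof (fun s => layer_profile_bounds y y1 C s HP) as Hbd.
  destruct HP as [HC [H0 [H1 [H2 H3]]]].
  destruct (linearized_ivp y y1 H1) as [v [v1 [V0 [V10 [V1 V2]]]]].
  assert (Cy : forall x, continuity_pt y x) by (intros x; exact (is_derive_continuity_pt y x _ (H1 x))).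
  assert (Cv : forall x, continuity_pt v x) by (intros x; exact (is_derive_continuity_pt v x _ (V1 x))).
  assert (Hmon : forall s t, 0 <= s -> s <= t -> t <= m -> y t <= y s).
  { intros s t Hs Hst Ht. apply (derive_le0_le y y1); [lra|intros; apply H1|].
    intros x Hx. apply Hdec; lra. }
  assert (Hmon' : forall s t, m <= s -> s <= t -> y s <= y t).
  { intros s t Hs Hst. apply (derive_ge0_le y y1); [lra|intros; apply H1|].
    intros x Hx. apply Hinc; lra. }
  assert (Hym : y m < 0).
  { destruct (is_derive_neg_local y 0 (y1 0) (H1 0) Hq) as [d [Hd [Hr _]]].
    set (t := Rmin (d / 2) m).
    assert (Ht : 0 < t <= m /\ t < d) by (unfold t, Rmin; destruct Rle_dec; lra).
    specialize (Hr t ltac:(lra)). specialize (Hmon t m ltac:(lra) ltac:(lra) ltac:(lra)). lra. }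
  set (S := Rmax (m + 1) ((1 + C) ^ 2)).
  assert (HSm : m + 1 <= S) by apply Rmax_l.
  assert (HS : forall s, S <= s -> 1 <= y s).
  { intros s Hs. apply Hlarge; [lra|]. eapply Rle_trans; [apply Rmax_r|exact Hs]. }
  (* [N] is the Wronskian of [v] and [y'], [M] that of [v] and [2 y + s y']. *)
  set (N := fun s => v s * ((y s ^ 2 - s) / 2) - v1 s * y1 s).
  assert (HN : forall s, 0 <= s -> is_derive N s (- v s / 2)).
  { intros s Hs. unfold N. derive_by (simpl; field). }
  set (M := fun s => v s * (3 * y1 s + s * ((y s ^ 2 - s) / 2)) - v1 s * (2 * y s + s * y1 s)).
  assert (HM : forall s, 0 <= s -> is_derive M s (- (5 / 2) * s * v s)).
  { intros s Hs. unfold M. derive_by (simpl; field). }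
  assert (M0 : M 0 = 0) by (unfold M; rewrite V0, H0; ring).
  assert (Vpos : exists d, 0 < d /\ forall t, 0 < t < d -> 0 < v t).
  { destruct (is_derive_pos_local v 0 (v1 0) (V1 0)) as [d [Hd [Hr _]]]; [lra|].
    exists d. split; [exact Hd|]. intros t Ht. specialize (Hr t ltac:(lra)). lra. }
  assert (Mneg : forall b, 0 < b -> (forall t, 0 < t < b -> 0 < v t) -> M b < 0).
  { intros b Hb Hv. destruct (mean_value M (fun s => - (5 / 2) * s * v s) 0 b Hb) as [c [Hc E]].
    - intros x Hx. apply HM; lra.
    - specialize (Hv c Hc). assert (0 < c * v c) by nra. nra. }
  assert (Hend : forall b, 0 < b -> v b = 0 -> (forall t, 0 < t < b -> 0 < v t) -> v1 b <= 0).
  { intros b Hb Eb Hv. apply Rnot_lt_le. intros Hlt.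
    destruct (is_derive_pos_local v b (v1 b) (V1 b) Hlt) as [d [Hd [_ Hl]]].
    set (t := Rmax (b - d / 2) (b / 2)).
    assert (Ht : 0 < t < b /\ b - d < t) by (unfold t, Rmax; destruct Rle_dec; lra).
    specialize (Hl t ltac:(lra)). specialize (Hv t ltac:(lra)). lra. }
  (* If [b <= m], then [y <= 0] on [[0, b]] makes [v] concave there, so [v t <= t] and
     [N b >= k ^ 2 - b ^ 2 / 4]. But [N b <= 0], so [y] descends during a time of at least [2 * k],
     which [slow_descent_impossible] excludes. *)
  assert (Hlate : forall b, 0 < b -> v b = 0 -> (forall t, 0 < t < b -> 0 < v t) -> m < b).
  { intros b Hb Eb Hv. apply Rnot_le_lt. intros Hbm.
    set (k := sqrt (- y1 0)).
    assert (Hk : 0 < k) by (apply sqrt_lt_R0; lra).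
    assert (Hk2 : k ^ 2 = - y1 0) by (unfold k; rewrite pow2_sqrt; lra).
    assert (Hv1 : forall t, 0 <= t <= b -> v1 t <= 1).
    { intros t Ht. rewrite <- V10. apply (derive_le0_le v1 (fun s => y s * v s)); [lra| |].
      - intros x Hx. apply V2; lra.
      - intros x Hx. specialize (Hv x ltac:(lra)).
        pose proof (Hmon 0 x ltac:(lra) ltac:(lra) ltac:(lra)). nra. }
    assert (Hvs : forall t, 0 <= t <= b -> v t <= t).
    { intros t Ht. assert (v t - t <= v 0 - 0); [|lra].
      apply (derive_le0_le (fun s => v s - s) (fun s => v1 s - 1)); [lra| |].
      - intros x Hx. derive_by ring.
      - intros x Hx. specialize (Hv1 x ltac:(lra)). lra. }
    assert (A : N 0 + 0 ^ 2 / 4 <= N b + b ^ 2 / 4).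
    { apply (derive_ge0_le (fun t => N t + t ^ 2 / 4) (fun t => - v t / 2 + t / 2)); [lra| |].
      - intros x Hx. pose proof (HN x ltac:(lra)). derive_by (simpl; field).
      - intros x Hx. specialize (Hvs x ltac:(lra)). lra. }
    assert (N0 : N 0 = k ^ 2) by (unfold N; rewrite V0, V10; lra).
    assert (Nb : N b <= 0).
    { unfold N. rewrite Eb. specialize (Hend b Hb Eb Hv). specialize (Hdec b ltac:(lra)). nra. }
    assert (Hb2 : 2 * k <= b) by (simpl in *; nra).
    destruct (intermediate_value y m S 0 Cy ltac:(lra)) as [a [Ha Ea]].
    { specialize (HS S (Rle_refl S)). lra. }
    set (P := Rmax a ((sqrt a + C) ^ 2)).
    assert (HPa : a <= P) by apply Rmax_l.
    pose proof (sqrt_pos a) as Hsa.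
    assert (HPy : sqrt a <= y P) by (apply Hlarge; [lra|apply Rmax_r]).
    destruct (intermediate_value y a P (sqrt a) Cy HPa ltac:(lra)) as [p [Hp Ep]].
    apply (slow_descent_impossible y y1 k a p); auto; try lra.
    - intros s Hs. apply Hdec; lra.
    - intros s Hs. destruct (Rle_lt_dec s m).
      + pose proof (Hmon 0 s ltac:(lra) ltac:(lra) ltac:(lra)). lra.
      + pose proof (Hmon' s a ltac:(lra) ltac:(lra)). lra.
    - intros s Hs. rewrite <- Ep. apply Hmon'; lra. }
  apply NNPP; intros Hno.
  (* Beyond [S], degeneracy makes the modulus of [v] nonincreasing, hence somewhere arbitrarily
     small, while in either case below a Wronskian stays away from zero. *)
  assert (Hsgn : forall s, S <= s -> v s * v1 s <= 0).
  { intros s Hs. apply Rnot_lt_le. intros Hlt. apply Hno.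
    exists s, 1, v, v1. conjs; auto; try lra. intros t Ht. apply HS; lra. }
  destruct (classic (exists x, 0 < x /\ v x <= 0)) as [[x [Hx Hvx]]|Hnz].
  - destruct Vpos as [d [Hd Hvd]].
    destruct (first_zero v x d Cv Hd Hvd Hx Hvx) as [b [[Hb _] [Eb Hv]]].
    specialize (Hlate b Hb Eb Hv). specialize (Hend b Hb Eb Hv).
    (* At [b] the Wronskian [M] reduces to [- v1 b * (2 * y b + b * y1 b)], so its strict sign
       excludes [v1 b = 0]. *)
    assert (Hv1b : v1 b < 0).
    { specialize (Mneg b Hb Hv). unfold M in Mneg. rewrite Eb in Mneg.
      destruct (Req_dec (v1 b) 0) as [E|]; [rewrite E in Mneg|]; lra. }
    assert (Nb : 0 <= N b).
    { unfold N. rewrite Eb. specialize (Hinc b ltac:(lra)). nra. }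
    assert (Nup : forall s, b < s -> (forall t, b < t < s -> v t < 0) -> N b < N s).
    { intros s Hs Hvs. destruct (mean_value N (fun t => - v t / 2) b s Hs) as [c [Hc E]].
      - intros t Ht. apply HN; lra.
      - specialize (Hvs c Hc). nra. }
    (* At a return to zero the slope [v1] would be nonnegative, so [N = - v1 * y1 <= 0] there,
       although [N] has increased strictly from [N b >= 0]. *)
    assert (Hvneg : forall s, b < s -> v s < 0).
    { intros s Hs. apply Rnot_le_lt. intros Hge.
      destruct (is_derive_neg_local v b (v1 b) (V1 b) Hv1b) as [e [He [Hr _]]].
      destruct (first_zero (fun t => - v (b + t)) (s - b) e) as [t [Ht [Et Hvt]]]; auto.
      - intros t. apply (is_derive_continuity_pt _ t (- (1 * v1 (b + t)))).
        apply is_derive_Ropp. apply (is_derive_comp v (fun t => b + t)); [apply V1|].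
        derive_by ring.
      - intros t Ht. specialize (Hr (b + t) ltac:(lra)). lra.
      - lra.
      - replace (b + (s - b)) with s by ring. lra.
      - assert (Hvt' : forall r, b < r < b + t -> v r < 0).
        { intros r Hr'. specialize (Hvt (r - b) ltac:(lra)).
          replace (b + (r - b)) with r in Hvt by ring. lra. }
        specialize (Nup (b + t) ltac:(lra) Hvt').
        assert (Hv1t : 0 <= v1 (b + t)).
        { apply Rnot_lt_le. intros Hlt.
          destruct (is_derive_neg_local v (b + t) _ (V1 (b + t)) Hlt) as [e2 [He2 [_ Hl]]].
          set (r := Rmax (b + t - e2 / 2) (b + t / 2)).
          assert (Hr' : b < r < b + t /\ b + t - e2 < r) by (unfold r, Rmax; destruct Rle_dec; lra).
          specialize (Hl r ltac:(lra)). specialize (Hvt' r ltac:(lra)). lra. }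
        unfold N in Nup at 2. replace (v (b + t)) with 0 in Nup by lra.
        specialize (Hinc (b + t) ltac:(lra)). nra. }
    set (T := Rmax S (b + 1)).
    assert (HTS : S <= T) by apply Rmax_l. assert (HTb : b + 1 <= T) by apply Rmax_r.
    assert (Hn : 0 < N T).
    { specialize (Nup T ltac:(lra)). assert (N b < N T); [|lra]. apply Nup. intros; apply Hvneg; lra. }
    assert (Hv1p : forall s, T <= s -> 0 <= v1 s).
    { intros s Hs. specialize (Hsgn s ltac:(lra)). specialize (Hvneg s ltac:(lra)). nra. }
    (* Where [- v s < N T / C], the first product in [N s] is below [N T] and the term
       [- v1 s * y1 s] is nonpositive, against [N T <= N s]. *)
    destruct (bounded_linearized_decays y (fun t => - v t) (fun t => - v1 t) T (N T / C)) as [s [Hs Hvs]].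
    + intros s Hs. apply HS; lra.
    + intros s Hs. pose proof (V2 s ltac:(lra)). derive_by ring.
    + intros s Hs. specialize (Hv1p s Hs). lra.
    + apply Rdiv_lt_0_compat; lra.
    + assert (A : N T <= N s).
      { apply (derive_ge0_le N (fun t => - v t / 2)); [exact Hs| |].
        - intros t Ht. apply HN; lra.
        - intros t Ht. specialize (Hvneg t ltac:(lra)). lra. }
      apply Rlt_div_r in Hvs; [|exact HC].
      unfold N in A at 2. destruct (Hbd s ltac:(lra)) as [_ [B _]].
      apply Rabs_le_between in B. specialize (Hvneg s ltac:(lra)). specialize (Hv1p s Hs).
      specialize (Hinc s ltac:(lra)). nra.
  - assert (Hv : forall s, 0 < s -> 0 < v s).
    { intros s Hs. apply Rnot_le_lt. intros Hle. apply Hnz. exists s; split; assumption. }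
    assert (Hv1 : forall s, S <= s -> v1 s <= 0).
    { intros s Hs. specialize (Hsgn s Hs). specialize (Hv s ltac:(lra)). nra. }
    assert (MS : M S < 0).
    { apply Mneg; [lra|]. intros t Ht. apply Hv; lra. }
    (* In [M s] the term [- v1 * (2 * y + s * y1)] is nonnegative and the factor of [v s] is at
       least [- 4 * C], so a small [v s] forces [M s > M S], although [M] decreases. *)
    destruct (bounded_linearized_decays y v v1 S (- M S / (4 * C))) as [s [Hs Hvs]]; auto.
    + intros s Hs. apply V2; lra.
    + apply Rdiv_lt_0_compat; lra.
    + assert (A : M s <= M S).
      { apply (derive_le0_le M (fun t => - (5 / 2) * t * v t)); [exact Hs| |].
        - intros t Ht. apply HM; lra.
        - intros t Ht. specialize (Hv t ltac:(lra)). assert (0 <= t * v t) by nra. nra. }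
      apply Rlt_div_r in Hvs; [|lra].
      unfold M in A at 1. destruct (Hbd s ltac:(lra)) as [_ [_ B]].
      destruct (H3 s ltac:(lra)) as [_ [D _]].
      assert (B' : - (4 * C) <= 3 * y1 s + s * ((y s ^ 2 - s) / 2)).
      { rewrite <- (Rabs_right (1 + s)) in D by lra. rewrite <- Rabs_mult in D.
        apply Rabs_le_between in B, D.
        destruct (Hbd s ltac:(lra)) as [_ [F _]]. apply Rabs_le_between in F. nra. }
      specialize (HS s Hs). specialize (Hinc s ltac:(lra)). specialize (Hv1 s Hs).
      specialize (Hv s ltac:(lra)).
      assert (0 <= 2 * y s + s * y1 s) by nra.
      assert (0 <= - v1 s * (2 * y s + s * y1 s)) by nra.
      assert (v s * - (4 * C) <= v s * (3 * y1 s + s * ((y s ^ 2 - s) / 2))).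
      { apply Rmult_le_compat_l; lra. }
      lra.
Qed.

(** * From a single local minimum to monotonicity on both sides *)

Lemma at_right_quotient_unique (f g : R -> R) (g1 l : R) :
  (forall s, 0 <= s -> g s = f s) -> is_derive g 0 g1 -> right_derivative f 0 l -> l = g1.
Proof.
  intros E Hg Hl. apply NNPP; intros Hne.
  set (e := Rabs (l - g1) / 2).
  assert (He : 0 < e) by (unfold e; assert (0 < Rabs (l - g1)); [apply Rabs_pos_lt; lra|lra]).
  destruct (Hl (fun z => Rabs (z - l) < e)) as [d1 D1].
  { exists (mkposreal e He). intros z Hz. exact Hz. }
  apply is_derive_Reals in Hg. destruct (Hg e He) as [d2 D2].
  set (h := Rmin (d1 / 2) (d2 / 2)).
  pose proof (cond_pos d1). pose proof (cond_pos d2).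
  assert (Hh : 0 < h /\ h < d1 /\ h < d2) by (unfold h, Rmin; destruct Rle_dec; lra).
  specialize (D1 h). specialize (D2 h ltac:(lra)).
  rewrite (Rabs_right h) in D2 by lra. specialize (D2 ltac:(lra)).
  assert (A : Rabs ((f h - f 0) / (h - 0) - l) < e).
  { apply D1; [|lra]. change (Rabs (h - 0) < d1). rewrite Rminus_0_r, Rabs_right; lra. }
  rewrite Rplus_0_l, !E in D2 by lra. rewrite Rminus_0_r in A.
  set (q := (f h - f 0) / h) in *.
  assert (Rabs (l - g1) <= Rabs (q - l) + Rabs (q - g1)).
  { unfold Rabs; repeat destruct Rcase_abs; lra. }
  unfold e in *. lra.
Qed.

(** The minimum over [[c, d]] is attained inside: the slope excludes [c], and either alternative
    excludes [d]. *)
Lemma local_min_of_dip (Y y y1 : R -> R) (c d : R) :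
  (forall s, 0 <= s -> y s = Y s) -> (forall s, is_derive y s (y1 s)) ->
  0 <= c -> c < d -> y1 c < 0 -> y c < y d \/ 0 < y1 d ->
  exists e, c < e < d /\ local_min_on half_line Y e.
Proof.
  intros E H1 Hc Hcd Hneg Hd.
  destruct (continuity_ab_min y c d) as [e [He Hcd']]; [lra| |].
  { intros x _. exact (is_derive_continuity_pt y x _ (H1 x)). }
  assert (Hec : e <> c).
  { intros ->. destruct (is_derive_neg_local y c _ (H1 c) Hneg) as [r [Hr [A _]]].
    set (t := Rmin (c + r / 2) d).
    assert (Ht : c < t <= d /\ t < c + r) by (unfold t, Rmin; destruct Rle_dec; lra).
    specialize (A t ltac:(lra)). specialize (He t ltac:(lra)). lra. }
  assert (Hed : e <> d).
  { intros ->. destruct Hd as [Hd|Hd].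
    - specialize (He c ltac:(lra)). lra.
    - destruct (is_derive_pos_local y d _ (H1 d) Hd) as [r [Hr [_ A]]].
      set (t := Rmax (d - r / 2) c).
      assert (Ht : c <= t < d /\ d - r < t) by (unfold t, Rmax; destruct Rle_dec; lra).
      specialize (A t ltac:(lra)). specialize (He t ltac:(lra)). lra. }
  exists e. split; [lra|]. split; [unfold half_line; lra|].
  assert (Hr : 0 < Rmin (e - c) (d - e)) by (apply Rmin_glb_lt; lra).
  exists (mkposreal _ Hr). intros t Ht Ht0. unfold half_line in Ht0.
  rewrite <- !E by lra. apply He.
  change (Rabs (t - e) < Rmin (e - c) (d - e)) in Ht.
  pose proof (Rmin_l (e - c) (d - e)). pose proof (Rmin_r (e - c) (d - e)).
  apply Rabs_lt_between in Ht. lra.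
Qed.

Lemma Yminus_nondegenerate (Y y y1 : R -> R) (C : R) :
  is_Yminus Y -> layer_profile y y1 C -> (forall s, 0 <= s -> y s = Y s) ->
  layer_nondegenerate y.
Proof.
  intros [_ [[l [Hl Hl0]] [m [Hm [_ Hmu]]]]] HP E.
  pose proof HP as [HC [H0 [H1 [H2 H3]]]].
  assert (Hq : y1 0 < 0) by (rewrite <- (at_right_quotient_unique Y y (y1 0) l E (H1 0) Hl); exact Hl0).
  (* Since [y1 0 < 0], a positive slope at [s < m] would produce another local minimum in
     [(0, s)]. *)
  assert (Hdec : forall s, 0 <= s < m -> y1 s <= 0).
  { intros s Hs. apply Rnot_lt_le. intros Hlt.
    destruct (Req_dec s 0) as [->|Hne]; [lra|].
    destruct (local_min_of_dip Y y y1 0 s) as [e [He Hmin]]; auto; try lra.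
    specialize (Hmu e Hmin). lra. }
  assert (Hinc : forall s, m < s -> 0 <= y1 s).
  { intros s Hs. apply Rnot_lt_le. intros Hlt.
    set (M := Rabs (y s) + 1).
    (* So far out that [y d > y s]; with a negative slope at [s] there would be another local
       minimum beyond [m]. *)
    set (d := s + 1 + (M + C) ^ 2).
    assert (HM : 0 <= M) by (unfold M; pose proof (Rabs_pos (y s)); lra).
    assert (0 <= (M + C) ^ 2) by apply pow2_ge_0.
    assert (M <= y d) by (apply (layer_profile_large y y1 C M d HP); unfold d; lra).
    pose proof (Rle_abs (y s)).
    destruct (local_min_of_dip Y y y1 s d) as [e [He Hmin]]; auto; try (unfold d; lra).
    - left. unfold M in *. lra.
    - specialize (Hmu e Hmin). lra. }
  assert (Hc : continuous y1 m) by exact (is_derive_continuous y1 m _ (H2 m ltac:(lra))).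
  assert (Hy1m : y1 m = 0).
  { apply NNPP; intros Hne. destruct (proj1 (continuous_eps y1 m) Hc (Rabs (y1 m))) as [d [Hd A]].
    { apply Rabs_pos_lt, Hne. }
    assert (B1 := A (m + d / 2)). rewrite Rabs_right in B1 by lra. specialize (B1 ltac:(lra)).
    set (t := Rmax (m - d / 2) 0).
    assert (Ht : 0 <= t < m /\ m - d < t) by (unfold t, Rmax; destruct Rle_dec; lra).
    assert (B2 := A t). rewrite Rabs_left in B2 by lra. specialize (B2 ltac:(lra)).
    specialize (Hinc (m + d / 2) ltac:(lra)). specialize (Hdec t ltac:(lra)).
    revert B1 B2. unfold Rabs; repeat destruct Rcase_abs; lra. }
  apply (dipping_layer_nondegenerate y y1 C m HP Hq Hm).
  - intros s Hs. destruct (Req_dec s m) as [->|]; [lra|]. apply Hdec; lra.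
  - intros s Hs. destruct (Req_dec s m) as [->|]; [lra|]. apply Hinc; lra.
Qed.

Lemma layer_data (Y : R -> R) :
  is_Yplus Y \/ is_Yminus Y ->
  exists y y1 C, layer_profile y y1 C /\ layer_nondegenerate y /\ forall s, 0 <= s -> y s = Y s.
Proof.
  intros [H|H].
  - destruct (layer_profile_exists Y (proj1 H)) as [y [y1 [C [HP E]]]].
    exists y, y1, C. split; [exact HP|]. split; [|exact E].
    destruct HP as [_ [H0 [H1 _]]]. apply (increasing_layer_nondegenerate y y1 H0 H1).
    intros s t Hs Hst. rewrite !E by lra. apply H; assumption.
  - destruct (layer_profile_exists Y (proj1 H)) as [y [y1 [C [HP E]]]].
    exists y, y1, C. split; [exact HP|]. split; [|exact E].
    exact (Yminus_nondegenerate Y y y1 C H HP E).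
Qed.

(** * The linearized operator *)

(** Any solution of [phi'' = P phi - f], [phi 0 = 0], with [P] close to [y] on [0, s0], satisfies
    up to small errors a Robin condition [phi' = kap phi] at [s0], with [kap > 0]. *)
Definition robin_at (y : R -> R) (s0 kap K : R) : Prop :=
  0 < kap /\ 0 < K /\
  forall (P phi phi1 f : R -> R) (eta g M : R),
    0 <= eta <= 1 -> 0 <= g ->
    (forall s, 0 <= s <= s0 -> Rabs (P s - y s) <= eta) ->
    (forall s, 0 <= s <= s0 -> is_derive phi s (phi1 s)) ->
    (forall s, 0 <= s <= s0 -> is_derive phi1 s (P s * phi s - f s)) ->
    phi 0 = 0 ->
    (forall s, 0 <= s <= s0 -> Rabs (f s) <= g) ->
    (forall s, 0 <= s <= s0 -> Rabs (phi s) <= M) ->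
    Rabs (phi1 s0 - kap * phi s0) <= K * (eta * M + g) /\
    forall s, 0 <= s <= s0 -> Rabs (phi s) <= K * (Rabs (phi s0) + (eta * M + g)).

(** The energy [phi^2 + phi1^2 + g^2], multiplied by [exp (m * t)], is nondecreasing; the constant
    [g^2] absorbs the source. The factor in the bound is the exponential itself instead of its
    square root, since it is at least one. *)
Lemma gronwall_backward (P phi phi1 f : R -> R) (s0 Q g : R) :
  0 <= Q ->
  (forall s, 0 <= s <= s0 -> is_derive phi s (phi1 s)) ->
  (forall s, 0 <= s <= s0 -> is_derive phi1 s (P s * phi s - f s)) ->
  (forall s, 0 <= s <= s0 -> Rabs (P s) <= Q) ->
  (forall s, 0 <= s <= s0 -> Rabs (f s) <= g) ->
  forall s, 0 <= s <= s0 ->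
    Rabs (phi s) <= exp ((Q + 2) * s0) * (Rabs (phi s0) + Rabs (phi1 s0) + g).
Proof.
  intros HQ H1 H2 HP Hf s Hs.
  assert (Hg : 0 <= g) by (eapply Rle_trans; [apply Rabs_pos|apply (Hf s Hs)]).
  set (m := Q + 2).
  set (E := fun t => phi t ^ 2 + phi1 t ^ 2 + g ^ 2).
  assert (A : E s * (1 * exp (m * s)) <= E s0 * (1 * exp (m * s0))).
  { apply (derive_ge0_le (fun t => E t * (1 * exp (m * t)))
      (fun t => (2 * phi t * phi1 t + 2 * phi1 t * (P t * phi t - f t)) * (1 * exp (m * t))
                + E t * (1 * m * exp (m * t)))); [lra| |].
    - intros x Hx. apply (is_derive_Rmult E (fun t => 1 * exp (m * t))); [|apply is_derive_exp_scal].
      unfold E. derive_by ring.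
    - intros x Hx. pose proof (exp_pos (m * x)).
      specialize (HP x ltac:(lra)). specialize (Hf x ltac:(lra)).
      apply Rabs_le_between in HP, Hf.
      assert (B : 0 <= (2 * phi x * phi1 x + 2 * phi1 x * (P x * phi x - f x)) + m * E x).
      { unfold E, m.
        assert (B1 : - (phi x ^ 2 + phi1 x ^ 2) <= 2 * phi x * phi1 x)
          by (pose proof (pow2_ge_0 (phi x + phi1 x)); nra).
        assert (B0 : f x ^ 2 <= g ^ 2) by nra.
        assert (B2 : - (phi1 x ^ 2 + g ^ 2) <= - 2 * phi1 x * f x) by (pose proof (pow2_ge_0 (phi1 x - f x)); nra).
        assert (B3 : - Q * (phi x ^ 2 + phi1 x ^ 2) <= 2 * phi1 x * (P x * phi x)).
        { replace (2 * phi1 x * (P x * phi x)) with (P x * (2 * phi x * phi1 x)) by ring.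
          assert (0 <= (Q - P x) * (phi x - phi1 x) ^ 2) by (apply Rmult_le_pos; [lra|apply pow2_ge_0]).
          assert (0 <= (Q + P x) * (phi x + phi1 x) ^ 2) by (apply Rmult_le_pos; [lra|apply pow2_ge_0]).
          nra. }
        assert (0 <= Q * g ^ 2) by (apply Rmult_le_pos; [lra|apply pow2_ge_0]).
        pose proof (pow2_ge_0 (phi x)). pose proof (pow2_ge_0 g). nra. }
      replace ((2 * phi x * phi1 x + 2 * phi1 x * (P x * phi x - f x)) * (1 * exp (m * x))
                + E x * (1 * m * exp (m * x)))
        with (((2 * phi x * phi1 x + 2 * phi1 x * (P x * phi x - f x)) + m * E x) * exp (m * x)) by ring.
      apply Rmult_le_pos; lra. }
  assert (He : 1 <= exp (m * s)).
  { rewrite <- exp_0. destruct (Req_dec (m * s) 0) as [->|]; [lra|].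
    left. apply exp_increasing. unfold m in *. nra. }
  assert (He' : exp (m * s) <= exp (m * s0)).
  { destruct (Req_dec s s0) as [->|]; [lra|]. left. apply exp_increasing. unfold m. nra. }
  fold m. set (e := exp (m * s0)) in *.
  set (a := Rabs (phi s0)). set (b := Rabs (phi1 s0)).
  assert (Ha : 0 <= a) by apply Rabs_pos. assert (Hb : 0 <= b) by apply Rabs_pos.
  assert (Ea : phi s0 ^ 2 = a ^ 2) by (unfold a; rewrite pow2_abs; reflexivity).
  assert (Eb : phi1 s0 ^ 2 = b ^ 2) by (unfold b; rewrite pow2_abs; reflexivity).
  assert (B : phi s ^ 2 <= E s * (1 * exp (m * s))).
  { unfold E. pose proof (pow2_ge_0 (phi s)). pose proof (pow2_ge_0 (phi1 s)). pose proof (pow2_ge_0 g). nra. }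
  assert (D : E s0 <= (a + b + g) ^ 2) by (unfold E; rewrite Ea, Eb; nra).
  apply Rsqr_incr_0_var; [|apply Rmult_le_pos; lra].
  rewrite <- Rsqr_abs. unfold Rsqr.
  apply Rle_trans with (E s0 * e); [simpl in B; lra|].
  apply Rle_trans with ((a + b + g) ^ 2 * e); [apply Rmult_le_compat_r; lra|].
  replace (e * (a + b + g) * (e * (a + b + g))) with ((a + b + g) ^ 2 * (e * e)) by ring.
  apply Rmult_le_compat_l; [apply pow2_ge_0|nra].
Qed.

(** [kap] is the logarithmic derivative of [v] at [s0]. The Wronskian of [phi] and [v] vanishes at
    [0] and has derivative [((P - y) * phi - f) * v]; its value at [s0], divided by [v s0], is the
    defect in the Robin condition. A backward Gronwall bound then recovers [phi] on [[0, s0]]. *)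
Lemma nondegenerate_robin (y y1 : R -> R) :
  (forall s, is_derive y s (y1 s)) -> layer_nondegenerate y ->
  exists s0 c kap K, 1 <= s0 /\ 0 < c /\ (forall s, s0 <= s -> c <= y s) /\ robin_at y s0 kap K.
Proof.
  intros H1 [s0 [c [v [v1 [Hs0 [Hc [Hyc [V0 [V1 [V2 Hvv]]]]]]]]]].
  exists s0, c.
  assert (Hv : v s0 <> 0) by (intros E; rewrite E in Hvv; lra).
  set (kap := v1 s0 / v s0).
  assert (Hkap : 0 < kap).
  { unfold kap. replace (v1 s0 / v s0) with ((v s0 * v1 s0) / (v s0 * v s0)) by (field; exact Hv).
    apply Rdiv_lt_0_compat; [exact Hvv|]. apply Rsqr_pos_lt in Hv. exact Hv. }
  destruct (bounded_on_segment y 0 s0) as [Q [HQ0 HQ]]; [lra| |].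
  { intros x _. exact (is_derive_continuous y x _ (H1 x)). }
  destruct (bounded_on_segment v 0 s0) as [V [HV0 HV]]; [lra| |].
  { intros x Hx. exact (is_derive_continuous v x _ (V1 x ltac:(lra))). }
  set (K1 := V * s0 / Rabs (v s0)).
  assert (Hav : 0 < Rabs (v s0)) by (apply Rabs_pos_lt, Hv).
  assert (HK1 : 0 < K1) by (apply Rdiv_lt_0_compat; nra).
  set (e := exp ((Q + 1 + 2) * s0)).
  assert (He : 1 <= e).
  { unfold e. rewrite <- exp_0 at 1. left. apply exp_increasing, Rmult_lt_0_compat; lra. }
  exists kap, (K1 + e * (1 + kap + K1 + 1)).
  assert (HKe : 0 < e * (1 + kap + K1 + 1)) by nra.
  split; [exact Hs0|]. split; [exact Hc|]. split; [exact Hyc|].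
  split; [exact Hkap|]. split; [lra|].
  intros P phi phi1 f eta g M Heta Hg HP F1 F2 F0 Hf HM.
  assert (HM0 : 0 <= M) by (eapply Rle_trans; [apply Rabs_pos|apply (HM 0); lra]).
  set (mu := eta * M + g).
  assert (Hmu : 0 <= mu) by (unfold mu; nra).
  assert (A : Rabs (phi1 s0 - kap * phi s0) <= K1 * mu).
  { assert (B : Rabs ((phi1 s0 * v s0 - phi s0 * v1 s0) - (phi1 0 * v 0 - phi 0 * v1 0))
              <= s0 * (V * mu) - 0 * (V * mu)).
    { apply (derive_abs_le (fun t => phi1 t * v t - phi t * v1 t)
         (fun t => ((P t - y t) * phi t - f t) * v t) (fun t => t * (V * mu)) (fun _ => V * mu)); [lra| | |].
      - intros x Hx. pose proof (V1 x ltac:(lra)). pose proof (V2 x ltac:(lra)).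
        pose proof (F1 x Hx). pose proof (F2 x Hx). derive_by ring.
      - intros x Hx. derive_by ring.
      - intros x Hx. rewrite Rabs_mult. rewrite (Rmult_comm V).
        apply Rmult_le_compat; [apply Rabs_pos|apply Rabs_pos| |apply HV; lra].
        eapply Rle_trans; [apply Rabs_triang|]. rewrite Rabs_Ropp, Rabs_mult.
        specialize (HP x ltac:(lra)). specialize (HM x ltac:(lra)). specialize (Hf x ltac:(lra)).
        unfold mu. apply Rplus_le_compat; [|exact Hf].
        apply Rmult_le_compat; auto using Rabs_pos. }
    rewrite V0, F0 in B. replace (phi1 0 * 0 - 0 * v1 0) with 0 in B by ring.
    rewrite Rminus_0_r in B.
    replace (phi1 s0 - kap * phi s0) with ((phi1 s0 * v s0 - phi s0 * v1 s0) / v s0)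
      by (unfold kap; field; exact Hv).
    unfold Rdiv at 1. rewrite Rabs_mult, Rabs_inv.
    apply Rle_trans with (s0 * (V * mu) * / Rabs (v s0)).
    - apply Rmult_le_compat_r; [left; apply Rinv_0_lt_compat, Hav|lra].
    - right. unfold K1. field. lra. }
  split.
  { eapply Rle_trans; [exact A|]. apply Rmult_le_compat_r; [exact Hmu|lra]. }
  intros s Hs.
  assert (B := gronwall_backward P phi phi1 f s0 (Q + 1) g ltac:(lra) F1 F2).
  assert (B' := B ltac:(intros t Ht; specialize (HP t Ht); specialize (HQ t Ht);
    apply Rabs_le_between in HP, HQ; apply Rabs_le; lra) Hf s Hs). fold e in B'.
  assert (D : Rabs (phi1 s0) <= kap * Rabs (phi s0) + K1 * mu).
  { replace (phi1 s0) with ((phi1 s0 - kap * phi s0) + kap * phi s0) by ring.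
    eapply Rle_trans; [apply Rabs_triang|]. rewrite Rabs_mult, (Rabs_right kap) by lra. lra. }
  assert (G : g <= mu) by (unfold mu; nra).
  pose proof (Rabs_pos (phi s0)) as Hp.
  eapply Rle_trans; [exact B'|].
  apply Rle_trans with (e * (1 + kap + K1 + 1) * (Rabs (phi s0) + mu)).
  - rewrite Rmult_assoc. apply Rmult_le_compat_l; [lra|].
    set (a := Rabs (phi s0)) in *. nra.
  - apply Rmult_le_compat_r; lra.
Qed.

(** The maximum [M] of the modulus of [phi] satisfies [M <= K3 * (eta * M + g)], and
    [eta = / (2 * K3)] absorbs the first term. No constant depends on [L]. *)
Lemma linear_estimate (y z : R -> R) (s0 t0 c kap kap' K K' : R) :
  0 < s0 -> 0 < t0 -> 0 < c -> robin_at y s0 kap K -> robin_at z t0 kap' K' ->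
  exists eta B : R, 0 < eta <= 1 /\ 0 < B /\
    forall (L : R) (P phi phi1 f : R -> R) (g : R), s0 < L - t0 ->
      (forall s, 0 <= s <= s0 -> Rabs (P s - y s) <= eta) ->
      (forall s, 0 <= s <= t0 -> Rabs (P (L - s) - z s) <= eta) ->
      (forall s, s0 <= s <= L - t0 -> c <= P s) ->
      (forall s, 0 <= s <= L -> is_derive phi s (phi1 s)) ->
      (forall s, 0 <= s <= L -> is_derive phi1 s (P s * phi s - f s)) ->
      phi 0 = 0 -> phi L = 0 ->
      (forall s, 0 <= s <= L -> Rabs (f s) <= g) ->
      forall s, 0 <= s <= L -> Rabs (phi s) <= B * g.
Proof.
  intros Hs0 Ht0 Hc [Hkap [HK HR]] [Hkap' [HK' HR']].
  set (B0 := / c + K / kap + K' / kap').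
  assert (I1 : 0 < / c) by (apply Rinv_0_lt_compat, Hc).
  assert (I2 : 0 < K / kap) by (apply Rdiv_lt_0_compat; lra).
  assert (I3 : 0 < K' / kap') by (apply Rdiv_lt_0_compat; lra).
  assert (HB0 : 0 < B0) by (unfold B0; lra).
  set (K3 := (1 + K + K') * (B0 + 1)).
  assert (HK3 : 1 < K3) by (unfold K3; nra).
  exists (/ (2 * K3)), (2 * K3).
  assert (Heta : 0 < / (2 * K3) <= 1).
  { split; [apply Rinv_0_lt_compat; lra|]. rewrite <- Rinv_1. apply Rinv_le_contravar; lra. }
  split; [exact Heta|]. split; [lra|].
  intros L P phi phi1 f g HL HP HP' HPc F1 F2 F0 FL Hf.
  assert (Hg : 0 <= g) by (eapply Rle_trans; [apply Rabs_pos|apply (Hf 0); lra]).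
  set (eta := / (2 * K3)) in *.
  destruct (continuity_ab_maj (fun s => Rabs (phi s)) 0 L) as [e [Hm He]]; [lra| |].
  { intros x Hx. apply (continuity_pt_comp phi Rabs); [exact (is_derive_continuity_pt phi x _ (F1 x Hx))|].
    apply Rcontinuity_abs. }
  cbv beta in Hm. set (M := Rabs (phi e)) in *.
  set (mu := eta * M + g).
  assert (HM : 0 <= M) by apply Rabs_pos.
  assert (Hmu : g <= mu) by (unfold mu; nra).
  destruct (HR P phi phi1 f eta g M) as [R1 R2]; try lra; auto.
  { intros s Hs. apply F1; lra. } { intros s Hs. apply F2; lra. }
  { intros s Hs. apply Hf; lra. } { intros s Hs. apply Hm; lra. }
  destruct (HR' (fun s => P (L - s)) (fun s => phi (L - s)) (fun s => - phi1 (L - s))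
     (fun s => f (L - s)) eta g M) as [R1' R2']; try lra; auto.
  { intros s Hs. apply is_derive_reflect. apply F1; lra. }
  { intros s Hs. eapply is_derive_eq; [apply is_derive_Ropp, is_derive_reflect, F2; lra|ring]. }
  { rewrite Rminus_0_r. exact FL. }
  { intros s Hs. apply Hf; lra. } { intros s Hs. apply Hm; lra. }
  cbv beta in R1', R2'. fold mu in R1, R2, R1', R2'.
  (* At a maximum located at [s0] the slope is nonpositive, while the Robin condition makes it at
     least [kap * phi - K * mu]; the other end is symmetric, and inside [P >= c] decides. The three
     terms of [B0] are these three cases. *)
  assert (Mid : forall sg, sg = 1 \/ sg = -1 -> forall s, s0 <= s <= L - t0 -> sg * phi s <= B0 * mu).
  { intros sg Hsg s Hs.
    destruct (max_conditions (fun t => sg * phi t) (fun t => sg * phi1 t)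
      (fun t => sg * (P t * phi t - f t)) s0 (L - t0) HL) as [r [Hr [Hmax [Hl [Hri Hi]]]]].
    { intros x Hx. pose proof (F1 x ltac:(lra)). derive_by ring. }
    { intros x Hx. pose proof (F2 x ltac:(lra)). derive_by ring. }
    specialize (Hmax s Hs). eapply Rle_trans; [exact Hmax|].
    destruct (Rle_lt_dec (sg * phi r) 0) as [|Hpos]; [nra|].
    assert (X : 0 <= K / kap * mu /\ 0 <= K' / kap' * mu /\ 0 <= / c * mu) by (repeat split; nra).
    unfold B0. destruct X as [X1 [X2 X3]].
    assert (Hsg1 : forall x, Rabs x <= K * mu -> - (K * mu) <= sg * x).
    { intros x Hx. apply Rabs_le_between in Hx. destruct Hsg as [->| ->]; lra. }
    assert (Hsg1' : forall x, Rabs x <= K' * mu -> - (K' * mu) <= sg * x).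
    { intros x Hx. apply Rabs_le_between in Hx. destruct Hsg as [->| ->]; lra. }
    destruct (Req_dec r s0) as [->|Hne1]; [|destruct (Req_dec r (L - t0)) as [->|Hne2]].
    - specialize (Hl HL). apply Hsg1 in R1.
      assert (sg * phi s0 <= K / kap * mu); [|lra].
      replace (K / kap * mu) with (K * mu / kap) by (field; lra).
      apply (proj1 (Rle_div_r _ _ _ Hkap)). lra.
    - specialize (Hri HL). apply Hsg1' in R1'.
      assert (sg * phi (L - t0) <= K' / kap' * mu); [|lra].
      replace (K' / kap' * mu) with (K' * mu / kap') by (field; lra).
      apply (proj1 (Rle_div_r _ _ _ Hkap')). lra.
    - specialize (Hi ltac:(lra)). specialize (HPc r Hr). specialize (Hf r ltac:(lra)).
      assert (sg * f r <= g).
      { apply Rabs_le_between in Hf. destruct Hsg as [->| ->]; lra. }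
      assert (sg * phi r <= / c * mu); [|lra].
      replace (/ c * mu) with (mu / c) by (field; lra).
      apply (proj1 (Rle_div_r _ _ _ Hc)). nra. }
  assert (Mid' : forall s, s0 <= s <= L - t0 -> Rabs (phi s) <= B0 * mu).
  { intros s Hs. apply Rabs_le.
    pose proof (Mid 1 ltac:(lra) s Hs). pose proof (Mid (-1) ltac:(lra) s Hs). lra. }
  assert (HM3 : forall s, 0 <= s <= L -> Rabs (phi s) <= K3 * mu).
  { intros s Hs. unfold K3.
    assert (0 <= B0 * mu) by nra. assert (0 <= K * ((B0 + 1) * mu)) by nra.
    assert (0 <= K' * ((B0 + 1) * mu)) by nra.
    destruct (Rlt_le_dec s s0) as [Hs1|Hs1]; [|destruct (Rle_lt_dec s (L - t0)) as [Hs2|Hs2]].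
    - specialize (R2 s ltac:(lra)). specialize (Mid' s0 ltac:(lra)).
      assert (K * (Rabs (phi s0) + mu) <= K * ((B0 + 1) * mu)) by (apply Rmult_le_compat_l; lra).
      lra.
    - specialize (Mid' s ltac:(lra)). lra.
    - specialize (R2' (L - s) ltac:(lra)). replace (L - (L - s)) with s in R2' by ring.
      specialize (Mid' (L - t0) ltac:(lra)).
      assert (K' * (Rabs (phi (L - t0)) + mu) <= K' * ((B0 + 1) * mu)) by (apply Rmult_le_compat_l; lra).
      lra. }
  assert (HMK : M <= K3 * mu) by (apply HM3; lra).
  assert (E : K3 * (eta * M) = M / 2) by (unfold eta; field; lra).
  intros s Hs. specialize (Hm s Hs). unfold mu in HMK. lra.
Qed.

(** * The approximate solution *)

Lemma layer_profile_weaken (y y1 : R -> R) (C C' : R) :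
  C <= C' -> layer_profile y y1 C -> layer_profile y y1 C'.
Proof.
  intros HC [H0 [H1 [H2 [H3 H4]]]]. split; [lra|]. split; [exact H1|]. split; [exact H2|].
  split; [exact H3|]. intros s Hs. destruct (H4 s Hs) as [A [B D]]. lra.
Qed.

(** The rescaled problem is [2 U'' = U^2 - hump L], [U 0 = U L = 0]; since
    [sqrt (hump L s) = sqrt s * sqrt (L - s) / sqrt L], the product [composite] of the two layers
    is an approximate solution on the whole interval. *)
Definition hump (L s : R) : R := s * (L - s) / L.
Definition composite (y z : R -> R) (L s : R) : R := y s * z (L - s) / sqrt L.
Definition composite1 (y y1 z z1 : R -> R) (L s : R) : R :=
  (y1 s * z (L - s) - y s * z1 (L - s)) / sqrt L.
Definition composite2 (y y1 z z1 : R -> R) (L s : R) : R :=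
  ((y s ^ 2 - s) / 2 * z (L - s) - 2 * y1 s * z1 (L - s)
   + y s * ((z (L - s) ^ 2 - (L - s)) / 2)) / sqrt L.
Definition residual (y y1 z z1 : R -> R) (L s : R) : R :=
  2 * composite2 y y1 z z1 L s - composite y z L s ^ 2 + hump L s.

Lemma composite_sym (y z : R -> R) (L s : R) : composite y z L (L - s) = composite z y L s.
Proof. unfold composite. replace (L - (L - s)) with s by ring. rewrite Rmult_comm. reflexivity. Qed.

Lemma residual_sym (y y1 z z1 : R -> R) (L s : R) :
  residual y y1 z z1 L (L - s) = residual z z1 y y1 L s.
Proof.
  unfold residual, composite2, hump. rewrite composite_sym.
  replace (L - (L - s)) with s by ring. unfold Rdiv. ring.
Qed.

Lemma composite_derive (y y1 z z1 : R -> R) (C C' L s : R) :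
  layer_profile y y1 C -> layer_profile z z1 C' ->
  is_derive (composite y z L) s (composite1 y y1 z z1 L s).
Proof.
  intros [_ [_ [Y1 _]]] [_ [_ [Z1 _]]]. unfold composite, composite1.
  pose proof (Y1 s). pose proof (Z1 (L - s)). derive_by (unfold Rdiv; ring).
Qed.

Lemma composite1_derive (y y1 z z1 : R -> R) (C C' L s : R) :
  layer_profile y y1 C -> layer_profile z z1 C' -> 0 <= s <= L ->
  is_derive (composite1 y y1 z z1 L) s (composite2 y y1 z z1 L s).
Proof.
  intros [_ [_ [Y1 [Y2 _]]]] [_ [_ [Z1 [Z2 _]]]] Hs. unfold composite1, composite2.
  pose proof (Y1 s). pose proof (Z1 (L - s)).
  pose proof (Y2 s ltac:(lra)). pose proof (Z2 (L - s) ltac:(lra)). derive_by (unfold Rdiv; ring).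
Qed.

(** The defect [1 - sqrt (L - s) / sqrt L] is at most [s / L]; since [L - s >= L / 2], the deviation
    of [z] from the square root adds at most [2 * C / L]. *)
Lemma far_factor (z z1 : R -> R) (C L s : R) :
  layer_profile z z1 C -> 1 <= L -> 0 <= s <= L / 2 ->
  Rabs (1 - z (L - s) / sqrt L) <= (s + 2 * C) / L.
Proof.
  intros [HC [_ [_ [_ H]]]] HL Hs. destruct (H (L - s) ltac:(lra)) as [A _].
  set (t := L - s) in *.
  assert (Hr : 1 <= sqrt L) by (rewrite <- sqrt_1 at 1; apply sqrt_le_1_alt; lra).
  assert (Hr2 : sqrt L * sqrt L = L) by (apply sqrt_sqrt; lra).
  assert (Ht : 0 <= sqrt t) by apply sqrt_pos.
  assert (Ht2 : sqrt t * sqrt t = t) by (apply sqrt_sqrt; unfold t; lra).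
  assert (Htr : sqrt t <= sqrt L) by (apply sqrt_le_1_alt; unfold t; lra).
  set (r := sqrt L) in *. set (q := sqrt t) in *.
  assert (A' : L * Rabs (z t - q) <= 2 * C).
  { pose proof (Rabs_pos (z t - q)). unfold t in *. nra. }
  apply (proj1 (Rle_div_r _ _ _ (Rlt_le_trans _ _ _ Rlt_0_1 HL))).
  replace (1 - z t / r) with ((1 - q / r) - (z t - q) / r) by (field; lra).
  assert (B1 : 0 <= 1 - q / r).
  { assert (q / r <= 1); [|lra]. apply Rdiv_le_intro; lra. }
  assert (B2 : L * (1 - q / r) <= s).
  { replace (L * (1 - q / r)) with (r * r - q * r) by (rewrite <- Hr2; field; lra).
    unfold t in Ht2. nra. }
  assert (B3 : Rabs ((z t - q) / r) <= Rabs (z t - q)).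
  { unfold Rdiv. rewrite Rabs_mult, (Rabs_right (/ r)).
    - assert (/ r <= 1) by (rewrite <- Rinv_1; apply Rinv_le_contravar; lra).
      pose proof (Rabs_pos (z t - q)). nra.
    - left. apply Rinv_0_lt_compat; lra. }
  assert (B4 : Rabs ((1 - q / r) - (z t - q) / r) <= (1 - q / r) + Rabs (z t - q)).
  { eapply Rle_trans; [apply Rabs_triang|]. rewrite Rabs_Ropp, (Rabs_right (1 - q / r)) by lra. lra. }
  apply Rle_trans with (((1 - q / r) + Rabs (z t - q)) * L); [apply Rmult_le_compat_r; lra|lra].
Qed.

Lemma layer_profile_growth (y y1 : R -> R) (C s : R) :
  layer_profile y y1 C -> 0 <= s -> Rabs (y s) <= sqrt s + C.
Proof.
  intros HP Hs. destruct (layer_profile_bounds y y1 C s HP Hs) as [A _].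
  pose proof (sqrt_pos s). replace (y s) with ((y s - sqrt s) + sqrt s) by ring.
  eapply Rle_trans; [apply Rabs_triang|]. rewrite (Rabs_right (sqrt s)) by lra. lra.
Qed.

Lemma composite_near (y y1 z z1 : R -> R) (C L s : R) :
  layer_profile y y1 C -> layer_profile z z1 C -> 1 <= L -> 0 <= s <= L / 2 ->
  Rabs (composite y z L s - y s) <= (sqrt s + C) * ((s + 2 * C) / L).
Proof.
  intros HY HZ HL Hs.
  pose proof (far_factor z z1 C L s HZ HL Hs) as A.
  pose proof (layer_profile_growth y y1 C s HY ltac:(lra)) as B.
  replace (composite y z L s - y s) with (y s * - (1 - z (L - s) / sqrt L))
    by (unfold composite, Rdiv; ring).
  rewrite Rabs_mult, Rabs_Ropp. apply Rmult_le_compat; auto using Rabs_pos.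
Qed.

Lemma Rabs_mult_le (a b A B : R) : Rabs a <= A -> Rabs b <= B -> Rabs (a * b) <= A * B.
Proof. intros. rewrite Rabs_mult. apply Rmult_le_compat; auto using Rabs_pos. Qed.

(** The identity [E] splits the residual into three products. In the first, the decay of
    [a = y^2 - s] compensates the growth in [s] of [1 - ze]; in the others, [b] and [z1 / r] are
    [O(1/L)] because they are taken at distance at least [L / 2] from the right end. *)
Lemma residual_left_half (y y1 z z1 : R -> R) (C L s : R) :
  layer_profile y y1 C -> layer_profile z z1 C -> 1 <= L -> 0 <= s <= L / 2 ->
  Rabs (residual y y1 z z1 L s)
  <= (C * (1 + 2 * C) * (2 + 2 * C) + 2 * C * (2 + C) + 8 * C ^ 2) / L.
Proof.
  intros HY HZ HL Hs.
  pose proof (far_factor z z1 C L s HZ HL Hs) as F.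
  pose proof (layer_profile_growth y y1 C s HY ltac:(lra)) as G.
  destruct (layer_profile_bounds y y1 C s HY ltac:(lra)) as [_ [_ Y1]].
  destruct HY as [HC [_ [_ [_ HY]]]]. destruct (HY s ltac:(lra)) as [_ [YA _]].
  destruct HZ as [_ [_ [_ [_ HZ]]]]. destruct (HZ (L - s) ltac:(lra)) as [_ [ZB Z1]].
  set (t := L - s) in *. set (r := sqrt L) in *.
  assert (Hr : 1 <= r) by (unfold r; rewrite <- sqrt_1 at 1; apply sqrt_le_1_alt; lra).
  assert (Hr2 : r * r = L) by (apply sqrt_sqrt; lra).
  set (ze := z t / r) in *. set (a := y s ^ 2 - s) in *. set (b := z t ^ 2 - t) in *.
  assert (E : residual y y1 z z1 L s =
     a * (ze * (1 - ze)) + b * (y s / r - s / L) - 4 * (y1 s * (z1 t / r))).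
  { unfold residual, composite2, composite, hump. fold t r. unfold ze, a, b.
    replace L with (r * r) by exact Hr2. field. lra. }
  assert (sL : 0 <= s / L <= 1).
  { split; [apply Rle_div_r; lra|apply Rdiv_le_intro; lra]. }
  assert (iL : 0 < / L) by (apply Rinv_0_lt_compat; lra).
  assert (iL1 : / L <= 1) by (rewrite <- Rinv_1; apply Rinv_le_contravar; lra).
  assert (Eze : (s + 2 * C) / L = s / L + 2 * C * / L) by (unfold Rdiv; ring).
  assert (Hze : Rabs ze <= 2 + 2 * C).
  { rewrite Eze in F. assert (2 * C * / L <= 2 * C) by nra.
    replace ze with (1 - (1 - ze)) by ring. eapply Rle_trans; [apply Rabs_triang|].
    rewrite Rabs_Ropp, Rabs_R1. lra. }
  assert (P1 : Rabs (a * (ze * (1 - ze))) <= C * (1 + 2 * C) * (2 + 2 * C) / L).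
  { assert (Q : Rabs (a * (1 - ze)) <= C * (1 + 2 * C) * / L).
    { apply Rle_trans with (Rabs a * ((s + 2 * C) / L)); [apply Rabs_mult_le; [lra|exact F]|].
      pose proof (Rabs_pos a).
      replace (Rabs a * ((s + 2 * C) / L)) with (Rabs a * (s + 2 * C) * / L) by (unfold Rdiv; ring).
      apply Rmult_le_compat_r; [lra|].
      assert (Rabs a * C <= C * C) by nra. nra. }
    replace (a * (ze * (1 - ze))) with (a * (1 - ze) * ze) by ring.
    eapply Rle_trans; [apply (Rabs_mult_le _ _ _ _ Q Hze)|right; unfold Rdiv; ring]. }
  assert (P2 : Rabs (b * (y s / r - s / L)) <= 2 * C * (2 + C) / L).
  { assert (Qb : Rabs b <= 2 * C * / L).
    { apply (proj1 (Rle_div_r _ _ _ (Rlt_le_trans _ _ _ Rlt_0_1 HL))).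
      pose proof (Rabs_pos b). unfold t in ZB. nra. }
    assert (Qy : Rabs (y s / r - s / L) <= 2 + C).
    { assert (Rabs (y s / r) <= 1 + C).
      { unfold Rdiv. rewrite Rabs_mult, (Rabs_right (/ r)) by (left; apply Rinv_0_lt_compat; lra).
        apply Rdiv_le_intro; [lra|].
        assert (sqrt s <= r) by (apply sqrt_le_1_alt; lra). nra. }
      eapply Rle_trans; [apply Rabs_triang|]. rewrite Rabs_Ropp, (Rabs_right (s / L)); lra. }
    eapply Rle_trans; [apply (Rabs_mult_le _ _ _ _ Qb Qy)|right; unfold Rdiv; ring]. }
  assert (P3 : Rabs (4 * (y1 s * (z1 t / r))) <= 8 * C ^ 2 / L).
  { assert (Qz : Rabs (z1 t / r) <= 2 * C * / L).
    { assert (r <= 2 * sqrt (1 + t)).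
      { apply Rsqr_incr_0_var; [|pose proof (sqrt_pos (1 + t)); lra].
        unfold Rsqr. replace (2 * sqrt (1 + t) * (2 * sqrt (1 + t)))
          with (4 * (sqrt (1 + t) * sqrt (1 + t))) by ring.
        rewrite sqrt_sqrt; unfold t; lra. }
      pose proof (Rabs_pos (z1 t)).
      unfold Rdiv. rewrite Rabs_mult, (Rabs_right (/ r)) by (left; apply Rinv_0_lt_compat; lra).
      replace (/ L) with (/ r * / r) by (rewrite <- Hr2; field; lra).
      rewrite <- Rmult_assoc. apply Rmult_le_compat_r; [left; apply Rinv_0_lt_compat; lra|].
      apply (proj1 (Rle_div_r _ _ _ (Rlt_le_trans _ _ _ Rlt_0_1 Hr))). nra. }
    rewrite Rabs_mult, (Rabs_right 4) by lra.
    pose proof (Rabs_mult_le _ _ _ _ Y1 Qz). unfold Rdiv. lra. }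
  rewrite E. eapply Rle_trans; [apply Rabs_triang|]. rewrite Rabs_Ropp.
  pose proof (Rabs_triang (a * (ze * (1 - ze))) (b * (y s / r - s / L))).
  replace ((C * (1 + 2 * C) * (2 + 2 * C) + 2 * C * (2 + C) + 8 * C ^ 2) / L)
    with (C * (1 + 2 * C) * (2 + 2 * C) / L + 2 * C * (2 + C) / L + 8 * C ^ 2 / L)
    by (unfold Rdiv; ring).
  lra.
Qed.

Lemma residual_bound (y y1 z z1 : R -> R) (C : R) :
  layer_profile y y1 C -> layer_profile z z1 C ->
  exists K, 0 < K /\ forall L s, 1 <= L -> 0 <= s <= L -> Rabs (residual y y1 z z1 L s) <= K / L.
Proof.
  intros HY HZ. pose proof (proj1 HY) as HC.
  exists (C * (1 + 2 * C) * (2 + 2 * C) + 2 * C * (2 + C) + 8 * C ^ 2). split; [nra|].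
  intros L s HL Hs. destruct (Rle_lt_dec s (L / 2)) as [H|H].
  - apply residual_left_half; auto; lra.
  - replace s with (L - (L - s)) by ring. rewrite residual_sym.
    apply residual_left_half; auto; lra.
Qed.

(** On the left half [L >= 8 * C] keeps the far factor above [1 - (1/2 + 1/4)]. *)
Lemma composite_left_lower (y y1 z z1 : R -> R) (C c L s : R) :
  layer_profile y y1 C -> layer_profile z z1 C -> 1 <= L -> 8 * C <= L -> 0 <= c ->
  0 <= s <= L / 2 -> c <= y s -> c / 4 <= composite y z L s.
Proof.
  intros HY HZ HL HC Hc Hs Hy.
  pose proof (far_factor z z1 C L s HZ HL Hs) as A.
  assert (B : (s + 2 * C) / L <= 3 / 4) by (apply Rdiv_le_intro; lra).
  apply Rabs_le_between in A.
  unfold composite. replace (y s * z (L - s) / sqrt L) with (y s * (z (L - s) / sqrt L))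
    by (unfold Rdiv; ring).
  nra.
Qed.

(** * Existence *)

Definition dirichlet_estimate (L B : R) (P : R -> R) : Prop :=
  forall (phi phi1 f : R -> R) (g : R),
    (forall s, 0 <= s <= L -> is_derive phi s (phi1 s)) ->
    (forall s, 0 <= s <= L -> is_derive phi1 s (P s * phi s - f s)) ->
    phi 0 = 0 -> phi L = 0 ->
    (forall s, 0 <= s <= L -> Rabs (f s) <= g) ->
    forall s, 0 <= s <= L -> Rabs (phi s) <= B * g.

Lemma composite_near_bound (y y1 z z1 : R -> R) (C L a s : R) :
  layer_profile y y1 C -> layer_profile z z1 C -> 1 <= a -> 0 <= s <= a -> 2 * a <= L ->
  Rabs (composite y z L s - y s) <= (a + C) * (a + 2 * C) / L.
Proof.
  intros HY HZ Ha Hs HL. pose proof (proj1 HY) as HC.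
  eapply Rle_trans; [apply (composite_near y y1 z z1 C L s HY HZ); lra|].
  assert (Hr : sqrt s <= a).
  { apply Rle_trans with (sqrt (a * a)); [apply sqrt_le_1_alt; nra|rewrite sqrt_square; lra]. }
  pose proof (sqrt_pos s).
  unfold Rdiv. rewrite <- Rmult_assoc. apply Rmult_le_compat_r.
  - left; apply Rinv_0_lt_compat; lra.
  - apply Rmult_le_compat; lra.
Qed.

(** Stated for all potentials near the composite because it serves twice: with the composite itself
    to run the contraction, and with the solution found, for its sign and for its own linearized
    operator. *)
Lemma composite_dirichlet_estimate (y y1 z z1 : R -> R) (C : R) :
  layer_profile y y1 C -> layer_profile z z1 C ->
  layer_nondegenerate y -> layer_nondegenerate z ->
  exists r B s0 L0 : R, 0 < r /\ 0 < B /\ 1 <= s0 /\ 1 <= L0 /\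
    forall L, L0 <= L -> forall P : R -> R,
      (forall s, 0 <= s <= L -> Rabs (P s - composite y z L s) <= r) ->
      (forall s, s0 <= s <= L - s0 -> 0 <= P s) /\ dirichlet_estimate L B P.
Proof.
  intros HY HZ NY NZ.
  pose proof HY as [HC [_ [Y1 _]]]. pose proof HZ as [_ [_ [Z1 _]]].
  destruct (nondegenerate_robin y y1 Y1 NY) as [s0 [c [kap [K [Hs0 [Hc [Hyc HR]]]]]]].
  destruct (nondegenerate_robin z z1 Z1 NZ) as [t0 [c' [kap' [K' [Ht0 [Hc' [Hzc HR']]]]]]].
  set (cm := Rmin c c').
  assert (Hcm : 0 < cm) by (apply Rmin_glb_lt; assumption).
  assert (Hcm1 : cm <= c) by apply Rmin_l. assert (Hcm2 : cm <= c') by apply Rmin_r.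
  destruct (linear_estimate y z s0 t0 (cm / 8) kap kap' K K') as [eta [B [Heta [HB HE]]]]; auto; try lra.
  set (a := s0 + t0).
  set (q := (a + C) * (a + 2 * C)).
  assert (Hq : 0 < q) by (unfold q, a; nra).
  (* Half of [eta] is spent between [P] and the composite, the other half between the composite and
     a layer; [cm / 8] is half of the lower bound [cm / 4] for the composite. *)
  set (r := Rmin (eta / 2) (cm / 8)).
  assert (Hr : 0 < r) by (apply Rmin_glb_lt; lra).
  assert (Hr1 : r <= eta / 2) by apply Rmin_l. assert (Hr2 : r <= cm / 8) by apply Rmin_r.
  assert (Hqe : 0 < 2 * q / eta) by (apply Rdiv_lt_0_compat; lra).
  exists r, B, a, (1 + 8 * C + 2 * a + 2 * q / eta).
  unfold a in *. split; [exact Hr|]. split; [exact HB|]. split; [lra|]. split; [lra|].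
  intros L HL P HP.
  assert (HqL : q / L <= eta / 2).
  { apply Rdiv_le_intro; [lra|].
    assert (2 * q / eta <= L) by lra. apply Rle_div_l in H; lra. }
  assert (Hpos : forall s, s0 <= s <= L - t0 -> cm / 8 <= P s).
  { intros s Hs. specialize (HP s ltac:(lra)). apply Rabs_le_between in HP.
    assert (cm / 4 <= composite y z L s); [|lra].
    destruct (Rle_lt_dec s (L / 2)) as [H|H].
    - apply (composite_left_lower y y1 z z1 C); auto; try lra. specialize (Hyc s ltac:(lra)). lra.
    - replace s with (L - (L - s)) by ring. rewrite composite_sym.
      apply (composite_left_lower z z1 y y1 C); auto; try lra.
      specialize (Hzc (L - s) ltac:(lra)). lra. }
  split; [intros s Hs; specialize (Hpos s ltac:(lra)); lra|].
  intros phi phi1 f g F1 F2 F0 FL Hf.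
  apply (HE L P phi phi1 f g); auto; try lra.
  - intros s Hs. pose proof (composite_near_bound y y1 z z1 C L (s0 + t0) s HY HZ ltac:(lra) ltac:(lra) ltac:(lra)) as A.
    fold q in A. specialize (HP s ltac:(lra)).
    replace (P s - y s) with ((P s - composite y z L s) + (composite y z L s - y s)) by ring.
    eapply Rle_trans; [apply Rabs_triang|lra].
  - intros s Hs. pose proof (composite_near_bound z z1 y y1 C L (s0 + t0) s HZ HY ltac:(lra) ltac:(lra) ltac:(lra)) as A.
    fold q in A. specialize (HP (L - s) ltac:(lra)). rewrite composite_sym in HP.
    replace (P (L - s) - z s) with ((P (L - s) - composite z y L s) + (composite z y L s - z s)) by ring.
    eapply Rle_trans; [apply Rabs_triang|lra].
Qed.

(** Shooting: a particular solution is corrected by a multiple of [v]. The estimate with zero source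
    shows [v L <> 0], since otherwise [v] would vanish identically despite its slope [1] at [0]. *)
Lemma dirichlet_solvable (P : R -> R) (L B : R) :
  0 < L -> (forall x, continuous P x) -> dirichlet_estimate L B P ->
  forall f, (forall x, continuous f x) ->
  exists phi phi1 : R -> R,
    (forall s, is_derive phi s (phi1 s)) /\
    (forall s, 0 <= s <= L -> is_derive phi1 s (P s * phi s - f s)) /\
    phi 0 = 0 /\ phi L = 0.
Proof.
  intros HL CP HE f Cf.
  destruct (linear_ivp P (fun _ => 0) 1 CP ltac:(intros; apply continuous_Rconst))
    as [v [v1 [V0 [V10 [V1 V2]]]]].
  destruct (linear_ivp P (fun s => - f s) 0 CP) as [p [p1 [P0 [P10 [P1 P2]]]]].
  { intros x. apply (continuous_ext (fun t => - 1 * f t)); [intros t; change (-1 * f t = - f t); ring|].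
    apply continuous_Rmult; [apply continuous_Rconst|apply Cf]. }
  assert (HvL : v L <> 0).
  { intros HvL.
    assert (Hv0 : forall s, 0 <= s <= L -> v s = 0).
    { intros s Hs. pose proof (HE v v1 (fun _ => 0) 0) as X.
      assert (Rabs (v s) <= B * 0).
      { apply X; auto.
        - intros t Ht. eapply is_derive_eq; [apply V2; lra|ring].
        - intros t _. rewrite Rabs_R0; lra. }
      pose proof (Rabs_pos (v s)). destruct (Req_dec (v s) 0) as [|Hne]; [assumption|].
      pose proof (Rabs_pos_lt _ Hne). lra. }
    destruct (is_derive_pos_local v 0 (v1 0) (V1 0)) as [d [Hd [Hr _]]]; [lra|].
    set (t := Rmin (d / 2) L).
    assert (Ht : 0 < t <= L /\ t < d) by (unfold t, Rmin; destruct Rle_dec; lra).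
    specialize (Hr t ltac:(lra)). specialize (Hv0 t ltac:(lra)). lra. }
  set (m := p L / v L).
  exists (fun s => p s - m * v s), (fun s => p1 s - m * v1 s). conjs.
  - intros s. derive_by ring.
  - intros s Hs. pose proof (P2 s ltac:(lra)). pose proof (V2 s ltac:(lra)). derive_by ring.
  - rewrite P0, V0. ring.
  - unfold m. field. exact HvL.
Qed.

Lemma Rabs_half_diff_sqr (a b r d : R) :
  Rabs a <= r -> Rabs b <= r -> Rabs (a - b) <= d -> Rabs ((a ^ 2 - b ^ 2) / 2) <= r * d.
Proof.
  intros Ha Hb Hd. replace ((a ^ 2 - b ^ 2) / 2) with ((a + b) / 2 * (a - b)) by field.
  apply Rabs_mult_le; [|exact Hd]. apply Rabs_le_between in Ha, Hb. apply Rabs_le. lra.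
Qed.

(* Contraction in the ball of radius [rho] of [C[0, L]] for the map
   [u |-> (- d^2/dx^2 + w)^-1 ((N - u^2) / 2)]. *)
Lemma quadratic_correction (w N : R -> R) (L B rho : R) :
  0 < L -> 0 < B -> 0 < rho -> 2 * B * rho <= 1 ->
  (forall x, continuous w x) -> (forall x, continuous N x) ->
  dirichlet_estimate L B w ->
  (forall s, 0 <= s <= L -> Rabs (N s) <= rho / B) ->
  exists phi phi1 : R -> R,
    (forall s, is_derive phi s (phi1 s)) /\
    (forall s, 0 <= s <= L -> is_derive phi1 s (w s * phi s - (N s - phi s ^ 2) / 2)) /\
    phi 0 = 0 /\ phi L = 0 /\ forall s, 0 <= s <= L -> Rabs (phi s) <= rho.
Proof.
  intros HL HB Hrho HBr Cw CN HE HN.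
  set (src := fun (u : R -> R) s => (N s - u s ^ 2) / 2).
  assert (Csrc : forall u, (forall x, continuous u x) -> forall x, continuous (src u) x).
  { intros u Cu x. unfold src.
    apply (continuous_ext (fun s => / 2 * (N s + - 1 * (u s * u s)))).
    - intros s. change (/ 2 * (N s + - 1 * (u s * u s)) = (N s - u s ^ 2) / 2). field.
    - apply continuous_Rmult; [apply continuous_Rconst|].
      apply continuous_Rplus; [apply CN|]. apply continuous_Rmult; [apply continuous_Rconst|].
      apply continuous_Rmult; apply Cu. }
  (* The solution operator must be chosen on all functions; at a discontinuous [u] its value is
     arbitrary, here [u] itself. *)
  assert (HT : forall u : R -> R, exists phi : R -> R, (forall x, continuous u x) ->
     exists phi1, (forall s, is_derive phi s (phi1 s)) /\
       (forall s, 0 <= s <= L -> is_derive phi1 s (w s * phi s - src u s)) /\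
       phi 0 = 0 /\ phi L = 0).
  { intros u. destruct (classic (forall x, continuous u x)) as [Cu|Cu].
    - destruct (dirichlet_solvable w L B HL Cw HE (src u) (Csrc u Cu)) as [phi [phi1 H]].
      exists phi. intros _. exists phi1. exact H.
    - exists u. intros H. contradiction. }
  destruct (choice _ HT) as [T HTs]. clear HT.
  assert (Tball : forall u, (forall x, continuous u x) ->
    (forall s, 0 <= s <= L -> Rabs (u s) <= rho) -> forall s, 0 <= s <= L -> Rabs (T u s) <= rho).
  { intros u Cu Hu s Hs. destruct (HTs u Cu) as [phi1 [H1 [H2 [H0 HLL]]]].
    replace rho with (B * (rho / B)) by (field; lra).
    apply (HE (T u) phi1 (src u)); auto.
    intros t Ht. unfold src.
    replace ((N t - u t ^ 2) / 2) with (N t / 2 + - ((u t ^ 2 - 0 ^ 2) / 2)) by (unfold Rdiv; ring).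
    eapply Rle_trans; [apply Rabs_triang|]. rewrite Rabs_Ropp.
    specialize (HN t Ht). specialize (Hu t Ht).
    assert (A : Rabs ((u t ^ 2 - 0 ^ 2) / 2) <= rho * rho).
    { apply Rabs_half_diff_sqr; [exact Hu|rewrite Rabs_R0; lra|rewrite Rminus_0_r; exact Hu]. }
    assert (D : Rabs (N t / 2) <= rho / B / 2).
    { unfold Rdiv at 1. rewrite Rabs_mult, (Rabs_right (/ 2)) by lra. lra. }
    assert (rho * rho <= rho / B / 2); [|lra].
    apply (Rmult_le_reg_r (2 * B)); [lra|].
    replace (rho / B / 2 * (2 * B)) with rho by (field; lra). nra. }
  assert (Tcontr : forall u u' d, (forall x, continuous u x) -> (forall x, continuous u' x) ->
    (forall s, 0 <= s <= L -> Rabs (u s) <= rho) -> (forall s, 0 <= s <= L -> Rabs (u' s) <= rho) ->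
    (forall s, 0 <= s <= L -> Rabs (u s - u' s) <= d) ->
    forall s, 0 <= s <= L -> Rabs (T u s - T u' s) <= d / 2).
  { intros u u' d Cu Cu' Hu Hu' Hd s Hs.
    destruct (HTs u Cu) as [phi1 [H1 [H2 [H0 HLL]]]].
    destruct (HTs u' Cu') as [psi1 [G1 [G2 [G0 GL]]]].
    assert (Hd0 : 0 <= d) by (eapply Rle_trans; [apply Rabs_pos|apply (Hd s Hs)]).
    apply Rle_trans with (B * (rho * d)); [|nra].
    apply (HE (fun t => T u t - T u' t) (fun t => phi1 t - psi1 t) (fun t => src u t - src u' t)); auto.
    - intros t Ht. apply is_derive_Rminus; [apply H1|apply G1].
    - intros t Ht. eapply is_derive_eq; [apply is_derive_Rminus; [apply H2|apply G2]; exact Ht|ring].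
    - lra.
    - lra.
    - intros t Ht. unfold src.
      replace ((N t - u t ^ 2) / 2 - (N t - u' t ^ 2) / 2) with ((u' t ^ 2 - u t ^ 2) / 2)
        by (unfold Rdiv; ring).
      apply Rabs_half_diff_sqr; auto. rewrite Rabs_minus_sym. auto. }
  (* The argument is clamped so that the bounds on [[0, L]] hold on the whole line, as
     [geometric_limit] requires. *)
  set (u := fix u (n : nat) : R -> R := match n with
     | O => fun _ => 0 | S n => fun s => T (u n) (clamp 0 L s) end).
  assert (Hcl : forall x, 0 <= clamp 0 L x <= L) by (intros x; apply clamp_in; lra).
  assert (Cu : forall n x, continuous (u n) x).
  { induction n as [|n IH]; intros x; simpl; [apply continuous_Rconst|].
    apply (continuous_clamp_comp (T (u n)) 0 L); [lra|]. apply (continuous_on_of_continuous (segment 0 L)). intros t _.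
    destruct (HTs (u n) IH) as [phi1 [H1 _]]. exact (is_derive_continuous _ t _ (H1 t)). }
  assert (Hu : forall n s, Rabs (u n s) <= rho).
  { induction n as [|n IH]; intros s; simpl; [rewrite Rabs_R0; lra|].
    apply Tball; auto. }
  assert (Hstep : forall n s, Rabs (u (S n) s - u n s) <= rho * (1 / 2) ^ n).
  { induction n as [|n IH]; intros s.
    - change (u 0%nat s) with 0. rewrite Rminus_0_r. specialize (Hu 1%nat s). simpl pow. lra.
    - change (u (S (S n)) s) with (T (u (S n)) (clamp 0 L s)).
      change (u (S n) s) with (T (u n) (clamp 0 L s)).
      replace (rho * (1 / 2) ^ S n) with (rho * (1 / 2) ^ n / 2) by (simpl; field).
      apply Tcontr; auto. }
  destruct (geometric_limit u Cu) as [v [Cv Hv]].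
  { intros b _. exists rho. intros n x _. apply Hstep. }
  destruct (Hv (1 + L)) as [K HK]; [lra|].
  assert (HK' : forall n s, 0 <= s <= L -> Rabs (u n s - v s) <= K * (1 / 2) ^ n).
  { intros n s Hs. apply HK. rewrite Rabs_right; lra. }
  assert (Hvb : forall s, 0 <= s <= L -> Rabs (v s) <= rho).
  { intros s Hs. assert (Rabs (v s) - rho <= 0); [|lra].
    apply (le_of_half_pow _ K). intros n. specialize (HK' n s Hs). specialize (Hu n s).
    assert (Rabs (v s) <= Rabs (u n s) + Rabs (u n s - v s)).
    { unfold Rabs; repeat destruct Rcase_abs; lra. }
    lra. }
  assert (Fix : forall s, 0 <= s <= L -> T v s = v s).
  { intros s Hs. assert (A : Rabs (T v s - v s) <= 0).
    { apply (le_of_half_pow _ K). intros n.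
      assert (A : Rabs (T (u n) s - T v s) <= K * (1 / 2) ^ n / 2).
      { apply Tcontr; auto. }
      pose proof (HK' (S n) s Hs) as D. simpl in D. rewrite clamp_id in D by exact Hs.
      replace (T v s - v s) with (- (T (u n) s - T v s) + (T (u n) s - v s)) by ring.
      eapply Rle_trans; [apply Rabs_triang|]. rewrite Rabs_Ropp. lra. }
    destruct (Req_dec (T v s - v s) 0) as [|Hne]; [lra|].
    pose proof (Rabs_pos_lt _ Hne). lra. }
  destruct (HTs v Cv) as [phi1 [H1 [H2 [H0 HLL]]]].
  exists (T v), phi1. conjs; auto.
  intros s Hs. eapply is_derive_eq; [apply H2, Hs|]. unfold src. rewrite (Fix s Hs). reflexivity.
Qed.

Lemma scaled_solution (y y1 z z1 : R -> R) (C : R) :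
  layer_profile y y1 C -> layer_profile z z1 C ->
  layer_nondegenerate y -> layer_nondegenerate z ->
  exists K B s0 L0 : R, 0 < K /\ 0 < B /\ 1 <= s0 /\ 1 <= L0 /\
    forall L, L0 <= L -> exists U U1 : R -> R,
      (forall s, 0 <= s <= L -> is_derive U s (U1 s)) /\
      (forall s, 0 <= s <= L -> is_derive U1 s ((U s ^ 2 - hump L s) / 2)) /\
      U 0 = 0 /\ U L = 0 /\
      (forall s, 0 <= s <= L -> Rabs (U s - composite y z L s) <= K / L) /\
      (forall s, s0 <= s <= L - s0 -> 0 <= U s) /\ dirichlet_estimate L B U.
Proof.
  intros HY HZ NY NZ.
  destruct (composite_dirichlet_estimate y y1 z z1 C HY HZ NY NZ)
    as [r [B [s0 [L0 [Hr [HB [Hs0 [HL0 HE]]]]]]]].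
  destruct (residual_bound y y1 z z1 C HY HZ) as [K0 [HK0 HN]].
  set (K := B * K0). assert (HK : 0 < K) by (unfold K; nra).
  assert (Hkr : 0 < K / r) by (apply Rdiv_lt_0_compat; lra).
  assert (HBK : 0 < 2 * B * K) by nra.
  (* The radius of the ball is [K / L]: the term [K / r] makes it at most [r], so that the estimate
     applies to [U] too, and [2 * B * K] makes the map a contraction. *)
  exists K, B, s0, (L0 + K / r + 2 * B * K). conjs; auto; try lra.
  intros L HL.
  set (w := composite y z L).
  assert (HKr : K / L <= r).
  { apply Rdiv_le_intro; [lra|]. assert (A : K / r <= L) by lra. apply Rle_div_l in A; lra. }
  assert (Hw : forall s, is_derive w s (composite1 y y1 z z1 L s)).
  { intros s. apply (composite_derive y y1 z z1 C C L s HY HZ). }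
  assert (HEw : dirichlet_estimate L B w).
  { apply (HE L ltac:(lra)). intros s _. unfold w. rewrite Rminus_diag, Rabs_R0. lra. }
  assert (Cw : forall x, continuous w x) by (intros x; exact (is_derive_continuous w x _ (Hw x))).
  set (N := fun s => residual y y1 z z1 L (clamp 0 L s)).
  pose proof HY as [HC [Y0 [Y1 [Y2 Y3]]]]. pose proof HZ as [_ [Z0 [Z1 [Z2 Z3]]]].
  assert (CN : forall x, continuous N x).
  { intros x. apply (continuous_clamp_comp (residual y y1 z z1 L) 0 L); [lra|]. apply (continuous_on_of_continuous (segment 0 L)). intros t Ht.
    assert (X : exists l, is_derive (residual y y1 z z1 L) t l).
    { unfold residual, composite2, composite, hump. unfold segment in Ht.
      pose proof (Y1 t). pose proof (Z1 (L - t)).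
      pose proof (Y2 t ltac:(lra)). pose proof (Z2 (L - t) ltac:(lra)).
      eexists. der. }
    destruct X as [l Hl]. exact (is_derive_continuous _ t _ Hl). }
  destruct (quadratic_correction w N L B (K / L)) as [phi [phi1 [F1 [F2 [F0 [FL Fb]]]]]]; auto; try lra.
  - apply Rdiv_lt_0_compat; lra.
  - replace (2 * B * (K / L)) with (2 * B * K / L) by (unfold Rdiv; ring). apply Rdiv_le_intro; lra.
  - intros s Hs. unfold N. rewrite clamp_id by exact Hs.
    replace (K / L / B) with (K0 / L) by (unfold K; field; lra). apply HN; lra.
  - exists (fun s => w s + phi s), (fun s => composite1 y y1 z z1 L s + phi1 s).
    assert (Fb' : forall s, 0 <= s <= L -> Rabs (w s + phi s - w s) <= K / L).
    { intros s Hs. replace (w s + phi s - w s) with (phi s) by ring. auto. }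
    destruct (HE L ltac:(lra) (fun s => w s + phi s)) as [E1 E2].
    { intros s Hs. specialize (Fb' s Hs). fold w. lra. }
    conjs; auto.
    + intros s Hs. derive_by ring.
    + intros s Hs. pose proof (F2 s Hs).
      pose proof (composite1_derive y y1 z z1 C C L s HY HZ Hs) as W2.
      eapply is_derive_eq; [apply is_derive_Rplus; [exact W2|exact H]|].
      unfold N. rewrite clamp_id by exact Hs. unfold residual. fold w. field.
    + rewrite F0. unfold w, composite. rewrite Y0. unfold Rdiv. ring.
    + rewrite FL. unfold w, composite. rewrite Rminus_diag, Z0. unfold Rdiv. ring.
Qed.

(** * Pointwise estimates *)

Lemma derive_lipschitz (f f1 : R -> R) (a b M : R) :
  (forall x, a <= x <= b -> is_derive f x (f1 x)) ->
  (forall x, a <= x <= b -> Rabs (f1 x) <= M) ->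
  forall s t, a <= s <= b -> a <= t <= b -> Rabs (f t - f s) <= M * Rabs (t - s).
Proof.
  intros H HM.
  assert (Ord : forall s t, a <= s <= b -> a <= t <= b -> s <= t -> Rabs (f t - f s) <= M * (t - s)).
  { intros s t Hs Ht Hst.
    replace (M * (t - s)) with (t * M - s * M) by ring.
    apply (derive_abs_le f f1 (fun x => x * M) (fun _ => M)); [exact Hst| | |].
    - intros x Hx. apply H; lra.
    - intros x Hx. derive_by ring.
    - intros x Hx. apply HM; lra. }
  intros s t Hs Ht. destruct (Rle_lt_dec s t).
  - rewrite (Rabs_right (t - s)) by lra. apply Ord; assumption.
  - rewrite Rabs_minus_sym, (Rabs_minus_sym t s), (Rabs_right (s - t)) by lra. apply Ord; lra.
Qed.

(** On [[0, D]] the difference [U - y] and its second derivative are [O(1/L)]. By the mean value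
    theorem one slope is [O(1/L)], hence all are, and the zero at [0] gives the linear bound. Beyond
    [D] the composite is compared with [y] directly, and [s >= 1] absorbs the lower powers. *)
Lemma layer_approximation (y y1 z z1 : R -> R) (C K D : R) :
  layer_profile y y1 C -> layer_profile z z1 C -> 0 < K -> 1 <= D ->
  exists K2, 0 < K2 /\ forall (L : R) (U U1 : R -> R), 2 * D <= L ->
    (forall s, 0 <= s <= L -> is_derive U s (U1 s)) ->
    (forall s, 0 <= s <= L -> is_derive U1 s ((U s ^ 2 - hump L s) / 2)) ->
    U 0 = 0 -> (forall s, 0 <= s <= L -> Rabs (U s - composite y z L s) <= K / L) ->
    (forall s, 0 <= s <= D -> Rabs (U s - y s) <= K2 / L * s) /\
    (forall s, D <= s <= L / 2 -> Rabs (U s - y s) <= K2 / L * (s * sqrt s)).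
Proof.
  intros HY HZ HK HD. pose proof HY as [HC [Y0 [Y1 [Y2 _]]]].
  set (E := K + (D + C) * (D + 2 * C)).
  assert (HE : 0 < E) by (unfold E; nra).
  set (Q := E + 2 * (D + C)).
  assert (HQ : 0 < Q) by (unfold Q; nra).
  set (F := Q * E + D * D). assert (HF : 0 < F) by (unfold F; nra).
  set (k1 := E + D * F). set (k2 := K + (1 + C) * (1 + 2 * C)).
  assert (Hk1 : 0 < k1) by (unfold k1; nra). assert (Hk2 : 0 < k2) by (unfold k2; nra).
  exists (k1 + k2). split; [lra|].
  intros L U U1 HL H1 H2 U0 Hw.
  assert (iL : 0 < / L) by (apply Rinv_0_lt_compat; lra).
  assert (iL1 : / L <= 1) by (rewrite <- Rinv_1; apply Rinv_le_contravar; lra).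
  split.
  - assert (He : forall s, 0 <= s <= D -> Rabs (U s - y s) <= E * / L).
    { intros s Hs. pose proof (composite_near_bound y y1 z z1 C L D s HY HZ HD Hs HL) as A.
      specialize (Hw s ltac:(lra)).
      replace (U s - y s) with ((U s - composite y z L s) + (composite y z L s - y s)) by ring.
      eapply Rle_trans; [apply Rabs_triang|]. unfold E, Rdiv in *. lra. }
    set (e1 := fun s => U1 s - y1 s).
    set (e2 := fun s => ((U s + y s) * (U s - y s) + s * s / L) / 2).
    assert (D1 : forall s, 0 <= s <= D -> is_derive (fun t => U t - y t) s (e1 s)).
    { intros s Hs. pose proof (H1 s ltac:(lra)). unfold e1. derive_by ring. }
    assert (D2 : forall s, 0 <= s <= D -> is_derive e1 s (e2 s)).
    { intros s Hs. pose proof (H2 s ltac:(lra)). pose proof (Y2 s ltac:(lra)).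
      unfold e1, e2. derive_by (unfold hump; field; lra). }
    assert (B2 : forall s, 0 <= s <= D -> Rabs (e2 s) <= F * / L).
    { intros s Hs. specialize (He s Hs).
      pose proof (layer_profile_growth y y1 C s HY ltac:(lra)) as G.
      assert (Hr : sqrt s <= D).
      { apply Rle_trans with (sqrt (D * D)); [apply sqrt_le_1_alt; nra|rewrite sqrt_square; lra]. }
      assert (A : Rabs (U s + y s) <= Q).
      { replace (U s + y s) with ((U s - y s) + 2 * y s) by ring.
        eapply Rle_trans; [apply Rabs_triang|]. rewrite Rabs_mult, (Rabs_right 2) by lra.
        unfold Q. nra. }
      pose proof (Rabs_mult_le _ _ _ _ A He) as A2.
      assert (A3 : 0 <= s * s / L <= D * D * / L).
      { unfold Rdiv. split; [apply Rmult_le_pos; [nra|lra]|]. apply Rmult_le_compat_r; [lra|nra]. }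
      unfold e2. unfold Rdiv at 1. rewrite Rabs_mult, (Rabs_right (/ 2)) by lra.
      pose proof (Rabs_triang ((U s + y s) * (U s - y s)) (s * s / L)).
      rewrite (Rabs_right (s * s / L)) in H by lra.
      pose proof (Rabs_pos ((U s + y s) * (U s - y s) + s * s / L)). unfold F. lra. }
    destruct (mean_value (fun t => U t - y t) e1 0 D) as [xi [Hxi Exi]]; [lra|exact D1|].
    rewrite U0, Y0 in Exi. replace (U D - y D - (0 - 0)) with (U D - y D) in Exi by ring.
    assert (Bxi : Rabs (e1 xi) <= E * / L).
    { specialize (He D ltac:(lra)). rewrite Exi, Rminus_0_r, Rabs_mult, (Rabs_right D) in He by lra.
      pose proof (Rabs_pos (e1 xi)). nra. }
    assert (B1 : forall s, 0 <= s <= D -> Rabs (e1 s) <= k1 * / L).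
    { intros s Hs.
      pose proof (derive_lipschitz e1 e2 0 D (F * / L) D2 B2 xi s ltac:(lra) Hs) as A.
      assert (A' : Rabs (s - xi) <= D) by (apply Rabs_le; lra).
      assert (A2 : F * / L * Rabs (s - xi) <= F * / L * D).
      { apply Rmult_le_compat_l; [nra|exact A']. }
      replace (e1 s) with ((e1 s - e1 xi) + e1 xi) by ring.
      eapply Rle_trans; [apply Rabs_triang|]. unfold k1. lra. }
    intros s Hs.
    pose proof (derive_lipschitz (fun t => U t - y t) e1 0 D (k1 * / L) D1 B1 0 s ltac:(lra) Hs) as A.
    cbv beta in A. rewrite U0, Y0, !Rminus_0_r, (Rabs_right s) in A by lra.
    eapply Rle_trans; [exact A|]. apply Rmult_le_compat_r; [lra|]. unfold Rdiv. nra.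
  - intros s Hs. specialize (Hw s ltac:(lra)).
    pose proof (composite_near y y1 z z1 C L s HY HZ ltac:(lra) ltac:(lra)) as A.
    assert (Hr : 1 <= sqrt s) by (rewrite <- sqrt_1 at 1; apply sqrt_le_1_alt; lra).
    set (q := sqrt s) in *.
    assert (A1 : (q + C) * (s + 2 * C) <= (1 + C) * (1 + 2 * C) * (s * q)).
    { replace ((1 + C) * (1 + 2 * C) * (s * q)) with ((q * (1 + C)) * (s * (1 + 2 * C))) by ring.
      apply Rmult_le_compat; nra. }
    assert (A2 : 1 <= s * q) by nra.
    replace (U s - y s) with ((U s - composite y z L s) + (composite y z L s - y s)) by ring.
    eapply Rle_trans; [apply Rabs_triang|].
    apply Rle_trans with ((K + (q + C) * (s + 2 * C)) * / L).
    + unfold Rdiv in *. lra.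
    + unfold Rdiv. rewrite Rmult_assoc, (Rmult_comm (/ L)), <- Rmult_assoc.
      apply Rmult_le_compat_r; [lra|]. unfold k2. nra.
Qed.

(** * The interior estimate *)

Lemma hump_sym (L s : R) : hump L (L - s) = hump L s.
Proof. unfold hump, Rdiv. ring. Qed.

Lemma hump_bounds (L a s : R) :
  0 < a -> 2 * a <= L -> a <= s <= L - a -> a / 2 <= hump L s <= L / 4.
Proof.
  intros Ha HL Hs. unfold hump. split.
  - apply Rle_div_intro; [lra|].
    assert (0 <= (s - a) * (L - a - s)) by (apply Rmult_le_pos; lra).
    assert (0 <= a * (L - 2 * a)) by (apply Rmult_le_pos; lra). nra.
  - apply Rdiv_le_intro; [lra|]. assert (0 <= (L - 2 * s) ^ 2) by apply pow2_ge_0. nra.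
Qed.

Lemma is_derive_hump (L s : R) : 0 < L -> is_derive (hump L) s (1 - 2 * s / L).
Proof. intros HL. unfold hump. derive_by (field; lra). Qed.

Lemma is_derive_sqrt_hump (L s : R) :
  0 < L -> 0 < hump L s ->
  is_derive (fun t => sqrt (hump L t)) s ((1 - 2 * s / L) * / (2 * sqrt (hump L s))).
Proof.
  intros HL Hs. eapply is_derive_eq.
  - apply (is_derive_sqrt (hump L)); [apply is_derive_hump, HL|exact Hs].
  - reflexivity.
Qed.

(** For [h = hump L] one has [h'' = - 2 / L] and [h'^2 = 1 - 4 h / L], so the terms in [1 / L]
    cancel and the formula is exact. *)
Lemma is_derive2_sqrt_hump (L s : R) :
  0 < L -> 0 < hump L s ->
  is_derive (fun t => (1 - 2 * t / L) * / (2 * sqrt (hump L t))) s (- / (4 * sqrt (hump L s) ^ 3)).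
Proof.
  intros HL Hs. pose proof (sqrt_lt_R0 _ Hs) as Hg.
  assert (Hg2 : sqrt (hump L s) ^ 2 = hump L s) by (apply pow2_sqrt; lra).
  set (g := sqrt (hump L s)) in *.
  apply (is_derive_eq _ _ ((- (2 / L)) * / (2 * g)
     + (1 - 2 * s / L) * (- (2 * ((1 - 2 * s / L) * / (2 * g))) / (2 * g) ^ 2))).
  - apply (is_derive_Rmult (fun t => 1 - 2 * t / L) (fun t => / (2 * sqrt (hump L t)))).
    + derive_by (field; lra).
    + apply (is_derive_inv (fun t => 2 * sqrt (hump L t))); [|fold g; lra].
      apply is_derive_scal, is_derive_sqrt_hump; assumption.
  - assert (A : (1 - 2 * s / L) ^ 2 = 1 - 4 * g ^ 2 / L) by (rewrite Hg2; unfold hump; field; lra).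
    replace (- (2 / L) * / (2 * g) + (1 - 2 * s / L) * (- (2 * ((1 - 2 * s / L) * / (2 * g))) / (2 * g) ^ 2))
      with (- (4 * g ^ 2 / L + (1 - 2 * s / L) ^ 2) * / (4 * g ^ 3)) by (field; lra).
    rewrite A. field. lra.
Qed.

Lemma is_derive_inv_hump (k L s : R) :
  0 < L -> 0 < hump L s ->
  is_derive (fun t => k / hump L t ^ 2) s (- 2 * k * (1 - 2 * s / L) / hump L s ^ 3).
Proof.
  intros HL Hs. assert (P : 0 < hump L s ^ 2) by (apply pow_lt, Hs).
  apply (is_derive_eq _ _ (k * (- (2 * hump L s * (1 - 2 * s / L)) / (hump L s ^ 2) ^ 2))).
  - apply is_derive_scal. apply (is_derive_inv (fun t => hump L t ^ 2)); [|lra].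
    apply is_derive_Rsqr, is_derive_hump, HL.
  - set (h := hump L s) in *. field. lra.
Qed.

Lemma is_derive2_inv_hump (k L s : R) :
  0 < L -> 0 < hump L s ->
  is_derive (fun t => - 2 * k * (1 - 2 * t / L) / hump L t ^ 3) s
    (k * (6 * (1 - 2 * s / L) ^ 2 / hump L s ^ 4 + 4 / (L * hump L s ^ 3))).
Proof.
  intros HL Hs. assert (P : 0 < hump L s ^ 3) by (apply pow_lt, Hs).
  apply (is_derive_eq _ _ ((4 * k / L) * / hump L s ^ 3
    + (- 2 * k * (1 - 2 * s / L)) * (- (3 * hump L s ^ 2 * (1 - 2 * s / L)) / (hump L s ^ 3) ^ 2))).
  - apply (is_derive_Rmult (fun t => - 2 * k * (1 - 2 * t / L)) (fun t => / hump L t ^ 3)).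
    + derive_by (field; lra).
    + apply (is_derive_inv (fun t => hump L t ^ 3)); [|lra].
      apply is_derive_Rcube, is_derive_hump, HL.
  - set (h := hump L s) in *. field. lra.
Qed.

(* The barrier [k / hump^2]: its second derivative is at most [7 k / hump^4], while
   [(sqrt hump)'' = - 1 / (4 hump^(3/2))]. *)
Lemma interior_approximation (L D k : R) (U U1 : R -> R) :
  8 <= D -> 2 * D < L -> 1 <= k ->
  (forall s, 0 <= s <= L -> is_derive U s (U1 s)) ->
  (forall s, 0 <= s <= L -> is_derive U1 s ((U s ^ 2 - hump L s) / 2)) ->
  (forall s, D <= s <= L - D -> 0 <= U s) ->
  Rabs (U D - sqrt (hump L D)) <= k / D ^ 2 ->
  Rabs (U (L - D) - sqrt (hump L (L - D))) <= k / D ^ 2 ->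
  forall s, D <= s <= L - D -> Rabs (U s - sqrt (hump L s)) <= k / hump L s ^ 2.
Proof.
  intros HD HL Hk H1 H2 HU B1 B2.
  assert (Hh : forall s, D <= s <= L - D -> 4 <= hump L s <= L / 4).
  { intros s Hs. destruct (hump_bounds L D s) as [A A']; lra. }
  assert (HhD : hump L D <= D).
  { unfold hump. apply Rdiv_le_intro; nra. }
  assert (HkD : k / D ^ 2 <= k / hump L D ^ 2).
  { pose proof (Hh D ltac:(lra)). unfold Rdiv. apply Rmult_le_compat_l; [lra|].
    apply Rinv_le_contravar; [apply pow_lt; lra|apply pow_incr; lra]. }
  set (G2 := fun t => (U t ^ 2 - hump L t) / 2 - - / (4 * sqrt (hump L t) ^ 3)).
  set (W2 := fun t => k * (6 * (1 - 2 * t / L) ^ 2 / hump L t ^ 4 + 4 / (L * hump L t ^ 3))).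
  set (G1 := fun t => U1 t - (1 - 2 * t / L) * / (2 * sqrt (hump L t))).
  set (W1 := fun t => - 2 * k * (1 - 2 * t / L) / hump L t ^ 3).
  assert (DG : forall s, D <= s <= L - D -> is_derive (fun t => U t - sqrt (hump L t)) s (G1 s)).
  { intros s Hs. specialize (Hh s Hs). apply is_derive_Rminus; [apply H1; lra|apply is_derive_sqrt_hump; lra]. }
  assert (DG1 : forall s, D <= s <= L - D -> is_derive G1 s (G2 s)).
  { intros s Hs. specialize (Hh s Hs). apply is_derive_Rminus; [apply H2; lra|apply is_derive2_sqrt_hump; lra]. }
  assert (DW : forall s, D <= s <= L - D -> is_derive (fun t => k / hump L t ^ 2) s (W1 s)).
  { intros s Hs. specialize (Hh s Hs). apply is_derive_inv_hump; lra. }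
  assert (DW1 : forall s, D <= s <= L - D -> is_derive W1 s (W2 s)).
  { intros s Hs. specialize (Hh s Hs). apply is_derive2_inv_hump; lra. }
  (* Since [g ^ 5 >= 32], the second derivative of the barrier is at most [7/32] of [k / g ^ 3]. The
     nonlinearity yields at least [1/2] and [(sqrt hump)''] costs at most [1/4], which leaves
     [1/32]. From below, [U >= 0] is what bounds [g + U] by [g]. *)
  assert (Key : forall s, D <= s <= L - D ->
    let g := sqrt (hump L s) in 2 <= g /\ g ^ 2 = hump L s /\
    k / hump L s ^ 2 * g = k / g ^ 3 /\ W2 s <= 7 / 32 * (k / g ^ 3)).
  { intros s Hs g. specialize (Hh s Hs).
    assert (Hg : 2 <= g) by (unfold g; rewrite <- (sqrt_pow2 2) by lra; apply sqrt_le_1_alt; lra).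
    assert (Hg2 : g ^ 2 = hump L s) by (apply pow2_sqrt; lra).
    split; [exact Hg|]. split; [exact Hg2|]. rewrite <- Hg2. split; [field; lra|].
    unfold W2. rewrite <- Hg2.
    assert (A : (1 - 2 * s / L) ^ 2 <= 1).
    { assert (0 <= s / L <= 1) by (split; [apply Rle_div_intro|apply Rdiv_le_intro]; lra).
      replace (2 * s / L) with (2 * (s / L)) by (unfold Rdiv; ring). nra. }
    assert (P8 : 0 < / g ^ 8) by (apply Rinv_0_lt_compat, pow_lt; lra).
    assert (Bq : / L <= / (4 * g ^ 2)).
    { apply Rinv_le_contravar; [nra|]. rewrite Hg2. lra. }
    assert (P6 : 0 < / g ^ 6) by (apply Rinv_0_lt_compat, pow_lt; lra).
    assert (X1 : 6 * (1 - 2 * s / L) ^ 2 / (g ^ 2) ^ 4 <= 6 * / g ^ 8).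
    { replace (6 * (1 - 2 * s / L) ^ 2 / (g ^ 2) ^ 4) with (6 * (1 - 2 * s / L) ^ 2 * / g ^ 8) by (field; lra).
      apply Rmult_le_compat_r; lra. }
    assert (X2 : 4 / (L * (g ^ 2) ^ 3) <= / g ^ 8).
    { replace (4 / (L * (g ^ 2) ^ 3)) with (/ L * (4 * / g ^ 6)) by (field; lra).
      replace (/ g ^ 8) with (/ (4 * g ^ 2) * (4 * / g ^ 6)) by (field; lra).
      apply Rmult_le_compat_r; lra. }
    apply Rle_trans with (k * (7 * / g ^ 8)); [apply Rmult_le_compat_l; lra|].
    replace (7 / 32 * (k / g ^ 3)) with (k * (7 * (g ^ 5 / 32 * / g ^ 8))) by (field; lra).
    assert (32 <= g ^ 5) by (replace 32 with (2 ^ 5) by ring; apply pow_incr; lra).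
    apply Rmult_le_compat_l; [lra|]. apply Rmult_le_compat_l; [lra|]. nra. }
  intros s Hs. apply Rabs_le_between in B1, B2. rewrite hump_sym in B2.
  apply Rabs_le. split.
  - assert (A : - (U s - sqrt (hump L s)) - k / hump L s ^ 2 <= 0); [|lra].
    apply (max_principle (fun t => - (U t - sqrt (hump L t)) - k / hump L t ^ 2)
      (fun t => - G1 t - W1 t) (fun t => - G2 t - W2 t) D (L - D)); auto; try lra.
    + intros x Hx. apply is_derive_Rminus; [apply is_derive_Ropp, DG, Hx|apply DW, Hx].
    + intros x Hx. apply is_derive_Rminus; [apply is_derive_Ropp, DG1, Hx|apply DW1, Hx].
    + rewrite hump_sym. lra.
    + intros x Hx Hp. destruct (Key x ltac:(lra)) as [Hg [Hg2 [E1 E2]]].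
      specialize (HU x ltac:(lra)). unfold G2. rewrite <- Hg2 at 1.
      set (g := sqrt (hump L x)) in *.
      assert (P3 : 0 < / g ^ 3) by (apply Rinv_0_lt_compat, pow_lt; lra).
      assert (E4 : / (4 * g ^ 3) = 1 / 4 * / g ^ 3) by (field; lra).
      assert (P : 0 < k / hump L x ^ 2) by (apply Rdiv_lt_0_compat; [lra|apply pow_lt; specialize (Hh x ltac:(lra)); lra]).
      set (b := k / hump L x ^ 2) in *.
      assert (b * g <= g ^ 2 - U x ^ 2) by nra.
      assert (/ g ^ 3 <= k / g ^ 3) by (unfold Rdiv; nra).
      lra.
  - assert (A : (U s - sqrt (hump L s)) - k / hump L s ^ 2 <= 0); [|lra].
    apply (max_principle (fun t => (U t - sqrt (hump L t)) - k / hump L t ^ 2)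
      (fun t => G1 t - W1 t) (fun t => G2 t - W2 t) D (L - D)); auto; try lra.
    + intros x Hx. apply is_derive_Rminus; [apply DG, Hx|apply DW, Hx].
    + intros x Hx. apply is_derive_Rminus; [apply DG1, Hx|apply DW1, Hx].
    + rewrite hump_sym. lra.
    + intros x Hx Hp. destruct (Key x ltac:(lra)) as [Hg [Hg2 [E1 E2]]].
      specialize (HU x ltac:(lra)). unfold G2. rewrite <- Hg2 at 1.
      set (g := sqrt (hump L x)) in *.
      assert (P3 : 0 < / g ^ 3) by (apply Rinv_0_lt_compat, pow_lt; lra).
      assert (E4 : / (4 * g ^ 3) = 1 / 4 * / g ^ 3) by (field; lra).
      assert (P : 0 < k / hump L x ^ 2) by (apply Rdiv_lt_0_compat; [lra|apply pow_lt; specialize (Hh x ltac:(lra)); lra]).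
      set (b := k / hump L x ^ 2) in *.
      assert (b * g <= U x ^ 2 - g ^ 2) by nra.
      assert (/ g ^ 3 <= k / g ^ 3) by (unfold Rdiv; nra).
      lra.
Qed.

Lemma scaled_theorem (y y1 z z1 : R -> R) (C : R) :
  layer_profile y y1 C -> layer_profile z z1 C ->
  layer_nondegenerate y -> layer_nondegenerate z ->
  exists K B D L0 : R, 0 < K /\ 0 < B /\ 1 < D /\ 1 <= L0 /\
    forall L, L0 <= L -> exists U U1 : R -> R,
      (forall s, 0 <= s <= L -> is_derive U s (U1 s)) /\
      (forall s, 0 <= s <= L -> is_derive U1 s ((U s ^ 2 - hump L s) / 2)) /\
      U 0 = 0 /\ U L = 0 /\
      (forall s, 0 <= s <= D -> Rabs (U s - y s) <= K / L * s) /\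
      (forall s, D <= s <= L / 2 -> Rabs (U s - y s) <= K / L * (s * sqrt s)) /\
      (forall s, 0 <= s <= D -> Rabs (U (L - s) - z s) <= K / L * s) /\
      (forall s, D <= s <= L / 2 -> Rabs (U (L - s) - z s) <= K / L * (s * sqrt s)) /\
      (forall s, D <= s <= L - D -> Rabs (U s - sqrt (hump L s)) <= K / hump L s ^ 2) /\
      dirichlet_estimate L B U.
Proof.
  intros HY HZ NY NZ.
  destruct (scaled_solution y y1 z z1 C HY HZ NY NZ) as [K [B [s0 [L0 [HK [HB [Hs0 [HL0 HS]]]]]]]].
  (* The summand [8] gives [hump >= 4] on the interior, and [s0] gives [U >= 0] there. *)
  set (D := 8 + s0).
  destruct (layer_approximation y y1 z z1 C K D HY HZ HK) as [Ky [HKy Ay]]; [unfold D; lra|].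
  destruct (layer_approximation z z1 y y1 C K D HZ HY HK) as [Kz [HKz Az]]; [unfold D; lra|].
  pose proof (proj1 HY) as HC.
  set (k := 1 + (Ky * D + Kz * D + 2 * D + C) * D ^ 2).
  assert (HD : 9 <= D) by (unfold D; lra).
  assert (Hk0 : 0 < (Ky * D + Kz * D + 2 * D + C) * D ^ 2).
  { apply Rmult_lt_0_compat; [nra|apply pow_lt; lra]. }
  exists (Ky + Kz + k), B, D, (L0 + 2 * D).
  assert (Hk : 1 < k) by (unfold k; lra).
  conjs; try lra.
  intros L HL. destruct (HS L ltac:(lra)) as [U [U1 [F1 [F2 [F0 [FL [Fw [Fp FE]]]]]]]].
  exists U, U1.
  destruct (Ay L U U1) as [P1 P2]; auto; try lra.
  destruct (Az L (fun s => U (L - s)) (fun s => - U1 (L - s))) as [P3 P4]; auto; try lra.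
  { intros s Hs. apply is_derive_reflect, F1; lra. }
  { intros s Hs. eapply is_derive_eq; [apply is_derive_Ropp, is_derive_reflect, F2; lra|].
    rewrite hump_sym. ring. }
  { rewrite Rminus_0_r. exact FL. }
  { intros s Hs. rewrite <- composite_sym. apply Fw; lra. }
  assert (iL : 0 < / L) by (apply Rinv_0_lt_compat; lra).
  assert (iL1 : / L <= 1) by (rewrite <- Rinv_1; apply Rinv_le_contravar; lra).
  assert (M1 : Ky / L <= (Ky + Kz + k) / L) by (unfold Rdiv; apply Rmult_le_compat_r; lra).
  assert (M2 : Kz / L <= (Ky + Kz + k) / L) by (unfold Rdiv; apply Rmult_le_compat_r; lra).
  assert (HhD : hump L D <= D) by (unfold hump; apply Rdiv_le_intro; nra).
  assert (Hsq : forall x, 0 <= x <= D -> sqrt x <= D).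
  { intros x Hx. apply Rle_trans with (sqrt (D * D)); [apply sqrt_le_1_alt; nra|rewrite sqrt_square; lra]. }
  (* At distance [D] from an end a crude constant bound suffices, since [k] was taken large enough
     to absorb it. *)
  assert (Bdry : forall (v w w1 : R -> R) Kw, layer_profile w w1 C ->
     Kw <= Ky + Kz -> 0 < Kw -> Rabs (v D - w D) <= Kw / L * D ->
     Rabs (v D - sqrt (hump L D)) <= k / D ^ 2).
  { intros v w w1 Kw HW HKw HKw0 Hv.
    pose proof (layer_profile_growth w w1 C D HW ltac:(lra)) as G.
    pose proof (Hsq D ltac:(lra)) as S1.
    assert (0 <= hump L D) by (unfold hump; apply Rle_div_intro; nra).
    pose proof (Hsq (hump L D) ltac:(lra)) as S2. pose proof (sqrt_pos (hump L D)) as S3.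
    apply (proj1 (Rle_div_r _ _ _ (pow_lt D 2 ltac:(lra)))).
    apply Rle_trans with ((Ky * D + Kz * D + 2 * D + C) * D ^ 2); [|unfold k; lra].
    apply Rmult_le_compat_r; [apply pow2_ge_0|].
    replace (v D - sqrt (hump L D)) with ((v D - w D) + w D + - sqrt (hump L D)) by ring.
    eapply Rle_trans; [apply Rabs_triang|]. rewrite Rabs_Ropp, (Rabs_right (sqrt _)) by lra.
    pose proof (Rabs_triang (v D - w D) (w D)).
    assert (Kw / L * D <= (Ky + Kz) * D).
    { apply Rmult_le_compat_r; [lra|]. unfold Rdiv. nra. }
    lra. }
  conjs; auto.
  - intros s Hs. eapply Rle_trans; [apply P1, Hs|]. apply Rmult_le_compat_r; lra.
  - intros s Hs. eapply Rle_trans; [apply P2, Hs|]. apply Rmult_le_compat_r; [|lra].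
    pose proof (sqrt_pos s). nra.
  - intros s Hs. eapply Rle_trans; [apply P3, Hs|]. apply Rmult_le_compat_r; lra.
  - intros s Hs. eapply Rle_trans; [apply P4, Hs|]. apply Rmult_le_compat_r; [|lra].
    pose proof (sqrt_pos s). nra.
  - intros s Hs. apply Rle_trans with (k / hump L s ^ 2).
    + apply (interior_approximation L D k U U1); auto; try lra.
      * intros t Ht. apply Fp. unfold D in Ht. lra.
      * apply (Bdry U y y1 Ky HY); try lra. apply P1; lra.
      * rewrite hump_sym. apply (Bdry (fun t => U (L - t)) z z1 Kz HZ); try lra. apply P3; lra.
    + destruct (hump_bounds L D s) as [A _]; try lra.
      unfold Rdiv. apply Rmult_le_compat_r; [|lra]. left. apply Rinv_0_lt_compat, pow_lt. lra.
Qed.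

(** * The essential supremum norm *)

(** The length of the part of [(a, b)] that lies in [(p, x)]. *)
Definition overlap (a b p x : R) : R := Rmax 0 (Rmin b x - Rmax a p).

Lemma overlap_mono (a b p x x' : R) : x <= x' -> overlap a b p x <= overlap a b p x'.
Proof. intros H. unfold overlap, Rmax, Rmin. repeat destruct Rle_dec; lra. Qed.

Lemma overlap_gain (a b p x x' : R) :
  p <= x -> a < x -> x <= x' -> x' < b -> overlap a b p x + (x' - x) <= overlap a b p x'.
Proof. intros. unfold overlap, Rmax, Rmin. repeat destruct Rle_dec; lra. Qed.

Lemma overlap_le (a b p x : R) : a <= b -> 0 <= overlap a b p x <= b - a.
Proof. intros. unfold overlap, Rmax, Rmin. repeat destruct Rle_dec; lra. Qed.

Lemma sum_n_le_sum_n (u v : nat -> R) (n : nat) :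
  (forall k, u k <= v k) -> sum_n u n <= sum_n v n.
Proof.
  intros H. induction n as [|n IH]; [rewrite !sum_O; apply H|].
  rewrite !sum_Sn. apply Rplus_le_compat; [exact IH|apply H].
Qed.

Lemma sum_n_ge0_mono (u : nat -> R) (n m : nat) :
  (forall k, 0 <= u k) -> (n <= m)%nat -> sum_n u n <= sum_n u m.
Proof.
  intros H Hnm. induction Hnm as [|m Hnm IH]; [lra|].
  rewrite sum_Sn. specialize (H (S m)). change (sum_n u n <= sum_n u m + u (S m)). lra.
Qed.

Lemma sum_n_gain (u v : nat -> R) (d : R) (k n : nat) :
  (forall j, u j <= v j) -> u k + d <= v k -> (k <= n)%nat -> sum_n u n + d <= sum_n v n.
Proof.
  intros H Hk Hkn. induction Hkn as [|n Hkn IH].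
  - destruct k as [|k]; [rewrite !sum_O; exact Hk|].
    rewrite !sum_Sn. pose proof (sum_n_le_sum_n u v k H).
    change (sum_n u k + u (S k) + d <= sum_n v k + v (S k)). lra.
  - rewrite !sum_Sn. specialize (H (S n)).
    change (sum_n u n + u (S n) + d <= sum_n v n + v (S n)). lra.
Qed.

(** Compactness by a supremum: [c] is the supremum of the [x] for which finitely many intervals
    account for the length [x - p]. An interval of the cover around [c] carries this property beyond
    [c], unless [q] is reached. *)
Lemma interval_cover_length (a b : nat -> R) (l p q : R) :
  p < q -> (forall n, a n <= b n) ->
  (forall x, p <= x <= q -> exists n, a n < x < b n) ->
  is_series (fun n => b n - a n) l -> q - p <= l.
Proof.
  intros Hpq Hab Hcov Hser.
  set (E := fun x => p <= x <= q /\ exists n, x - p <= sum_n (fun k => overlap (a k) (b k) p x) n).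
  assert (Ep : E p).
  { split; [lra|]. exists 0%nat. rewrite sum_O.
    pose proof (overlap_le (a 0%nat) (b 0%nat) p p (Hab 0%nat)). lra. }
  destruct (completeness E) as [c [Hub Hlub]].
  { exists q. intros x [Hx _]. lra. }
  { exists p. exact Ep. }
  assert (Hpc : p <= c) by (apply Hub, Ep).
  assert (Hcq : c <= q) by (apply Hlub; intros x [Hx _]; lra).
  destruct (Hcov c ltac:(lra)) as [k Hk].
  assert (Hx : exists x, E x /\ a k < x <= c).
  { apply NNPP; intros Hn. assert (c <= a k); [|lra]. apply Hlub. intros x Hx.
    apply Rnot_lt_le. intros Hlt. apply Hn. exists x. split; [exact Hx|].
    split; [exact Hlt|apply Hub, Hx]. }
  destruct Hx as [x [[Hx [n Hn]] Hxk]].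
  assert (Ext : forall x', x <= x' -> x' <= q -> x' < b k -> E x').
  { intros x' Hxx' Hx'q Hx'b. split; [lra|]. exists (Nat.max n k).
    pose proof (sum_n_gain (fun j => overlap (a j) (b j) p x) (fun j => overlap (a j) (b j) p x')
      (x' - x) k (Nat.max n k)) as A.
    assert (B : sum_n (fun j => overlap (a j) (b j) p x) n
             <= sum_n (fun j => overlap (a j) (b j) p x) (Nat.max n k)).
    { apply sum_n_ge0_mono; [|lia]. intros j. apply (proj1 (overlap_le _ _ _ _ (Hab j))). }
    cbv beta in A. eapply Rle_trans; [|apply A; [| |lia]].
    - lra.
    - intros j. apply overlap_mono, Hxx'.
    - apply overlap_gain; lra. }
  assert (Eq : E q).
  { destruct (Rlt_le_dec q (b k)) as [H|H]; [apply Ext; lra|].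
    assert (E ((c + b k) / 2)) by (apply Ext; lra).
    specialize (Hub _ H0). lra. }
  destruct Eq as [_ [m Hm]].
  eapply Rle_trans; [exact Hm|].
  apply Rle_trans with (sum_n (fun n => b n - a n) m).
  - apply sum_n_le_sum_n. intros j. apply (proj2 (overlap_le _ _ _ _ (Hab j))).
  - apply (is_lim_seq_incr_compare (sum_n (fun n => b n - a n)) l); [exact Hser|].
    intros j. rewrite sum_Sn. specialize (Hab (S j)).
    change (sum_n (fun n => b n - a n) j <= sum_n (fun n => b n - a n) j + (b (S j) - a (S j))). lra.
Qed.

Lemma segment_not_null (N : R -> Prop) (p q : R) :
  p < q -> null_set N -> exists x, p <= x <= q /\ ~ N x.
Proof.
  intros Hpq HN. apply NNPP; intros Hno.
  destruct (HN ((q - p) / 2)) as [a [b [l [Hab [Hcov [Hser Hl]]]]]]; [lra|].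
  assert (q - p <= l); [|lra].
  apply (interval_cover_length a b l p q Hpq Hab); [|exact Hser].
  intros x Hx. apply Hcov. apply NNPP; intros Hnx. apply Hno. exists x; split; assumption.
Qed.

Lemma empty_null_set (N : R -> Prop) : (forall x, ~ N x) -> null_set N.
Proof.
  intros HN eps Heps. exists (fun _ => 0), (fun _ => 0), 0. conjs; [intros; lra| | |lra].
  - intros x Hx. destruct (HN x Hx).
  - apply (is_lim_seq_ext (fun _ => 0) _ 0); [|apply is_lim_seq_const].
    intros n. rewrite (sum_n_ext _ (fun _ => 0)) by (intros; apply Rminus_diag).
    rewrite sum_n_const. ring.
Qed.

(** By continuity a value above [M'] persists on a segment, which is not null, so the essential
    supremum bounds every value. Its finiteness reduces [Rbar_mult] to a product of reals. *)
Lemma Linf_norm_continuous (a b : R) (f : R -> R) :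
  a < b -> continuous_on (segment a b) f ->
  exists m, Linf_norm a b f = Finite m /\ forall x, a < x < b -> Rabs (f x) <= m.
Proof.
  intros Hab Hf.
  set (F := fun t => f (clamp a b t)).
  assert (CF : forall x, continuous F x) by (apply continuous_clamp_comp; [lra|exact Hf]).
  set (E := fun M => null_set (fun x => a < x < b /\ M < Rabs (f x))).
  destruct (bounded_on_segment F a b) as [M [HM0 HM]]; [lra|intros; apply CF|].
  assert (EM : E M).
  { apply empty_null_set. intros x [Hx Hlt]. specialize (HM x ltac:(lra)). unfold F in HM.
    rewrite clamp_id in HM by lra. lra. }
  assert (Low : forall x, a < x < b -> forall M', E M' -> Rabs (f x) <= M').
  { intros x Hx M' HM'. apply Rnot_lt_le. intros Hlt.
    destruct (proj1 (continuous_eps F x) (CF x) (Rabs (f x) - M')) as [d [Hd H]]; [lra|].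
    set (r := Rmin (d / 2) ((b - x) / 2)).
    assert (Hr : 0 < r /\ r < d /\ x + r < b) by (unfold r, Rmin; destruct Rle_dec; lra).
    destruct (segment_not_null _ x (x + r) ltac:(lra) HM') as [t [Ht Hnt]].
    apply Hnt. split; [lra|].
    assert (A : Rabs (F t - F x) < Rabs (f x) - M') by (apply H; rewrite Rabs_right; lra).
    unfold F in A. rewrite !clamp_id in A by lra.
    assert (Rabs (f x) <= Rabs (f t) + Rabs (f t - f x)).
    { unfold Rabs; repeat destruct Rcase_abs; lra. }
    lra. }
  destruct (Glb_Rbar_correct E) as [Hlb Hglb].
  change (Linf_norm a b f) with (Glb_Rbar E).
  assert (Hx : forall x, a < x < b -> Rbar_le (Rabs (f x)) (Glb_Rbar E)).
  { intros x Hx. apply Hglb. intros M' HM'. exact (Low x Hx M' HM'). }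
  specialize (Hlb M EM). destruct (Glb_Rbar E) as [m| |].
  - exists m. split; [reflexivity|]. intros x Hab'. exact (Hx x Hab').
  - destruct Hlb.
  - destruct (Hx ((a + b) / 2)). lra.
Qed.

Lemma Linf_norm_le (a b : R) (f : R -> R) (M : R) :
  (forall x, a < x < b -> Rabs (f x) <= M) -> Rbar_le (Linf_norm a b f) M.
Proof.
  intros H. apply (proj1 (Glb_Rbar_correct _)).
  apply empty_null_set. intros x [Hx Hlt]. specialize (H x Hx). lra.
Qed.

Lemma Rabs_le_endpoints (F : R -> R) (a b M : R) :
  a < b -> (forall x, continuous F x) -> (forall x, a < x < b -> Rabs (F x) <= M) ->
  forall x, a <= x <= b -> Rabs (F x) <= M.
Proof.
  intros Hab CF H x Hx. apply Rnot_lt_le. intros Hlt.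
  destruct (proj1 (continuous_eps F x) (CF x) (Rabs (F x) - M)) as [d [Hd Hc]]; [lra|].
  set (r := Rmin (d / 2) ((b - a) / 4)).
  assert (Hr : 0 < r /\ r < d /\ r < (b - a) / 2) by (unfold r, Rmin; destruct Rle_dec; lra).
  assert (Ht : exists t, a < t < b /\ Rabs (t - x) < d).
  { destruct (Rle_lt_dec x ((a + b) / 2)).
    - exists (x + r). split; [lra|]. rewrite Rabs_right; lra.
    - exists (x - r). split; [lra|]. rewrite Rabs_left; lra. }
  destruct Ht as [t [Ht Htd]]. specialize (Hc t Htd). specialize (H t Ht).
  assert (Rabs (F x) <= Rabs (F t) + Rabs (F t - F x)).
  { unfold Rabs; repeat destruct Rcase_abs; lra. }
  lra.
Qed.

(** * Change of scale and powers of A *)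

Lemma is_derive_twice (f f1 : R -> R) (a b x l : R) :
  (forall t, a < t < b -> is_derive f t (f1 t)) -> a < x < b -> is_derive f1 x l ->
  twice_derivable f x /\ Derive_n f 2 x = l.
Proof.
  intros H Hx Hl.
  assert (D : is_derive (Derive f) x l).
  { apply (is_derive_ext_loc f1); [|exact Hl].
    assert (Hr : 0 < Rmin (x - a) (b - x)) by (apply Rmin_glb_lt; lra).
    exists (mkposreal _ Hr). intros t Ht. symmetry. apply is_derive_unique, H.
    change (Rabs (t - x) < Rmin (x - a) (b - x)) in Ht.
    pose proof (Rmin_l (x - a) (b - x)). pose proof (Rmin_r (x - a) (b - x)).
    apply Rabs_lt_between in Ht. lra. }
  split; [split|].
  - exists (f1 x). apply H, Hx.
  - exists l. exact D.
  - exact (is_derive_unique _ _ _ D).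
Qed.

Lemma is_derive_affine (f : R -> R) (k c x l : R) :
  is_derive f (k * x + c) l -> is_derive (fun t => f (k * t + c)) x (k * l).
Proof.
  intros Hf. apply (is_derive_comp f (fun t => k * t + c)); [exact Hf|].
  derive_by ring.
Qed.

(** With [x = s / K - 1] the potential becomes [U] and the source [f / K ^ 2], whence the gain
    [K ^ (-2)]. Extending [phi] by [C2_extension] supplies the two-sided derivatives at the end
    points. *)
Lemma dirichlet_estimate_unscaled (U u : R -> R) (K B : R) :
  0 < K -> 0 < B -> dirichlet_estimate (2 * K) B U ->
  continuous_on (segment (-1) 1) u ->
  (forall x, -1 <= x <= 1 -> u x = K ^ 2 * U (K * x + K)) ->
  forall phi f : R -> R,
    C2_segment (-1) 1 phi -> continuous_on (segment (-1) 1) f ->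
    (forall x, -1 < x < 1 -> - Derive_n phi 2 x + u x * phi x = f x) ->
    phi (-1) = 0 -> phi 1 = 0 ->
    forall M, (forall x, -1 < x < 1 -> Rabs (f x) <= M) ->
    forall x, -1 < x < 1 -> Rabs (phi x) <= B / K ^ 2 * M.
Proof.
  intros HK HB HE Cu Eu phi f [Cphi [Tphi _]] Cf Hode Pm Pp M HM x Hx.
  set (cl := clamp (-1) 1).
  assert (Cu' := continuous_clamp_comp u (-1) 1 ltac:(lra) Cu).
  assert (Cphi' := continuous_clamp_comp phi (-1) 1 ltac:(lra) Cphi).
  assert (Cf' := continuous_clamp_comp f (-1) 1 ltac:(lra) Cf).
  set (G := fun t => u (cl t) * phi (cl t) + - 1 * f (cl t)).
  assert (CG : forall t, continuous G t).
  { intros t. apply continuous_Rplus; [apply continuous_Rmult|apply continuous_Rmult]; auto using continuous_Rconst. }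
  destruct (C2_extension (fun t => -1 < t < 1) phi G 0) as [g [g1 [Hg [Hg1 Eg]]]]; auto; try lra.
  { intros p q t Hp Hq Ht. lra. }
  { intros t Ht. split; [apply Tphi, Ht|]. unfold G, cl. rewrite !clamp_id by lra.
    specialize (Hode t Ht). lra. }
  assert (Cg : forall t, continuous g t) by (intros t; exact (is_derive_continuous g t _ (Hg t))).
  assert (Em : g (-1) = 0).
  { rewrite <- Pm. apply (eq_at_limit_point (segment (-1) 1)); auto.
    - apply Cphi. unfold segment; lra.
    - intros d Hd. set (r := Rmin (d / 2) 1).
      assert (Hr : 0 < r <= 1 /\ r < d) by (unfold r, Rmin; destruct Rle_dec; lra).
      exists (-1 + r). split; [rewrite Rabs_right; lra|].
      split; [unfold segment; lra|apply Eg; lra]. }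
  assert (Ep : g 1 = 0).
  { rewrite <- Pp. apply (eq_at_limit_point (segment (-1) 1)); auto.
    - apply Cphi. unfold segment; lra.
    - intros d Hd. set (r := Rmin (d / 2) 1).
      assert (Hr : 0 < r <= 1 /\ r < d) by (unfold r, Rmin; destruct Rle_dec; lra).
      exists (1 - r). split; [rewrite Rabs_left; lra|].
      split; [unfold segment; lra|apply Eg; lra]. }
  assert (Ephi : forall t, -1 <= t <= 1 -> g t = phi t).
  { intros t Ht. destruct (Req_dec t (-1)) as [->|]; [lra|].
    destruct (Req_dec t 1) as [->|]; [lra|]. apply Eg; lra. }
  assert (HM' := Rabs_le_endpoints (fun t => f (cl t)) (-1) 1 M ltac:(lra) Cf').
  assert (HM2 : forall t, -1 <= t <= 1 -> Rabs (f t) <= M).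
  { intros t Ht. rewrite <- (clamp_id (-1) 1 t Ht). apply HM'; [|exact Ht].
    intros r Hr. unfold cl. rewrite clamp_id by lra. apply HM, Hr. }
  assert (K2 : 0 < K ^ 2) by (apply pow_lt, HK).
  assert (Hin : forall s, 0 <= s <= 2 * K -> -1 <= / K * s + - 1 <= 1).
  { intros s Hs. assert (0 <= / K * s <= 2); [|lra].
    rewrite Rmult_comm. change (s * / K) with (s / K).
    split; [apply Rle_div_intro|apply Rdiv_le_intro]; lra. }
  assert (A : Rabs (g (/ K * (K * x + K) + - 1)) <= B * (M / K ^ 2)).
  { apply (HE (fun s => g (/ K * s + - 1)) (fun s => / K * g1 (/ K * s + - 1))
      (fun s => f (/ K * s + - 1) / K ^ 2)).
    - intros s Hs. apply is_derive_affine, Hg.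
    - intros s Hs. specialize (Hin s Hs).
      apply (is_derive_eq _ _ (/ K * (/ K * G (/ K * s + - 1)))).
      + apply is_derive_scal, is_derive_affine, Hg1.
      + unfold G, cl. rewrite !clamp_id by exact Hin. rewrite (Eu _ Hin), (Ephi _ Hin).
        replace (K * (/ K * s + - 1) + K) with s by (field; lra). field. lra.
    - replace (/ K * 0 + - 1) with (-1) by ring. exact Em.
    - replace (/ K * (2 * K) + - 1) with 1 by (field; lra). exact Ep.
    - intros s Hs. specialize (Hin s Hs). specialize (HM2 _ Hin).
      unfold Rdiv. rewrite Rabs_mult, (Rabs_right (/ K ^ 2)) by (left; apply Rinv_0_lt_compat, K2).
      apply Rmult_le_compat_r; [left; apply Rinv_0_lt_compat, K2|exact HM2].
    - nra. }
  replace (/ K * (K * x + K) + - 1) with x in A by (field; lra).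
  rewrite Ephi in A by lra. eapply Rle_trans; [exact A|]. right. field. lra.
Qed.

Lemma Rpower_three_halves (t : R) : 0 < t -> Rpower t (3 / 2) = t * sqrt t.
Proof.
  intros Ht. replace (3 / 2) with (1 + / 2) by field.
  rewrite Rpower_plus, Rpower_1, Rpower_sqrt by exact Ht. reflexivity.
Qed.

(** Because [2^(2/5)] lies between [1] and [2], [K ^ 2] and [A^(2/5)] agree up to a factor two;
    [K ^ 2 * sqrt K] is [sqrt (2 * A)]. *)
Lemma fifth_root_scales (A : R) : 0 < A ->
  let K := Rpower (2 * A) (1 / 5) in
  0 < K /\ K ^ 5 = 2 * A /\ Rpower (2 * A) (2 / 5) = K ^ 2 /\ Rpower (2 * A) (- (1 / 5)) = / K /\
  K ^ 2 <= 2 * Rpower A (2 / 5) /\ / K ^ 2 <= Rpower A (- (2 / 5)) /\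
  K ^ 2 * sqrt K <= 2 * Rpower A (1 / 2).
Proof.
  intros HA K.
  assert (HK : 0 < K) by apply exp_pos.
  assert (Pow : forall n, K ^ n = Rpower (2 * A) (1 / 5 * INR n)).
  { intros n. rewrite <- Rpower_pow by exact HK. unfold K. apply Rpower_mult. }
  assert (K5 : K ^ 5 = 2 * A).
  { rewrite Pow. replace (1 / 5 * INR 5) with 1 by (simpl; field). apply Rpower_1. lra. }
  assert (K2 : Rpower (2 * A) (2 / 5) = K ^ 2).
  { rewrite Pow. f_equal. simpl. field. }
  split; [exact HK|]. split; [exact K5|]. split; [exact K2|]. split.
  { rewrite Rpower_Ropp. reflexivity. }
  assert (Hmul : K ^ 2 = Rpower 2 (2 / 5) * Rpower A (2 / 5)).
  { rewrite <- K2. symmetry. apply Rpower_mult_distr; lra. }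
  assert (H2 : 1 <= Rpower 2 (2 / 5) <= 2).
  { split.
    - apply Rle_trans with (Rpower 2 0); [rewrite Rpower_O; lra|apply Rle_Rpower; lra].
    - apply Rle_trans with (Rpower 2 1); [apply Rle_Rpower; lra|rewrite Rpower_1; lra]. }
  assert (HP : 0 < Rpower A (2 / 5)) by apply exp_pos.
  split; [rewrite Hmul; apply Rmult_le_compat_r; lra|]. split.
  { rewrite Rpower_Ropp. apply Rinv_le_contravar; [exact HP|]. rewrite Hmul. nra. }
  replace (1 / 2) with (/ 2) by field. rewrite Rpower_sqrt by exact HA.
  pose proof (sqrt_pos K). pose proof (sqrt_pos A).
  apply Rsqr_incr_0_var; [|lra]. unfold Rsqr.
  replace (K ^ 2 * sqrt K * (K ^ 2 * sqrt K)) with (K ^ 4 * (sqrt K * sqrt K)) by ring.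
  replace (2 * sqrt A * (2 * sqrt A)) with (4 * (sqrt A * sqrt A)) by ring.
  rewrite !sqrt_sqrt by lra. replace (K ^ 4 * K) with (K ^ 5) by ring. lra.
Qed.

(** * Back to the original variables *)

Lemma unscaled_bvp (U U1 : R -> R) (A K : R) :
  0 < K -> K ^ 5 = 2 * A ->
  (forall s, 0 <= s <= 2 * K -> is_derive U s (U1 s)) ->
  (forall s, 0 <= s <= 2 * K -> is_derive U1 s ((U s ^ 2 - hump (2 * K) s) / 2)) ->
  U 0 = 0 -> U (2 * K) = 0 ->
  bvp_solution A (fun x => K ^ 2 * U (K * x + K)).
Proof.
  intros HK HA H1 H2 H0 HL.
  assert (Hin : forall x, -1 <= x <= 1 -> 0 <= K * x + K <= 2 * K) by (intros x Hx; split; nra).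
  set (u1 := fun x => K ^ 2 * (K * U1 (K * x + K))).
  assert (D1 : forall x, -1 <= x <= 1 -> is_derive (fun x => K ^ 2 * U (K * x + K)) x (u1 x)).
  { intros x Hx. apply is_derive_scal, is_derive_affine, H1, Hin, Hx. }
  split; [|split; [|split]].
  - apply (continuous_on_of_continuous (segment (-1) 1)). intros x Hx.
    exact (is_derive_continuous _ x _ (D1 x Hx)).
  - intros x Hx.
    destruct (is_derive_twice (fun x => K ^ 2 * U (K * x + K)) u1 (-1) 1 x
      (K ^ 2 * (K * (K * ((U (K * x + K) ^ 2 - hump (2 * K) (K * x + K)) / 2))))) as [T E].
    + intros t Ht. apply D1; lra.
    + exact Hx.
    + apply is_derive_scal, is_derive_scal, is_derive_affine, H2, Hin; lra.
    + split; [exact T|]. rewrite E. unfold hump.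
      replace A with (K ^ 5 / 2) by lra. field. lra.
  - replace (K * -1 + K) with 0 by ring. rewrite H0. ring.
  - replace (K * 1 + K) with (2 * K) by ring. rewrite HL. ring.
Qed.

Lemma unscaled_layer (U y : R -> R) (K Kc D t : R) :
  0 < K -> 1 <= D -> 0 < Kc ->
  (forall s, 0 <= s <= D -> Rabs (U s - y s) <= Kc / (2 * K) * s) ->
  (forall s, D <= s <= 2 * K / 2 -> Rabs (U s - y s) <= Kc / (2 * K) * (s * sqrt s)) ->
  (0 <= t <= / K * D -> Rabs (K ^ 2 * U (K * t) - K ^ 2 * y (K * t)) <= Kc * K ^ 2 * t) /\
  (/ K * D <= t <= 1 / 2 ->
     Rabs (K ^ 2 * U (K * t) - K ^ 2 * y (K * t)) <= Kc * (K ^ 2 * sqrt K) * (t * sqrt t)).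
Proof.
  intros HK HD HKc H1 H2.
  assert (K2 : 0 < K ^ 2) by (apply pow_lt, HK).
  assert (HKD : K * (/ K * D) = D) by (field; lra).
  assert (E : Rabs (K ^ 2 * U (K * t) - K ^ 2 * y (K * t)) = K ^ 2 * Rabs (U (K * t) - y (K * t))).
  { rewrite <- Rmult_minus_distr_l, Rabs_mult, (Rabs_right (K ^ 2)); lra. }
  rewrite E. split; intros Ht.
  - specialize (H1 (K * t) ltac:(split; nra)).
    apply Rle_trans with (K ^ 2 * (Kc / (2 * K) * (K * t))); [apply Rmult_le_compat_l; lra|].
    replace (K ^ 2 * (Kc / (2 * K) * (K * t))) with (Kc * K ^ 2 * t / 2) by (field; lra).
    assert (0 <= Kc * K ^ 2 * t) by (apply Rmult_le_pos; nra). lra.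
  - assert (Ht0 : 0 < t).
    { assert (0 < / K * D); [|lra]. apply Rmult_lt_0_compat; [apply Rinv_0_lt_compat, HK|lra]. }
    specialize (H2 (K * t) ltac:(split; nra)).
    rewrite sqrt_mult in H2 by lra.
    apply Rle_trans with (K ^ 2 * (Kc / (2 * K) * (K * t * (sqrt K * sqrt t)))); [apply Rmult_le_compat_l; lra|].
    replace (K ^ 2 * (Kc / (2 * K) * (K * t * (sqrt K * sqrt t))))
      with (Kc * (K ^ 2 * sqrt K) * (t * sqrt t) / 2) by (field; lra).
    pose proof (sqrt_pos K). pose proof (sqrt_pos t).
    assert (0 <= Kc * (K ^ 2 * sqrt K) * (t * sqrt t)) by (repeat apply Rmult_le_pos; lra). lra.
Qed.

(** The rescaled [hump] is [K * (1 - x^2) / 2], so the amplitude [K ^ 2] cancels against the square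
    in the barrier and the bound no longer contains [A]. *)
Lemma unscaled_interior (U : R -> R) (A K Kc D x : R) :
  0 < K -> K ^ 5 = 2 * A -> 0 < D ->
  (forall s, D <= s <= 2 * K - D ->
     Rabs (U s - sqrt (hump (2 * K) s)) <= Kc / hump (2 * K) s ^ 2) ->
  -1 + / K * D <= x <= 1 - / K * D ->
  Rabs (K ^ 2 * U (K * x + K) - sqrt (A * (1 - x ^ 2))) <= 4 * Kc * / (1 - x ^ 2) ^ 2.
Proof.
  intros HK HA HD H Hx.
  assert (K2 : 0 < K ^ 2) by (apply pow_lt, HK).
  assert (HKD : K * (/ K * D) = D) by (field; lra).
  assert (Hd : 0 < / K * D) by (apply Rmult_lt_0_compat; [apply Rinv_0_lt_compat, HK|lra]).
  assert (Hx2 : 0 < 1 - x ^ 2) by nra.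
  specialize (H (K * x + K) ltac:(split; nra)).
  assert (Eh : hump (2 * K) (K * x + K) = K * (1 - x ^ 2) / 2) by (unfold hump; field; lra).
  rewrite Eh in H.
  assert (Es : sqrt (A * (1 - x ^ 2)) = K ^ 2 * sqrt (K * (1 - x ^ 2) / 2)).
  { rewrite <- (sqrt_pow2 (K ^ 2)) at 1 by lra. rewrite <- sqrt_mult by nra.
    f_equal. replace A with (K ^ 5 / 2) by lra. field. }
  rewrite Es, <- Rmult_minus_distr_l, Rabs_mult, (Rabs_right (K ^ 2)) by lra.
  apply Rle_trans with (K ^ 2 * (Kc / (K * (1 - x ^ 2) / 2) ^ 2)); [apply Rmult_le_compat_l; lra|].
  right. field. split; lra.
Qed.

Theorem theorem1p1 (Y Z : R -> R)
    (hY : is_Yplus Y \/ is_Yminus Y) (hZ : is_Yplus Z \/ is_Yminus Z) :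
  exists (u : R -> R -> R) (delta D C A0 : R),
    0 < delta < 1 /\ 1 < D /\ 0 < C /\ 0 < A0 /\
    (forall A : R, A0 <= A ->
       bvp_solution A (u A) /\
       (forall x : R, -1 <= x <= 1 ->
          (0 <= x + 1 <= Rpower (2 * A) (- (1 / 5)) * D ->
           Rabs (u A x - Rpower (2 * A) (2 / 5) * Y (Rpower (2 * A) (1 / 5) * (x + 1)))
             <= C * Rpower A (2 / 5) * (x + 1)) /\
          (Rpower (2 * A) (- (1 / 5)) * D <= x + 1 <= delta ->
           Rabs (u A x - Rpower (2 * A) (2 / 5) * Y (Rpower (2 * A) (1 / 5) * (x + 1)))
             <= C * Rpower A (1 / 2) * Rpower (x + 1) (3 / 2)) /\
          (0 <= 1 - x <= Rpower (2 * A) (- (1 / 5)) * D ->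
           Rabs (u A x - Rpower (2 * A) (2 / 5) * Z (Rpower (2 * A) (1 / 5) * (1 - x)))
             <= C * Rpower A (2 / 5) * (1 - x)) /\
          (Rpower (2 * A) (- (1 / 5)) * D <= 1 - x <= delta ->
           Rabs (u A x - Rpower (2 * A) (2 / 5) * Z (Rpower (2 * A) (1 / 5) * (1 - x)))
             <= C * Rpower A (1 / 2) * Rpower (1 - x) (3 / 2)) /\
          (-1 + Rpower (2 * A) (- (1 / 5)) * D <= x
             <= 1 - Rpower (2 * A) (- (1 / 5)) * D ->
           Rabs (u A x - sqrt (A * (1 - x ^ 2))) <= C * / (1 - x ^ 2) ^ 2))) /\
    exists A1 C1 : R,
      0 < A1 /\ A0 <= A1 /\ 0 < C1 /\
      forall (A : R) (phi f : R -> R),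
        A1 < A ->
        C2_segment (-1) 1 phi ->
        continuous_on (segment (-1) 1) f ->
        (forall x : R, -1 < x < 1 -> - Derive_n phi 2 x + u A x * phi x = f x) ->
        phi (-1) = 0 -> phi 1 = 0 ->
        Rbar_le (Linf_norm (-1) 1 phi)
                (Rbar_mult (C1 * Rpower A (- (2 / 5))) (Linf_norm (-1) 1 f)).
Proof.
  destruct (layer_data Y hY) as [y [y1 [Cy [Py [Ny Ey]]]]].
  destruct (layer_data Z hZ) as [z [z1 [Cz [Pz [Nz Ez]]]]].
  set (C := Rmax Cy Cz).
  destruct (scaled_theorem y y1 z z1 C) as [Kc [B [D [L0 [HKc [HB [HD [HL0 HS]]]]]]]]; auto.
  { apply (layer_profile_weaken y y1 Cy); [apply Rmax_l|exact Py]. }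
  { apply (layer_profile_weaken z z1 Cz); [apply Rmax_r|exact Pz]. }
  (* If [2 * K < L0], then [K ^ 5 <= L0 ^ 5 <= A], against [K ^ 5 = 2 * A]. *)
  set (A0 := L0 ^ 5).
  assert (HA0 : 1 <= A0) by (apply pow_R1_Rle, HL0).
  assert (Hroot : forall A, A0 <= A -> L0 <= 2 * Rpower (2 * A) (1 / 5)).
  { intros A HA. destruct (fifth_root_scales A ltac:(lra)) as [HK [K5 _]].
    set (K := Rpower (2 * A) (1 / 5)) in *.
    apply Rnot_lt_le. intros Hlt.
    assert (K ^ 5 <= L0 ^ 5) by (apply pow_incr; lra). unfold A0 in *. lra. }
  (* A single family [U] is chosen, so that the estimates and the linearized operator concern the
     same solution; for [A < A0] the value is a placeholder. *)
  assert (Hex : forall A, exists U, A0 <= A -> exists U1, let K := Rpower (2 * A) (1 / 5) in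
      (forall s, 0 <= s <= 2 * K -> is_derive U s (U1 s)) /\
      (forall s, 0 <= s <= 2 * K -> is_derive U1 s ((U s ^ 2 - hump (2 * K) s) / 2)) /\
      U 0 = 0 /\ U (2 * K) = 0 /\
      (forall s, 0 <= s <= D -> Rabs (U s - y s) <= Kc / (2 * K) * s) /\
      (forall s, D <= s <= 2 * K / 2 -> Rabs (U s - y s) <= Kc / (2 * K) * (s * sqrt s)) /\
      (forall s, 0 <= s <= D -> Rabs (U (2 * K - s) - z s) <= Kc / (2 * K) * s) /\
      (forall s, D <= s <= 2 * K / 2 -> Rabs (U (2 * K - s) - z s) <= Kc / (2 * K) * (s * sqrt s)) /\
      (forall s, D <= s <= 2 * K - D ->
         Rabs (U s - sqrt (hump (2 * K) s)) <= Kc / hump (2 * K) s ^ 2) /\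
      dirichlet_estimate (2 * K) B U).
  { intros A. destruct (Rle_lt_dec A0 A) as [HA|HA].
    - destruct (HS _ (Hroot A HA)) as [U [U1 H]]. exists U. intros _. exists U1. exact H.
    - exists y. intros H. lra. }
  destruct (choice _ Hex) as [U HU]. clear Hex HS.
  set (u := fun A x => Rpower (2 * A) (1 / 5) ^ 2
     * U A (Rpower (2 * A) (1 / 5) * x + Rpower (2 * A) (1 / 5))).
  (* [delta = 1 / 2] keeps [s = K * (x + 1)] within the half-length [L / 2 = K]. The factor [4]
     comes from the interior bound and also covers the factors [2] of [fifth_root_scales]. *)
  exists u, (1 / 2), D, (4 * Kc), A0. conjs; try lra.
  - intros A HA. destruct (HU A HA) as [U1 [F1 [F2 [F0 [FL [Q1 [Q2 [Q3 [Q4 [Q5 _]]]]]]]]]].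
    destruct (fifth_root_scales A ltac:(lra)) as [HK [K5 [R1 [R2 [R3 [_ R4]]]]]].
    unfold u. rewrite R1, R2. set (K := Rpower (2 * A) (1 / 5)) in *.
    split; [apply (unscaled_bvp (U A) U1); assumption|].
    assert (HKD : 0 < / K * D) by (apply Rmult_lt_0_compat; [apply Rinv_0_lt_compat, HK|lra]).
    assert (Near : forall t X, 0 <= t -> X <= Kc * K ^ 2 * t -> X <= 4 * Kc * Rpower A (2 / 5) * t).
    { intros t X Ht HX. eapply Rle_trans; [exact HX|]. apply Rmult_le_compat_r; [exact Ht|].
      pose proof (exp_pos (2 / 5 * ln A)) as P. fold (Rpower A (2 / 5)) in P. nra. }
    assert (Mid : forall t X, 0 < t -> X <= Kc * (K ^ 2 * sqrt K) * (t * sqrt t) ->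
      X <= 4 * Kc * Rpower A (1 / 2) * Rpower t (3 / 2)).
    { intros t X Ht HX. eapply Rle_trans; [exact HX|]. rewrite (Rpower_three_halves t Ht).
      pose proof (sqrt_pos t).
      apply Rmult_le_compat_r; [apply Rmult_le_pos; lra|].
      pose proof (exp_pos (1 / 2 * ln A)) as P. fold (Rpower A (1 / 2)) in P. nra. }
    intros x Hx.
    destruct (unscaled_layer (U A) y K Kc D (x + 1) HK ltac:(lra) HKc Q1 Q2) as [S1 S2].
    destruct (unscaled_layer (fun s => U A (2 * K - s)) z K Kc D (1 - x) HK ltac:(lra) HKc Q3 Q4)
      as [S3 S4].
    cbv beta in S3, S4.
    replace (K * (x + 1)) with (K * x + K) in * by ring.
    replace (2 * K - K * (1 - x)) with (K * x + K) in * by ring.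
    rewrite (Ey (K * x + K)) in S1, S2 by nra. rewrite (Ez (K * (1 - x))) in S3, S4 by nra.
    conjs; intros Ht.
    + apply Near; [lra|]. apply S1, Ht.
    + apply Mid; [lra|]. apply S2, Ht.
    + apply Near; [lra|]. apply S3, Ht.
    + apply Mid; [lra|]. apply S4, Ht.
    + apply (unscaled_interior (U A) A K Kc D x); auto; lra.
  - exists A0, B. conjs; try lra.
    intros A phi f HA Cphi Cf Hode Pm Pp.
    destruct (HU A ltac:(lra)) as [U1 [F1 [F2 [F0 [FL [_ [_ [_ [_ [_ FE]]]]]]]]]].
    destruct (fifth_root_scales A ltac:(lra)) as [HK [K5 [_ [_ [_ [R5 _]]]]]].
    set (K := Rpower (2 * A) (1 / 5)) in *.
    destruct (unscaled_bvp (U A) U1 A K HK K5 F1 F2 F0 FL) as [Cu _].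
    destruct (Linf_norm_continuous (-1) 1 f ltac:(lra) Cf) as [m [Em Hm]].
    rewrite Em. change (Rbar_mult (B * Rpower A (- (2 / 5))) m)
      with (Finite (B * Rpower A (- (2 / 5)) * m)).
    apply Linf_norm_le. intros x Hx.
    eapply Rle_trans; [apply (dirichlet_estimate_unscaled (U A) (u A) K B HK HB FE Cu
      (fun t _ => eq_refl) phi f Cphi Cf Hode Pm Pp m Hm x Hx)|].
    assert (Hm0 : 0 <= m) by (eapply Rle_trans; [apply Rabs_pos|apply (Hm x Hx)]).
    apply Rmult_le_compat_r; [exact Hm0|]. unfold Rdiv. apply Rmult_le_compat_l; lra.
Qed.
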